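(* Let $d\ge 1$, $R>0$ and $0<U<1$. Let $(X_t)_{t\ge 0}$ be the $\mathcal{S}_c$-valued Markov process with generator $$\mathcal{L} I_n(f;\psi)=\int_{\mathbb{R}^d}\int_{(\mathbb{R}^d)^n}\sum_{I\subset\{1,\dots,n\}}\Big(\prod_{j\notin I}\mathbf{1}_{x_j\notin B(c,R)}f(x_j)\Big)\Big(\prod_{i\in I}\mathbf{1}_{x_i\in B(c,R)}\Big)\Big[f(c)\Big(\prod_{i\in I}\big((1-U)f(x_i)+U\big)-\prod_{i\in I}f(x_i)\Big)+(1-f(c))\Big(\prod_{i\in I}(1-U)f(x_i)-\prod_{i\in I}f(x_i)\Big)\Big]\psi(x_1,\dots,x_n)\,dx_1\cdots dx_n\,dc$$ (in the precise sense given in the context). Suppose that $X_0=f\in\mathcal{S}_c$ is deterministic (with bounded support). Then there exist a random bounded set $B\subset\mathbb{R}^d$ and an almost surely finite random time $T$ such that $$\forall t>T,\quad \mathrm{Supp}(X_t)=B\quad\text{a.s.}$$ Furthermore, $$\sup_{z\in B}X_t(z)\to 0\quad\text{a.s. as }t\to\infty .$$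
   Context: $\|\cdot\|$ is the Euclidean norm on $\mathbb{R}^d$, $|A|$ is the Lebesgue measure of $A$, $B(c,r)=\{y\in\mathbb{R}^d:\|y-c\|\le r\}$, and $\mathrm{Supp}(f)$ is the support of $f$. For $A\subset\mathbb{R}^d$, $A^R:=\{x\in\mathbb{R}^d:\min_{y\in A}\|x-y\|\le R\}$ (with $\emptyset^R=\emptyset$). $\mathcal{S}_c$ is the set of Borel measurable functions $f:\mathbb{R}^d\to[0,1]$ with compact support. Test functions: for $n\ge1$ and $\psi:(\mathbb{R}^d)^n\to\mathbb{R}$ with $\int|\psi|\,dx_1\cdots dx_n<\infty$, $I_n(f;\psi)=\int_{(\mathbb{R}^d)^n}\psi(x_1,\dots,x_n)\prod_{i=1}^n f(x_i)\,dx_1\cdots dx_n$. The generator is $\mathcal{L}I(f)=\lim_{t\to0}\mathbb{E}[I(X_t)-I(X_0)\mid X_0=f]/t$. The Markov process with this generator is the (non-explosive) $\mathcal{S}_c$-valued continuous-time pure jump Markov chain with the following dynamics. When in state $f$, it waits an exponential time of rate $\lambda(f)=|(\mathrm{Supp}(f))^R|$ (the state $f\equiv 0$, for which $\lambda(f)=0$, is absorbing). It then draws, independently of the past given $f$, a point $c$ uniform on $(\mathrm{Supp}(f))^R$ and an independent $v$ uniform on $[0,1]$, and jumps to $f_{(c,v)}$, where $$f_{(c,v)}(x)=f(x)+U\,\mathbf{1}_{\{\|x-c\|\le R\}}\big(\mathbf{1}_{\{v\le f(c)\}}-f(x)\big).$$ Its paths are right-continuous step functions of $t$. (Here $X_t(y)$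 is the frequency of Red individuals at location $y$ at time $t$.) The supremum over the empty set is $0$. *)

(* Defs.v *)
From HB Require Import structures.
From mathcomp Require Import all_boot all_order all_algebra.
From mathcomp Require Import all_classical all_reals all_analysis.
From mathcomp Require Import measurable_realfun.

Set Implicit Arguments.
Unset Strict Implicit.
Unset Printing Implicit Defensive.

Import Order.TTheory GRing.Theory Num.Theory.
Import numFieldNormedType.Exports.

Local Open Scope classical_set_scope.
Local Open Scope ring_scope.

(* The library norm on ['rV[R]_d] is the sup norm; it is
   only used through its topology, its Borel sets and its bounded sets, which
   are those of the Euclidean norm. *)
Definition enorm (R : realType) (d : nat) (x : 'rV[R]_d) : R :=
  Num.sqrt (\sum_(i < d) x 0 i ^+ 2).

HB.instance Definition _ (R : realType) (m n : nat) :=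
  @isMeasurable.Build (sigma_display (@open 'M[R]_(m, n))) 'M[R]_(m, n)
    <<s @open 'M[R]_(m, n) >> (@sigma_algebra0 _ setT _)
    (@sigma_algebraC _ _) (@sigma_algebra_bigcup _ setT _).

(* A set function on all sets; it is Lebesgue measure on Borel sets, to which
   it is only ever applied here. *)
Fixpoint lebesgue_rV (R : realType) (d : nat) : set 'rV[R]_d -> \bar R :=
  match d with
  | 0 => \d_(0 : 'rV[R]_0)
  | d'.+1 =>
      pushforward (lebesgue_measure \x @lebesgue_rV R d')%E
        (fun p : R * 'rV[R]_d' => row_mx p.1%:M p.2 : 'rV[R]_(1 + d'))
  end.

Section spatial_model.
Context {R : realType} {d : nat}.

Definition supp (f : 'rV[R]_d -> R) : set 'rV[R]_d := closure [set x | f x != 0].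

Definition enlarge (r : R) (A : set 'rV[R]_d) : set 'rV[R]_d :=
  [set x | exists2 y, A y & enorm (x - y) <= r].

Definition Sc : set ('rV[R]_d -> R) :=
  [set f : 'rV[R]_d -> R | [/\ measurable_fun setT f, forall x, 0 <= f x <= 1
             & compact (supp f)]].

Definition jump_rate (r : R) (f : 'rV[R]_d -> R) : \bar R := lebesgue_rV (enlarge r (supp f)).

Definition jump (r U : R) (f : 'rV[R]_d -> R) (c : 'rV[R]_d) (v : R) : 'rV[R]_d -> R :=
  fun x => f x + U * (enorm (x - c) <= r)%R%:R * ((v <= f c)%R%:R - f x).

Definition uniform_on (A : set 'rV[R]_d) : set 'rV[R]_d -> \bar R :=
  fun C => (lebesgue_rV (C `&` A) * ((fine (lebesgue_rV A))^-1)%:E)%E.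

End spatial_model.

Section jump_chain.
Context {R : realType} {d : nat} {dO : measure_display}
  {Omega : measurableType dO}.
Variables (r U : R) (f : 'rV[R]_d -> R).
Variables (tau : nat -> Omega -> R) (c : nat -> Omega -> 'rV[R]_d)
  (v : nat -> Omega -> R).

(* [tau n], [c n] and [v n] are the waiting time, the centre and the uniform
   variable drawn in the n-th state of the chain; they are ignored as soon as
   that state is absorbing. *)
Fixpoint state (n : nat) (w : Omega) : 'rV[R]_d -> R :=
  match n with
  | 0 => f
  | n'.+1 => if jump_rate r (state n' w) == 0%E then state n' w
             else jump r U (state n' w) (c n' w) (v n' w)
  end.

Definition sojourn (n : nat) (w : Omega) : \bar R :=
  if jump_rate r (state n w) == 0%E then +oo%E else (tau n w)%:E.

Definition jump_time (n : nat) (w : Omega) : \bar R :=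
  (\sum_(k < n) sojourn k w)%E.

Definition past (n : nat) : set_system Omega :=
  <<s \bigcup_(k in `I_n)
        (preimage_set_system setT (tau k) measurable `|`
         preimage_set_system setT (c k) measurable `|`
         preimage_set_system setT (v k) measurable) >>.

(* Given the past, on the event that the n-th state g is not absorbing,
   [tau n], [c n], [v n] are independent, exponential of rate [jump_rate r g],
   uniform on [enlarge r (supp g)] and uniform on [0, 1]. *)
Definition draws_law (P : probability Omega R) : Prop :=
  forall (n : nat) (G : set Omega) (D : set R) (C : set 'rV[R]_d) (V : set R),
  past n G -> measurable D -> measurable C -> measurable V ->
  let G' := G `&` [set w | (0 < jump_rate r (state n w))%E] in
  (P (G' `&` (tau n @^-1` D `&` c n @^-1` C `&` v n @^-1` V)) =
   \int[P]_(w in G')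
     (exponential_prob (fine (jump_rate r (state n w))) D *
      uniform_on (enlarge r (supp (state n w))) C *
      uniform_prob (@ltr01 R) V))%E.

Record chain_realization (P : probability Omega R)
    (X : R -> Omega -> 'rV[R]_d -> R) : Prop := ChainRealization {
  measurable_tau : forall n, measurable_fun setT (tau n);
  measurable_c : forall n, measurable_fun setT (c n);
  measurable_v : forall n, measurable_fun setT (v n);
  chain_draws_law : draws_law P;
  chain_nonexplosive : {ae P, forall w, forall t : R,
    exists n, (t%:E < jump_time n w)%E};
  chain_path : {ae P, forall w, forall (n : nat) (t : R),
    (jump_time n w <= t%:E < jump_time n.+1 w)%E -> X t w = state n w}
}.

End jump_chain.

Definition jump_process (R : realType) (d : nat) (dO : measure_display)
    (Omega : measurableType dO) (P : probability Omega R) (r U : R)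
    (f : 'rV[R]_d -> R) (X : R -> Omega -> 'rV[R]_d -> R) : Prop :=
  (forall t w, 0 <= t -> Sc (X t w)) /\
  exists tau c v, chain_realization r U f tau c v P X.

(* Effros measurability, the usual notion for random closed sets. *)
Definition random_set (R : realType) (d : nat) (dO : measure_display)
    (Omega : measurableType dO) (B : Omega -> set 'rV[R]_d) : Prop :=
  forall G : set 'rV[R]_d, open G -> measurable [set w | B w `&` G !=set0].

(* Main.v *)
Require Import Defs.
From HB Require Import structures.
From mathcomp Require Import all_boot all_order all_algebra.
From mathcomp Require Import all_classical all_reals all_analysis.
From mathcomp Require Import measurable_realfun ring lra.

(** Write g for the current state, M for its integral, H(c) for the integral of
    g over B(c, r), and w for the volume of B(c, r).  A red jump
    (one with v <= g(c)) changes M by U (w - H(c)), any other jump changes it by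
    - U H(c), and only red jumps enlarge the support.

    - The integral of H is w M, so M is a martingale for the embedded chain.  Its
      conditional variance is U^2 / rate times the integral of the dispersion
      g (w - H)^2 + (1 - g) H^2.  If H <= w / 2 everywhere this is at least
      M w^2 / 4; otherwise H, which is uniformly continuous (uniformly in g) and
      vanishes far away, is close to w / 2 on a ball of fixed radius, and the
      integral is bounded below by a constant.
    - Hence the bounded supermartingale sat M = M / (1 + M) loses in mean at least
      (function of M) / rate at each step.  The rate grows at most linearly with
      the number of jumps, so the sum of 1 / rate diverges and E (sat M_n) has
      infimum 0.  After a red jump M >= U w, so the maximal inequality bounds the
      probability of a red jump after time n by E (sat M_n) / sat (U w): almost
      surely there are finitely many red jumps, and the support is eventually
      constant.
    - The centre falls in a given ball of radius r / 2 that meets the support with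
      probability at least constant / rate, hence infinitely often; each such jump
      multiplies the state by 1 - U on that ball, and finitely many of these
      balls cover the limit support. *)

Set Implicit Arguments.
Unset Strict Implicit.
Unset Printing Implicit Defensive.

Import Order.TTheory GRing.Theory Num.Theory.
Import numFieldNormedType.Exports.

Local Open Scope classical_set_scope.
Local Open Scope ring_scope.

(** * Euclidean norm *)

(** Since E M is constant, M cannot be shown to tend to 0 in mean: it may survive on rare events
    with a huge population. The strictly concave [sat] turns the variance of M into a loss of mean,
    and a small mean of [sat M] says only that M is small with high probability, which is all that
    the maximal inequality asks, at a single index. The variance must be bounded below in terms of M
    alone, and the obstacle is a large region filled with red: the dispersion vanishes wherever g
    and H / w are both 0 or both 1, so only the rim of such a region contributes. A rim exists
    because H has to descend through w / 2 on the way out of the support, and its thickness is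
    bounded below because the modulus of continuity of H does not depend on g. No conditional
    expectation is formed: [draws_law] speaks of product events, [freezing] extends it to functions
    of the past and of the new draw, and the one-step inequalities are integrated over arbitrary
    events of [past n]. *)

Section euclidean_norm.
Context {R : realType} {d : nat}.
Implicit Types (x y z c : 'rV[R]_d).

Lemma enorm_ge0 x : 0 <= enorm x.
Proof. exact: sqrtr_ge0. Qed.

Lemma enormN x : enorm (- x) = enorm x.
Proof. by rewrite /enorm; under eq_bigr do rewrite mxE sqrrN. Qed.

Lemma enormBC x y : enorm (x - y) = enorm (y - x).
Proof. by rewrite -enormN opprB. Qed.

Lemma enorm_sqr x : enorm x ^+ 2 = \sum_(i < d) x 0 i ^+ 2.
Proof. by rewrite sqr_sqrtr// sumr_ge0// => i _; rewrite sqr_ge0. Qed.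

Lemma enormZ (a : R) x : enorm (a *: x) = `|a| * enorm x.
Proof.
rewrite /enorm -sqrtr_sqr -sqrtrM ?sqr_ge0// mulr_sumr.
by under eq_bigr do rewrite mxE exprMn.
Qed.

Lemma enorm0 : enorm (0 : 'rV[R]_d) = 0.
Proof. by rewrite -(scale0r (0 : 'rV[R]_d)) enormZ normr0 mul0r. Qed.

Lemma enormD x y : enorm (x + y) <= enorm x + enorm y.
Proof.
have ax := enorm_ge0 x; have ay := enorm_ge0 y.
have CS : \sum_(i < d) x 0 i * y 0 i <= enorm x * enorm y.
  have [x0|x0] := eqVneq (enorm x) 0.
    rewrite x0 mul0r big1// => i _.
    have : \sum_(i < d) x 0 i ^+ 2 == 0 by rewrite -enorm_sqr x0 expr0n.
    rewrite psumr_eq0 => [/allP/(_ i)|j _]; last by rewrite sqr_ge0.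
    by rewrite mem_index_enum sqrf_eq0 => /(_ isT)/eqP ->; rewrite mul0r.
  have [y0|y0] := eqVneq (enorm y) 0.
    rewrite y0 mulr0 big1// => i _.
    have : \sum_(i < d) y 0 i ^+ 2 == 0 by rewrite -enorm_sqr y0 expr0n.
    rewrite psumr_eq0 => [/allP/(_ i)|j _]; last by rewrite sqr_ge0.
    by rewrite mem_index_enum sqrf_eq0 => /(_ isT)/eqP ->; rewrite mulr0.
  have px : 0 < enorm x by rewrite lt_neqAle eq_sym x0.
  have py : 0 < enorm y by rewrite lt_neqAle eq_sym y0.
  (* Cauchy-Schwarz: this sum of squares equals 2 |x| |y| (|x| |y| - <x, y>). The factor |x| |y| is
     divided out, hence the separate cases of zero norm above. *)
  have : 0 <= \sum_(i < d) (enorm y * x 0 i - enorm x * y 0 i) ^+ 2.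
    by apply: sumr_ge0 => i _; rewrite sqr_ge0.
  rewrite (_ : \sum_(i < d) _ = enorm y ^+ 2 * enorm x ^+ 2 +
      enorm x ^+ 2 * enorm y ^+ 2 -
      (enorm x * enorm y * (\sum_(i < d) x 0 i * y 0 i)) *+ 2); last first.
    rewrite {1}(enorm_sqr x) {2}(enorm_sqr y) !mulr_sumr -sumrMnl -big_split/=.
    by rewrite -sumrB; apply: eq_bigr => i _; ring.
  move=> h; rewrite -(ler_pM2l (mulr_gt0 px py)); nra.
rewrite -(ler_pXn2r (n := 2))// ?nnegrE ?enorm_ge0 ?addr_ge0//.
rewrite sqrrD !enorm_sqr.
under eq_bigr do rewrite mxE sqrrD.
by rewrite !big_split/= -mulr2n lerD2r lerD2l ler_pMn2r.
Qed.

Lemma enorm_triangle y x z : enorm (x - z) <= enorm (x - y) + enorm (y - z).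
Proof. by rewrite -[x - z](_ : (x - y) + (y - z) = _) ?enormD// addrA subrK. Qed.

Lemma norm_le_enorm x : `|x| <= enorm x.
Proof.
have -> : `|x| = mx_norm x by [].
rewrite mx_normrE; apply/bigmax_leP; split; first exact: enorm_ge0.
move=> [i j] _ /=; rewrite ord1 -sqrtr_sqr ler_sqrt ?sumr_ge0//; last first.
  by move=> k _; rewrite sqr_ge0.
by rewrite (bigD1 j)//= lerDl sumr_ge0// => k _; rewrite sqr_ge0.
Qed.

Lemma coord_le_norm x i : `|x 0 i| <= `|x|.
Proof.
have -> : `|x| = mx_norm x by [].
by rewrite mx_normrE; apply: (le_bigmax_cond _ (fun p => `|x p.1 p.2|) (j := (0, i))).
Qed.

Lemma enorm_le_norm x : enorm x <= Num.sqrt d%:R * `|x|.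
Proof.
rewrite -(ler_pXn2r (n := 2))// ?nnegrE ?enorm_ge0 ?mulr_ge0 ?sqrtr_ge0//.
rewrite exprMn (sqr_sqrtr (ler0n R d)) enorm_sqr.
rewrite -[X in _ <= X%:R * _](card_ord d) -sum1_card natr_sum mulr_suml.
apply: ler_sum => i _; rewrite mul1r -real_normK ?num_real//.
by rewrite lerXn2r ?nnegrE// coord_le_norm.
Qed.

Lemma enorm_continuous c : continuous (fun x => enorm (x - c)).
Proof.
move=> x; have FF : Filter (nbhs x) := nbhs_filter x.
apply/(@cvgrPdist_le _ _ _ (nbhs x) FF) => /= e e0.
(* The Euclidean norm is at most sqrt d times the sup norm; the added 1 keeps K positive in
   dimension 0. *)
pose K : R := Num.sqrt d%:R + 1.
have K0 : 0 < K by rewrite ltr_wpDl ?sqrtr_ge0.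
apply/nbhs_ballP; exists (e / K) => /=; first exact: divr_gt0.
move=> y; rewrite -ball_normE/= => /ltW yx.
apply: (@le_trans _ _ (enorm (x - y))).
  have := enorm_triangle y x c; have := enorm_triangle x y c.
  by rewrite (enormBC y x) ler_norml => ? ?; apply/andP; split; lra.
apply: (le_trans (enorm_le_norm _)).
rewrite ler_pdivlMr// in yx; apply: le_trans yx.
by rewrite mulrC ler_wpM2l// /K lerDl.
Qed.

Definition eball c (rho : R) : set 'rV[R]_d := [set x | enorm (x - c) <= rho].

Lemma closed_eball c rho : closed (eball c rho).
Proof.
rewrite (_ : eball c rho = (fun x => enorm (x - c)) @^-1` [set t | t <= rho])//.
by apply: closed_comp => [x _|]; [exact: enorm_continuous|exact: closed_le].
Qed.

Lemma open_eball c rho : open [set x | enorm (x - c) < rho].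
Proof.
rewrite (_ : [set x | _] = (fun x => enorm (x - c)) @^-1` [set t | t < rho])//.
by apply: open_comp => [x _|]; [exact: enorm_continuous|exact: open_lt].
Qed.

Lemma bounded_eball c rho : bounded_set (eball c rho).
Proof.
exists (rho + enorm c); split; first exact: num_real.
move=> M hM x xc; apply: le_trans (ltW hM).
rewrite (le_trans (norm_le_enorm _))// -[x in enorm x](subrK c).
by rewrite (le_trans (enormD _ _))// lerD2r.
Qed.

Lemma compact_eball c rho : compact (eball c rho).
Proof.
by apply: bounded_closed_compact; [exact: bounded_eball|exact: closed_eball].
Qed.

Lemma enlarge_eball c (a b : R) : 0 < a -> 0 < b -> enlarge a (eball c b) = eball c (a + b).
Proof.
move=> a0 b0; apply/seteqP; split => x /=.
  move=> [y yc xy]; apply: (le_trans (enorm_triangle y _ _)).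
  exact: lerD.
rewrite /eball/= => xc; have ab : 0 < a + b by rewrite addr_gt0.
have ab0 : a + b != 0 by rewrite gt_eqF.
have be : 0 <= b / (a + b) by apply: divr_ge0; apply: ltW.
have ae : 0 <= a / (a + b) by apply: divr_ge0; apply: ltW.
(* The point dividing the segment from c to x in the ratio b : a is within b of c and within a of
   x. *)
exists (c + (b / (a + b)) *: (x - c)); rewrite /eball/=.
  rewrite addrC addKr enormZ ger0_norm//.
  by rewrite mulrAC ler_pdivrMr// ler_wpM2l// ltW.
have -> : x - (c + (b / (a + b)) *: (x - c)) = (a / (a + b)) *: (x - c).
  rewrite opprD addrA -{1}[x - c]scale1r -scalerBl; congr (_ *: _); field.
  done.
rewrite enormZ ger0_norm//.
by rewrite mulrAC ler_pdivrMr// ler_wpM2l// ltW.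
Qed.

Lemma enlargeU (a : R) (A B : set 'rV[R]_d) :
  enlarge a (A `|` B) = enlarge a A `|` enlarge a B.
Proof.
apply/seteqP; split => x /=.
  by move=> [y [Ay|By] xy]; [left|right]; exists y.
by move=> [[y Ay xy]|[y By xy]]; exists y => //; [left|right].
Qed.

(** [enlarge] is defined by a weak inequality, but inside an open set the witness can be pushed
    towards x, which makes the inequality strict; the enlargement is then a union of open balls. *)
Lemma open_enlarge (a : R) (G : set 'rV[R]_d) : 0 < a -> open G -> open (enlarge a G).
Proof.
move=> a0 oG.
rewrite (_ : enlarge a G = \bigcup_(y in G) [set x | enorm (x - y) < a]).
  by apply: bigcup_open => y _; exact: open_eball.
apply/seteqP; split => x [y Gy] /= xy; last by exists y => //; exact: ltW.
have /nbhs_ballP[e /= e0 eG] : nbhs y G by apply: open_nbhs_nbhs.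
(* move [y] towards [x] by a factor [1 - t] *)
pose t : R := Num.min (1 / 2) (e / (2 * (a + 1))).
have t0 : 0 < t by rewrite lt_min; apply/andP; split; [|apply: divr_gt0]; lra.
have t1 : t <= 1 / 2 by rewrite ge_min lexx.
have te : t * (a + 1) <= e / 2.
  have : t <= e / (2 * (a + 1)) by rewrite ge_min lexx orbT.
  rewrite ler_pdivlMr; last lra.
  lra.
exists (y + t *: (x - y)).
  apply: eG; rewrite -ball_normE/=.
  rewrite opprD addrA subrr sub0r normrN (le_lt_trans (norm_le_enorm _))//.
  rewrite enormZ gtr0_norm//; have := enorm_ge0 (x - y); nra.
rewrite /= opprD addrA -{1}[x - y]scale1r -scalerBl enormZ gtr0_norm; last lra.
have := enorm_ge0 (x - y); nra.
Qed.

End euclidean_norm.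

(** * Borel sets and Lebesgue measure *)

Section borel_rV.
Context {R : realType} {d : nat}.

Lemma open_measurable_rV (A : set 'rV[R]_d) : open A -> measurable A.
Proof. by move=> oA; exact: sub_sigma_algebra. Qed.

Lemma closed_measurable_rV (A : set 'rV[R]_d) : closed A -> measurable A.
Proof.
move=> cA; rewrite -(setCK A); apply: measurableC; apply: open_measurable_rV.
exact: closed_openC.
Qed.

Lemma continuous_measurable_rV (g : 'rV[R]_d -> R) :
  continuous g -> measurable_fun setT g.
Proof.
move=> /continuousP cg; apply: (measurability _ (RGenOpens.measurableE R)).
move=> _ [_ [a [b ->] <-]]; rewrite setTI; apply: open_measurable_rV.
exact/cg/interval_open.
Qed.

Lemma measurable_coord (i : 'I_d) : measurable_fun setT (fun x : 'rV[R]_d => x 0 i).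
Proof. by apply: continuous_measurable_rV; exact: coord_continuous. Qed.

(** An open set is the union of the countably many boxes with rational centre and radius 1 / (k + 1)
    that it contains, and the preimage of a box is a finite intersection of coordinate events. *)
Lemma measurable_fun_rV {dT : measure_display} {T : measurableType dT}
    (h : T -> 'rV[R]_d) :
  (forall i, measurable_fun setT (fun t => h t 0 i)) -> measurable_fun setT h.
Proof.
move=> mh; apply: (measurability (@open 'rV[R]_d)) => //.
move=> _ [G oG <-]; rewrite setTI.
pose bx (p : 'rV[rat]_d * nat) : set 'rV[R]_d :=
  [set x | forall i, `|x 0 i - ratr (p.1 0 i)| < p.2.+1%:R^-1].
rewrite (_ : h @^-1` G = \bigcup_(p in [set p | bx p `<=` G])
    \bigcap_(i in [set: 'I_d]) [set t | `|h t 0 i - ratr (p.1 0 i)| < p.2.+1%:R^-1]).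
  rewrite bigcup_mkcond; apply: countable_bigcupT_measurable => // p.
  case: ifP => // _; apply: fin_bigcap_measurable => // i _.
  rewrite -[X in measurable X]setTI.
  have mf : measurable_fun setT (fun t => `|h t 0 i - ratr (p.1 0 i)|).
    by apply: measurableT_comp => //; apply: measurable_funB.
  have := mf measurableT _ (measurable_itv `]-oo, p.2.+1%:R^-1[).
  by congr measurable; apply/seteqP; split => t /=; rewrite in_itv.
apply/seteqP; split => [t Gt|t [p pG tp]]; last first.
  by apply: (pG (h t)) => i; exact: tp.
have /nbhs_ballP[e /= e0 eG] : nbhs (h t) G by apply: open_nbhs_nbhs.
(* Half of e, because both [h t] and the other points of the box are within 1 / (k + 1) of the
   rational centre. *)
have [k ke] : exists k, k.+1%:R^-1 < e / 2.
  have [k _ /(_ k)] := near_infty_natSinv_lt (PosNum (divr_gt0 e0 (ltr0n R 2))).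
  by move=> /(_ (leqnn _)); exists k.
have /choice[q hq] : forall i : 'I_d, exists q : rat, `|h t 0 i - ratr q| < k.+1%:R^-1.
  move=> i; have [|q] := @rat_in_itvoo R (h t 0 i - k.+1%:R^-1) (h t 0 i + k.+1%:R^-1).
    by rewrite ltrD2l gtrN// invr_gt0.
  rewrite in_itv/= => /andP[q1 q2]; exists q; rewrite ltr_norml.
  by move: q1 q2; set u := _^-1 => q1 q2; apply/andP; split; lra.
exists (\row_i q i, k) => [x /= xq|i _ /=]; last by rewrite mxE.
apply: eG; split=> // i j; rewrite ord1 -ball_normE/=.
have := xq j; have := hq j; move: ke; rewrite mxE !ltr_norml; set u := _^-1.
move=> ? /andP[? ?] /andP[? ?].
by apply/andP; split; lra.
Qed.

Lemma measurable_enormB {dT : measure_display} {T : measurableType dT}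
    (h1 h2 : T -> 'rV[R]_d) :
  measurable_fun setT h1 -> measurable_fun setT h2 ->
  measurable_fun setT (fun t => enorm (h1 t - h2 t)).
Proof.
move=> m1 m2.
have mh : measurable_fun setT (fun t => h1 t - h2 t).
  apply: measurable_fun_rV => i.
  rewrite (_ : (fun t => _) = (fun t => h1 t 0 i - h2 t 0 i)); last first.
    by apply/funext => t; rewrite !mxE.
  by apply: measurable_funB; [exact: (measurableT_comp (measurable_coord i) m1)|
    exact: (measurableT_comp (measurable_coord i) m2)].
have me : measurable_fun setT (@enorm R d).
  apply: continuous_measurable_rV.
  rewrite (_ : @enorm R d = (fun x => enorm (x - 0))); first exact: enorm_continuous.
  by apply/funext => x; rewrite subr0.
exact: (measurableT_comp me mh).
Qed.

End borel_rV.

(** Keeping the bundled measure under an existential, together with its equation, lets an induction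
    on the dimension carry it along. *)
Lemma sigma_finite_measureP {R : realType} {dT : measure_display}
    {T : measurableType dT} (f : set T -> \bar R) :
  f set0 = 0%E -> (forall A, (0 <= f A)%E) -> semi_sigma_additive f ->
  sigma_finite setT f ->
  exists m : {sigma_finite_measure set T -> \bar R}, (m : set T -> \bar R) = f.
Proof.
move=> f0 fge0 fsa fsf.
pose M1 := isMeasure.Build _ _ _ f f0 fge0 fsa.
pose M : {measure set T -> \bar R} := HB.pack f M1.
pose M2 := isSigmaFinite.Build _ _ _ f fsf.
pose M3 := isSFinite.Build _ _ _ f
  (@sfinite_measure_sigma_finite _ _ _ M fsf).
pose N : {sigma_finite_measure set T -> \bar R} := HB.pack f M1 M2 M3.
by exists N.
Qed.

Section lebesgue_rV_measure.
Context {R : realType}.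

Lemma measurable_row_mx (d : nat) :
  measurable_fun setT (fun p : measurableTypeR R * 'rV[R]_d => row_mx p.1%:M p.2 : 'rV[R]_(1 + d)).
Proof.
apply: measurable_fun_rV => i.
case: (split_ordP i) => j ->.
  rewrite (_ : (fun t => _) = fst); first exact: measurable_fst.
  by apply/funext => t; rewrite row_mxEl ord1 mxE eqxx.
rewrite (_ : (fun t => _) = (fun x : 'rV[R]_d => x 0 j) \o snd).
  by apply: measurableT_comp; [exact: measurable_coord|exact: measurable_snd].
by apply/funext => t; rewrite row_mxEr.
Qed.

(** Sigma-finiteness belongs to the induction: it is what makes the product with the
    lower-dimensional measure a measure again. *)
Lemma lebesgue_rV_sigma_finite_measure (d : nat) :
  exists m : {sigma_finite_measure set 'rV[R]_d -> \bar R},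
    (m : set 'rV[R]_d -> \bar R) = @lebesgue_rV R d.
Proof.
elim: d => [|d [m mE]]; first by exists (\d_(0 : 'rV[R]_0) : {finite_measure set _ -> \bar R}).
rewrite /= -mE.
pose g (p : measurableTypeR R * 'rV[R]_d) := row_mx p.1%:M p.2 : 'rV[R]_(1 + d).
have mg : measurable_fun setT g := @measurable_row_mx d.
pose nu := (lebesgue_measure \x m)%E.
pose gM := isMeasurableFun.Build _ _ _ _ g mg.
pose G : {mfun _ >-> _} := HB.pack g gM.
(* [h] inverts [g], so the preimages under [h] of rectangles of finite measure exhaust the new
   space. *)
pose h (x : 'rV[R]_(1 + d)) : measurableTypeR R * 'rV[R]_d := (lsubmx x 0 0, rsubmx x).
have mh : measurable_fun setT h.
  apply: measurable_fun_pair.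
    by under eq_fun do rewrite mxE; exact: measurable_coord.
  by apply: measurable_fun_rV => i; under eq_fun do rewrite mxE; exact: measurable_coord.
have gK : cancel g h.
  by move=> [a y]; rewrite /h /g/= row_mxKl row_mxKr mxE eqxx.
have hK : cancel h g.
  move=> x; rewrite /h /g/= -[RHS]hsubmxK; congr row_mx.
  by apply/rowP => i; rewrite ord1 mxE eqxx.
have p0 : pushforward nu g set0 = 0%E by exact: (@measure0 _ _ _ (pushforward nu G)).
have pge0 A : (0 <= pushforward nu g A)%E by exact: (measure_ge0 (pushforward nu G)).
have psa : semi_sigma_additive (pushforward nu g).
  exact: (@measure_semi_sigma_additive _ _ _ (pushforward nu G)).
have psf : sigma_finite setT (pushforward nu g).
  have /sigma_finiteP[F [FT Fnd Ffin]] := sigma_finiteT (@lebesgue_measure R).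
  have /sigma_finiteP[F' [FT' Fnd' Ffin']] := sigma_finiteT m.
  exists (fun n => h @^-1` (F n `*` F' n)).
    rewrite -preimage_bigcup (_ : \bigcup_n _ = setT) ?preimage_setT//.
    rewrite predeqE => -[x y]; split => // _.
    have [n _ Fnx] : (\bigcup_n F n) x by rewrite -FT.
    have [k _ Fky] : (\bigcup_n F' n) y by rewrite -FT'.
    exists (maxn n k) => //; split => /=.
      by move: x Fnx; apply/subsetPset/Fnd; exact: leq_maxl.
    by move: y Fky; apply/subsetPset/Fnd'; exact: leq_maxr.
  move=> n; have [mFn Fnoo] := Ffin n; have [mFn' Fnoo'] := Ffin' n; split.
    by rewrite -[X in measurable X]setTI; apply: mh => //; exact: measurableX.
  rewrite /pushforward -comp_preimage (_ : h \o g = id); last first.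
    by apply/funext => p; exact: gK.
  rewrite preimage_id /nu product_measure1E// lte_mul_pinfty//.
  by rewrite ge0_fin_numE.
exact: sigma_finite_measureP.
Qed.

Section instances.
Variable d : nat.
Local Notation mu := (@lebesgue_rV R d).

Let mu0 : mu set0 = 0%E.
Proof. by have [m <-] := lebesgue_rV_sigma_finite_measure d; exact: measure0. Qed.

Let mu_ge0 A : (0 <= mu A)%E.
Proof. by have [m <-] := lebesgue_rV_sigma_finite_measure d; exact: measure_ge0. Qed.

Let mu_sigma_additive : semi_sigma_additive mu.
Proof.
by have [m <-] := lebesgue_rV_sigma_finite_measure d; exact: measure_semi_sigma_additive.
Qed.

HB.instance Definition _ := isMeasure.Build _ _ _ mu mu0 mu_ge0 mu_sigma_additive.

Let mu_sigma_finite : sigma_finite setT mu.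
Proof.
by have [m <-] := lebesgue_rV_sigma_finite_measure d; exact: sigma_finiteT.
Qed.

HB.instance Definition _ := Measure_isSigmaFinite.Build _ _ _ mu mu_sigma_finite.

End instances.

End lebesgue_rV_measure.

(** * Translation invariance; volumes of cubes and balls *)

Section lebesgue_rV_translation.
Context {R : realType}.

Lemma lebesgue_measure_shift (a : R) (A : set R) : measurable A ->
  pushforward lebesgue_measure (fun t : measurableTypeR R => (t + a : measurableTypeR R)) A
    = lebesgue_measure A.
Proof.
have ms : measurable_fun setT (fun t : measurableTypeR R => (t + a : measurableTypeR R)).
  exact: (@measurable_funD _ _ _ setT id (cst a)).
move=> mA; apply/esym/lebesgue_measure_unique => //= _ [[x y]] _ <-.
rewrite /pushforward (_ : _ @^-1` _ = [set` Interval (BRight (x - a)) (BRight (y - a))]).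
  by rewrite !lebesgue_measure_itv/= !lte_fin ltrD2r -!EFinB opprB addrA subrK.
by apply/seteqP; split => t /=; rewrite !in_itv/= ltrBlDr lerBrDr.
Qed.

Lemma lebesgue_rV_section (d : nat) (A : set 'rV[R]_d.+1) :
  lebesgue_rV A = (\int[@lebesgue_measure R]_t
    lebesgue_rV [set y : 'rV[R]_d | A (row_mx t%:M y : 'rV[R]_(1 + d))])%E.
Proof.
rewrite /= /pushforward /product_measure1; apply: eq_integral => t _ /=.
by congr lebesgue_rV; apply/seteqP; split => y /=; rewrite /xsection/= inE.
Qed.

(** Slice along the first coordinate: each slice is translated by [a'], which the induction absorbs,
    and the outer variable by [a0], which is invariance on the line. *)
Lemma lebesgue_rV_shift (d : nat) (a : 'rV[R]_d) (A : set 'rV[R]_d) :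
  measurable A -> lebesgue_rV ((fun x => x + a) @^-1` A) = lebesgue_rV A.
Proof.
elim: d a A => [|d IH] a A mA.
  have E x : x + a = x by rewrite [LHS]thinmx0 [RHS]thinmx0.
  by rewrite (_ : _ @^-1` A = A)//; apply/seteqP; split => x; rewrite /preimage/= E.
rewrite 2!lebesgue_rV_section.
pose a0 : R := a 0 0; pose a' : 'rV[R]_d := @rsubmx _ 1 1 d a.
have aE : a = row_mx a0%:M a'.
  apply/rowP => i; case: (@split_ordP 1 d i) => j ->.
    rewrite [RHS](@row_mxEl _ 1 1 d) ord1 mxE eqxx mulr1n; congr (a _ _).
    exact/val_inj.
  by rewrite [RHS](@row_mxEr _ 1 1 d) mxE.
have addE t y : (row_mx t%:M y : 'rV[R]_d.+1) + a = row_mx (t + a0)%:M (y + a').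
  by rewrite {1}aE raddfD/=; exact: (@add_row_mx _ 1 1 d).
pose F t := lebesgue_rV [set y : 'rV[R]_d | A (row_mx t%:M y : 'rV[R]_(1 + d))].
have mB : measurable ((fun p : measurableTypeR R * 'rV[R]_d =>
    row_mx p.1%:M p.2 : 'rV[R]_(1 + d)) @^-1` A).
  by rewrite -[X in measurable X]setTI; exact: measurable_row_mx.
have mF : measurable_fun [set: measurableTypeR R] F.
  have := measurable_fun_xsection (@lebesgue_rV R d) mB.
  congr measurable_fun; apply/funext => t; rewrite /F/=; congr lebesgue_rV.
  by apply/seteqP; split => y /=; rewrite /xsection/= inE.
have mA' t : measurable [set y : 'rV[R]_d | A (row_mx t%:M y : 'rV[R]_(1 + d))].
  have := measurable_xsection t mB.
  by congr measurable; apply/seteqP; split => y /=; rewrite /xsection/= inE.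
transitivity (\int[@lebesgue_measure R]_t F (t + a0)%R)%E.
  apply: eq_integral => t _; rewrite /F -[RHS](IH a')//.
  by congr lebesgue_rV; apply/seteqP; split => y; rewrite /preimage/= addE.
have ms : measurable_fun setT (fun t : measurableTypeR R => (t + a0 : measurableTypeR R)).
  exact: (@measurable_funD _ _ _ setT id (cst a0)).
have := ge0_integral_pushforward ms (@lebesgue_measure R) measurableT mF.
rewrite preimage_setT => <-; last by move=> t _; exact: measure_ge0.
by apply: eq_measure_integral => B mB' _; exact: lebesgue_measure_shift.
Qed.

Lemma row_mx_ord0 (d : nat) (t : R) (y : 'rV[R]_d) :
  (row_mx t%:M y : 'rV[R]_(1 + d)) 0 (ord0 : 'I_d.+1) = t.
Proof.
rewrite (_ : (ord0 : 'I_d.+1) = lshift d (ord0 : 'I_1)); last exact/val_inj.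
by rewrite [LHS](@row_mxEl _ 1 1 d) mxE eqxx.
Qed.

Lemma row_mx_lift (d : nat) (t : R) (y : 'rV[R]_d) i :
  (row_mx t%:M y : 'rV[R]_(1 + d)) 0 (lift ord0 i : 'I_d.+1) = y 0 i.
Proof.
rewrite (_ : (lift ord0 i : 'I_d.+1) = rshift 1 i); last exact/val_inj.
by rewrite [LHS](@row_mxEr _ 1 1 d).
Qed.

Lemma lebesgue_rV_cube (d : nat) (K : R) : 0 <= K ->
  lebesgue_rV [set x : 'rV[R]_d | forall i, `|x 0 i| <= K] = ((2 * K) ^+ d)%:E.
Proof.
move=> K0; elim: d => [|d IH].
  rewrite expr0 /= diracE mem_set//= => i; by case: i.
rewrite lebesgue_rV_section.
transitivity (\int[@lebesgue_measure R]_t ((\1_(`[-K, K]) t)%:E * ((2 * K) ^+ d)%:E))%E.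
  apply: eq_integral => t _; rewrite indicE; case: (boolP (t \in _)) => [|] tK.
    rewrite mul1e -IH; congr lebesgue_rV.
    apply/seteqP; split => y /= yK i.
      by have := yK (lift ord0 i); rewrite row_mx_lift.
    case: (unliftP ord0 i) => [j|] ->; rewrite ?row_mx_lift// row_mx_ord0.
    by move: tK; rewrite inE/= in_itv/= ler_norml.
  rewrite mul0e -(measure0 (@lebesgue_rV R d)); congr lebesgue_rV.
  rewrite -subset0 => y /= /(_ ord0); rewrite row_mx_ord0.
  by move: tK; rewrite notin_setE/= in_itv/= ler_norml => /negP/negbTE ->.
rewrite ge0_integralZr ?lee_fin ?exprn_ge0 ?mulr_ge0//; last exact/measurable_EFinP.
rewrite integral_indic// setIT/= lebesgue_measure_itv/= lte_fin.
case: ifPn => [_|].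
  by rewrite -EFinB -EFinM exprS; congr (_ * _)%:E; ring.
(* For K = 0 the interval degenerates to a point, and the factor 2 K makes the right-hand side 0 as
   well. *)
rewrite -leNgt => KK; have -> : K = 0 by lra.
by rewrite mul0e mulr0 exprS mul0r.
Qed.

Section balls.
Context {d : nat}.
Implicit Types (c : 'rV[R]_d) (A : set 'rV[R]_d).

Lemma measurable_cube (K : R) :
  measurable [set x : 'rV[R]_d | forall i, `|x 0 i| <= K].
Proof.
rewrite (_ : [set x | _] =
    \bigcap_(i in [set: 'I_d]) [set x : 'rV[R]_d | `|x 0 i| <= K]); last first.
  by apply/seteqP; split => x /= h i; [move=> _|]; exact: h.
apply: fin_bigcap_measurable => // i _; apply: closed_measurable_rV.
rewrite (_ : [set x | _] =
  (fun x : 'rV[R]_d => `|x 0 i|) @^-1` [set t | t <= K])//.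
apply: closed_comp => [x _|]; last exact: closed_le.
by apply: continuous_comp; [exact: coord_continuous|exact: norm_continuous].
Qed.

Lemma lebesgue_rV_bounded A : measurable A -> bounded_set A -> (lebesgue_rV A < +oo)%E.
Proof.
move=> mA [M [_ /(_ (Num.max (M + 1) 0))]].
rewrite lt_max ltrDl ltr01 => /(_ isT) AM.
have K0 : 0 <= Num.max (M + 1) 0 by rewrite le_max lexx orbT.
apply: le_lt_trans (ltry ((2 * Num.max (M + 1) 0) ^+ d)); rewrite -lebesgue_rV_cube//.
apply: le_measure; rewrite ?inE//; [exact: measurable_cube|].
by move=> x /AM xM i; exact: le_trans (coord_le_norm _ _) xM.
Qed.

Lemma measurable_eball c rho : measurable (eball c rho).
Proof. by apply: closed_measurable_rV; exact: closed_eball. Qed.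

Definition ball_vol (rho : R) : R := fine (lebesgue_rV (eball (0 : 'rV[R]_d) rho)).

Lemma lebesgue_rV_eball c rho : lebesgue_rV (eball c rho) = (ball_vol rho)%:E.
Proof.
rewrite /ball_vol fineK; last first.
  rewrite ge0_fin_numE//; apply: lebesgue_rV_bounded.
    exact: measurable_eball.
  exact: bounded_eball.
rewrite -[RHS](lebesgue_rV_shift (- c) (measurable_eball _ _)); congr lebesgue_rV.
by apply/seteqP; split => x; rewrite /eball/= subr0.
Qed.

Lemma ball_vol_ge0 rho : 0 <= ball_vol rho.
Proof. exact: fine_ge0. Qed.

Lemma ball_vol_gt0 rho : 0 < rho -> 0 < ball_vol rho.
Proof.
(* The cube of half-side K lies in the ball, since the Euclidean norm is at most sqrt d times the
   sup norm. *)
move=> rho0; pose K := rho / (Num.sqrt d%:R + 1).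
have s0 : 0 <= Num.sqrt (d%:R : R) by exact: sqrtr_ge0.
have K0 : 0 < K by rewrite divr_gt0// ltr_wpDl.
rewrite -lte_fin -(lebesgue_rV_eball 0); apply: (@lt_le_trans _ _ ((2 * K) ^+ d)%:E).
  by rewrite lte_fin exprn_gt0// mulr_gt0.
rewrite -(lebesgue_rV_cube _ (ltW K0)); apply: le_measure; rewrite ?inE//.
- exact: measurable_cube.
- exact: measurable_eball.
move=> x /= xK; rewrite /eball/= subr0 (le_trans (enorm_le_norm _))//.
have xK' : `|x| <= K.
  have -> : `|x| = mx_norm x by [].
  rewrite mx_normrE; apply/bigmax_leP; split => [|[i j] _ /=]; first exact: ltW.
  by rewrite ord1; exact: xK.
have -> : rho = K * (Num.sqrt d%:R + 1) by rewrite /K divfK// gt_eqF// ltr_wpDl.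
by rewrite mulrC ler_pM// lerDl.
Qed.

End balls.
End lebesgue_rV_translation.

(** * Mass of a density *)

Lemma measurable_natb {R : realType} {dT : measure_display} {T : measurableType dT}
    (b : T -> bool) :
  measurable_fun setT b -> measurable_fun setT (fun t => (b t)%:R : R).
Proof.
move=> mb; rewrite (_ : (fun t => _) = (fun t => if b t then 1 else 0)).
  by apply: measurable_fun_ifT.
by apply/funext => t; case: (b t).
Qed.

Section mass.
Context {R : realType} {d : nat}.
Variable r : R.
Hypothesis r0 : 0 < r.
Implicit Types (g : 'rV[R]_d -> R) (c x : 'rV[R]_d).
Local Notation mu := (@lebesgue_rV R d).
Local Notation w := (@ball_vol R d r).

Definition kern c x : R := (enorm (x - c) <= r)%R%:R.

Definition mass g : R := fine (\int[mu]_x (g x)%:E)%E.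

(** H(c) in the overview, as [mass] is M. Taking [fine] loses nothing on [Sc], by [lmassE]. *)
Definition lmass g c : R := fine (\int[mu]_x (g x * kern c x)%:E)%E.

Lemma kernC c x : kern c x = kern x c.
Proof. by rewrite /kern enormBC. Qed.

Lemma kern_itv c x : 0 <= kern c x <= 1.
Proof. by rewrite /kern; case: (enorm _ <= _)%R; rewrite ?lexx ler01. Qed.

Lemma kern_indic c : kern c = \1_(eball c r).
Proof.
apply/funext => x; rewrite indicE /kern; congr ((nat_of_bool _)%:R).
by apply/idP/idP; rewrite inE.
Qed.

Lemma measurable_kern {dT : measure_display} {T : measurableType dT}
    (h1 h2 : T -> 'rV[R]_d) :
  measurable_fun setT h1 -> measurable_fun setT h2 ->
  measurable_fun setT (fun t => kern (h1 t) (h2 t)).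
Proof.
move=> m1 m2; apply: measurable_natb.
by apply: measurable_fun_ler => //; exact: measurable_enormB.
Qed.

Lemma Sc_measurable g : Sc g -> measurable_fun setT g. Proof. by case. Qed.

Lemma Sc_ge0 g x : Sc g -> 0 <= g x. Proof. by case=> _ /(_ x)/andP[]. Qed.

Lemma Sc_le1 g x : Sc g -> g x <= 1. Proof. by case=> _ /(_ x)/andP[]. Qed.

Lemma notin_supp g x : ~ supp g x -> g x = 0.
Proof. by move=> gx; apply/eqP/negPn/negP => gx0; apply: gx; exact: subset_closure. Qed.

Lemma closed_supp g : closed (supp g). Proof. exact: closed_closure. Qed.

Lemma measurable_supp g : measurable (supp g).
Proof. by apply: closed_measurable_rV; exact: closed_supp. Qed.

Lemma Sc_bounded_supp g : Sc g -> bounded_set (supp g).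
Proof. by case=> _ _ /compact_bounded. Qed.

(** The enlargement is the image of the compact product of A and a ball under addition. *)
Lemma compact_enlarge (A : set 'rV[R]_d) : compact A -> compact (enlarge r A).
Proof.
move=> cA.
rewrite (_ : enlarge r A = (fun p : 'rV[R]_d * 'rV[R]_d => p.1 + p.2) @` (A `*` eball 0 r)).
  apply: continuous_compact; last by apply: compact_setX => //; exact: compact_eball.
  by apply: continuous_subspaceT => p; apply: cvgD; [exact: cvg_fst|exact: cvg_snd].
apply/seteqP; split => [x [y Ay xy]|_ [[y z] [/= Ay zr] <-]].
  by exists (y, x - y) => /=; [split=> //; rewrite /eball/= subr0|rewrite addrC subrK].
by exists y => //; rewrite addrC addKr; rewrite /eball/= subr0 in zr.
Qed.

Lemma Sc_enlarge_measurable g : Sc g -> measurable (enlarge r (supp g)).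
Proof.
case=> _ _ /compact_enlarge cE; apply: closed_measurable_rV.
exact: compact_closed (@norm_hausdorff _ _) cE.
Qed.

Lemma Sc_enlarge_lty g : Sc g -> (mu (enlarge r (supp g)) < +oo)%E.
Proof.
move=> hg; apply: lebesgue_rV_bounded; first exact: Sc_enlarge_measurable.
by apply: compact_bounded; apply: compact_enlarge; case: hg.
Qed.

Lemma Sc_integral_lty g : Sc g -> (\int[mu]_x (g x)%:E < +oo)%E.
Proof.
move=> hg.
apply: (@le_lt_trans _ _ (\int[mu]_x (\1_(supp g) x)%:E)%E); last first.
  rewrite integral_indic//; last exact: measurable_supp.
  by rewrite setIT; apply: lebesgue_rV_bounded; [exact: measurable_supp|exact: Sc_bounded_supp].
apply: ge0_le_integral => //.
- by move=> x _; rewrite lee_fin (Sc_ge0 x hg).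
- by apply/measurable_EFinP; exact: Sc_measurable.
- by apply/measurable_EFinP; exact: (measurable_indic (measurable_supp g)).
move=> x _; rewrite lee_fin indicE; case: (boolP (x \in supp g)) => [_|].
  exact: Sc_le1.
by rewrite notin_setE => /notin_supp ->.
Qed.

Lemma massE g : Sc g -> (mass g)%:E = (\int[mu]_x (g x)%:E)%E.
Proof.
move=> hg; rewrite fineK// ge0_fin_numE ?Sc_integral_lty//.
by apply: integral_ge0 => x _; rewrite lee_fin Sc_ge0.
Qed.

Lemma mass_ge0 g : Sc g -> 0 <= mass g.
Proof.
move=> hg; apply: fine_ge0; apply: integral_ge0 => x _.
by rewrite lee_fin Sc_ge0.
Qed.

Lemma measurable_gkern g c : Sc g -> measurable_fun setT (fun x => g x * kern c x).
Proof.
move=> hg; apply: measurable_funM; first exact: Sc_measurable.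
exact: measurable_kern.
Qed.

Lemma gkern_ge0 g c x : Sc g -> 0 <= g x * kern c x.
Proof. move=> hg; have /andP[k0 k1] := kern_itv c x. apply: mulr_ge0 => //; exact: Sc_ge0. Qed.

Lemma gkern_le g c x : Sc g -> g x * kern c x <= g x.
Proof.
by move=> hg; have /andP[k0 k1] := kern_itv c x; rewrite ler_piMr ?Sc_ge0.
Qed.

Lemma gkern_le_kern g c x : Sc g -> g x * kern c x <= kern c x.
Proof.
by move=> hg; have /andP[k0 k1] := kern_itv c x; rewrite ler_piMl ?Sc_le1.
Qed.

Lemma lmassE g c : Sc g -> (lmass g c)%:E = (\int[mu]_x (g x * kern c x)%:E)%E.
Proof.
move=> hg; rewrite fineK// ge0_fin_numE; last first.
  by apply: integral_ge0 => x _; rewrite lee_fin gkern_ge0.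
apply: le_lt_trans (Sc_integral_lty hg); apply: ge0_le_integral => //.
- by move=> x _; rewrite lee_fin gkern_ge0.
- by apply/measurable_EFinP; exact: measurable_gkern.
- by apply/measurable_EFinP; exact: Sc_measurable.
by move=> x _; rewrite lee_fin gkern_le.
Qed.

Lemma integral_kern c : (\int[mu]_x (kern c x)%:E = w%:E)%E.
Proof.
rewrite kern_indic integral_indic ?setIT//; first exact: lebesgue_rV_eball.
exact: measurable_eball.
Qed.

Lemma lmass_ge0 g c : Sc g -> 0 <= lmass g c.
Proof.
by move=> hg; apply: fine_ge0; apply: integral_ge0 => x _; rewrite lee_fin gkern_ge0.
Qed.

Lemma lmass_le_mass g c : Sc g -> lmass g c <= mass g.
Proof.
move=> hg; rewrite -lee_fin lmassE// massE//; apply: ge0_le_integral => //.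
- by move=> x _; rewrite lee_fin gkern_ge0.
- by apply/measurable_EFinP; exact: measurable_gkern.
- by apply/measurable_EFinP; exact: Sc_measurable.
by move=> x _; rewrite lee_fin gkern_le.
Qed.

Lemma lmass_le_vol g c : Sc g -> lmass g c <= w.
Proof.
move=> hg; rewrite -lee_fin lmassE// -(integral_kern c); apply: ge0_le_integral => //.
- by move=> x _; rewrite lee_fin gkern_ge0.
- by apply/measurable_EFinP; exact: measurable_gkern.
- by apply/measurable_EFinP; exact: measurable_kern.
by move=> x _; rewrite lee_fin gkern_le_kern.
Qed.

Lemma measurable_gkern2 g : Sc g ->
  measurable_fun setT (fun p : 'rV[R]_d * 'rV[R]_d => (g p.2 * kern p.1 p.2)%:E).
Proof.
move=> hg; apply/measurable_EFinP; apply: measurable_funM.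
  exact: (measurableT_comp (Sc_measurable hg) measurable_snd).
by apply: measurable_kern; [exact: measurable_fst|exact: measurable_snd].
Qed.

Lemma measurable_lmass g : Sc g -> measurable_fun setT (lmass g).
Proof.
move=> hg; apply/measurable_EFinP.
rewrite (_ : EFin \o _ = (fun c => \int[mu]_x (g x * kern c x)%:E)%E); last first.
  by apply/funext => c /=; exact: lmassE.
apply: (measurable_fun_fubini_tonelli_F (m2 := mu) (fun p => (g p.2 * kern p.1 p.2)%:E)).
  exact: measurable_gkern2.
by move=> p /=; rewrite lee_fin gkern_ge0.
Qed.

(** Exchange the integrals: a point x is counted by the centres within r of it, which fill a ball of
    volume w. This identity balances the average gains and losses of mass. *)
Lemma integral_lmass g : Sc g ->
  (\int[mu]_c (lmass g c)%:E = w%:E * (mass g)%:E)%E.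
Proof.
move=> hg.
transitivity (\int[mu]_c \int[mu]_x (g x * kern c x)%:E)%E.
  by apply: eq_integral => c _; exact: lmassE.
have := fubini_tonelli (m1 := mu) (m2 := mu) (fun p => (g p.2 * kern p.1 p.2)%:E).
move=> /(_ (measurable_gkern2 hg)) /= ->; last by move=> p /=; rewrite lee_fin gkern_ge0.
transitivity (\int[mu]_x (w%:E * (g x)%:E))%E.
  apply: eq_integral => x _; under eq_integral do rewrite EFinM.
  rewrite ge0_integralZl//.
  - by under eq_integral do rewrite kernC; rewrite integral_kern muleC.
  - by apply/measurable_EFinP; exact: measurable_kern.
  - by move=> c _; rewrite lee_fin; have /andP[] := kern_itv c x.
  - by rewrite lee_fin Sc_ge0.
rewrite ge0_integralZl// ?massE//.
- by apply/measurable_EFinP; exact: Sc_measurable.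
- by move=> x _; rewrite lee_fin Sc_ge0.
- by rewrite lee_fin ball_vol_ge0.
Qed.

Lemma lmass_notin g c : Sc g -> ~ enlarge r (supp g) c -> lmass g c = 0.
Proof.
move=> hg cE; apply/eqP; rewrite -eqe lmassE//; apply/eqP.
apply: integral0_eq => x _; case: (pselect (supp g x)) => gx; last by rewrite notin_supp// mul0r.
rewrite /kern; have [xc|] := boolP (enorm (x - c) <= r); last by rewrite mulr0.
by case: cE; exists x => //; rewrite enormBC.
Qed.

Lemma notin_enlarge_supp g c : ~ enlarge r (supp g) c -> g c = 0.
Proof.
move=> cE; apply: notin_supp => sc; apply: cE; exists c => //.
by rewrite subrr enorm0 ltW.
Qed.

End mass.

(** * Effect of a single jump on support and mass *)

Section jump_facts.
Context {R : realType} {d : nat}.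
Variables r U : R.
Hypotheses (r0 : 0 < r) (U01 : 0 < U < 1).
Implicit Types (g : 'rV[R]_d -> R) (c x : 'rV[R]_d).
Local Notation mu := (@lebesgue_rV R d).
Local Notation w := (@ball_vol R d r).

Let U0 : 0 < U. Proof. by case/andP: U01. Qed.
Let U1 : U < 1. Proof. by case/andP: U01. Qed.

Lemma jumpE g c v x :
  jump r U g c v x = g x + U * kern r c x * ((v <= g c)%R%:R - g x).
Proof. by []. Qed.

Lemma jump_itv g c v x : Sc g -> 0 <= jump r U g c v x <= 1.
Proof.
move=> hg; have := Sc_ge0 x hg; have := Sc_le1 x hg.
move=> g1 g0; have U0' := U0; have U1' := U1.
have /= h1 : 0 <= (1 - U) * (1 - g x) by apply: mulr_ge0; lra.
have h2 : 0 <= U * (1 - g x) by apply: mulr_ge0; lra.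
have h3 : 0 <= (1 - U) * g x by apply: mulr_ge0; lra.
have h4 : 0 <= U * g x by apply: mulr_ge0; lra.
by rewrite jumpE /kern; case: (enorm _ <= _)%R; case: (v <= _)%R => /=;
  rewrite ?mulr1 ?mulr0 ?mul0r ?subr0 ?sub0r; apply/andP; split; lra.
Qed.

(** U > 0 makes a red jump charge its whole ball, and U < 1 keeps positive values positive under the
    other jumps, so the support never shrinks. *)
Lemma jump_neq0 g c v x : Sc g ->
  (jump r U g c v x != 0) = (g x != 0) || (v <= g c) && (enorm (x - c) <= r).
Proof.
move=> hg; have := Sc_ge0 x hg; have := Sc_le1 x hg => g1 g0.
have U0' := U0; have U1' := U1.
have h3 : 0 <= (1 - U) * g x by apply: mulr_ge0; lra.
have h4 : 0 <= U * g x by apply: mulr_ge0; lra.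
rewrite jumpE /kern; case: (enorm _ <= _)%R; case: (v <= _)%R => /=.
- rewrite mulr1 orbT gt_eqF//; lra.
- rewrite orbF mulr1 sub0r mulrN -{1}[g x]mul1r -mulrBl mulf_eq0 negb_or.
  by rewrite subr_eq0 eq_sym lt_eqF.
- by rewrite orbF mulr0 mul0r addr0.
- by rewrite orbF mulr0 mul0r addr0.
Qed.

Lemma supp_jump g c v : Sc g ->
  supp (jump r U g c v) = if v <= g c then supp g `|` eball c r else supp g.
Proof.
move=> hg; rewrite /supp; case: ifPn => vg.
  rewrite [X in _ `|` X](closure_id _).1; last exact: closed_eball.
  rewrite -closureU; congr closure; apply/seteqP.
  by split => x /=; rewrite jump_neq0// vg/= => /orP.
congr closure; apply/seteqP.
by split => x /=; rewrite jump_neq0// (negbTE vg)/= orbF.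
Qed.

Lemma jump_Sc g c v : Sc g -> Sc (jump r U g c v).
Proof.
move=> hg; split; last 1 first.
- rewrite supp_jump//; case: ifPn => _; last by case: hg.
  by apply: compactU; [case: hg|exact: compact_eball].
- have mg := Sc_measurable hg.
  apply: measurable_funD => //; apply: measurable_funM.
    by apply: measurable_funM => //; exact: (measurable_kern r (h1 := cst c) (h2 := id)).
  exact: measurable_funB.
- by move=> x; exact: jump_itv.
Qed.

Lemma mass_jump g c v : Sc g ->
  mass (jump r U g c v) = mass g + U * ((v <= g c)%R%:R * w - lmass r g c).
Proof.
move=> hg; have hj := jump_Sc c v hg; set b : R := (_ <= _)%R%:R.
have b0 : 0 <= b by exact: ler0n.
have mk : measurable_fun setT (kern r c) by exact: (measurable_kern r (h1 := cst c) (h2 := id)).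
(* In additive form every integrand is nonnegative, so integrals add up without integrability
   conditions; the subtraction is done at the end, on real numbers. *)
have /eqP : (mass (jump r U g c v) + U * lmass r g c)%:E = (mass g + U * b * w)%:E.
  rewrite !EFinD !EFinM (massE hg) (massE hj) lmassE// -(integral_kern r c) -EFinM.
  rewrite -ge0_integralZl ?lee_fin ?(ltW U0)//; last 2 first.
  - by apply/measurable_EFinP; exact: measurable_gkern.
  - by move=> x _; rewrite lee_fin gkern_ge0.
  rewrite -ge0_integralZl ?lee_fin ?mulr_ge0 ?(ltW U0)//; last 2 first.
  - exact/measurable_EFinP.
  - by move=> x _; rewrite lee_fin; have /andP[] := kern_itv r c x.
  rewrite -ge0_integralD//; first last.
  - by apply: measurable_funeM; apply/measurable_EFinP; exact: measurable_gkern.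
  - by move=> x _; rewrite -EFinM lee_fin mulr_ge0 ?gkern_ge0// ltW.
  - by apply/measurable_EFinP; exact: Sc_measurable.
  - by move=> x _; rewrite lee_fin Sc_ge0.
  rewrite -ge0_integralD//; first last.
  - by apply: measurable_funeM; apply/measurable_EFinP.
  - move=> x _; have /andP[k0 _] := kern_itv r c x.
    by rewrite -EFinM lee_fin !mulr_ge0// ltW.
  - by apply/measurable_EFinP; exact: Sc_measurable.
  - by move=> x _; rewrite lee_fin Sc_ge0.
  apply: eq_integral => x _; rewrite -!EFinM -!EFinD jumpE -/b; congr (_%:E); ring.
by rewrite eqe => /eqP h; rewrite mulrBr addrA mulrA -h addrK.
Qed.

End jump_facts.

(** The draw v influences a jump only through whether v <= g(c), so averages over v take this
    two-valued form with p = g(c). *)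
Lemma uniform_threshold {R : realType} (p a b : R) : 0 <= p <= 1 -> 0 <= a -> 0 <= b ->
  (\int[uniform_prob (@ltr01 R)]_v (if (v <= p)%R then a else b)%:E = (p * a + (1 - p) * b)%:E)%E.
Proof.
move=> /andP[p0 p1] a0 b0.
pose A : set (measurableTypeR R) := `]-oo, p]%classic.
have mA : measurable A by exact: measurable_itv.
have PA : uniform_prob (@ltr01 R) A = p%:E.
  rewrite /uniform_prob integral_uniform_pdf.
  rewrite (_ : A `&` _ = `[0, p]%classic); last first.
    by apply/seteqP; split => t; rewrite /A/= !in_itv/=;
      [move=> [-> /andP[->]]|move=> /andP[-> tp]; rewrite tp (le_trans tp p1)].
  transitivity (\int[lebesgue_measure]_(x in `[0%R, p]) (cst 1%:E) x)%E.
    apply: eq_integral => t; rewrite inE/= in_itv/= => /andP[t0 tp].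
    by rewrite /uniform_pdf t0 (le_trans tp p1)/= subr0 invr1.
  rewrite integral_cst//= mul1e lebesgue_measure_itv/= lte_fin.
  case: ltP => [_|h]; first by rewrite oppr0 adde0.
  by congr _%:E; apply/eqP; rewrite eq_le p0.
transitivity (\int[uniform_prob (@ltr01 R)]_v (a%:E * (\1_A v)%:E + b%:E * (\1_(~` A) v)%:E))%E.
  apply: eq_integral => v _; rewrite !indicE in_setC.
  have -> : (v \in A) = (v <= p) by apply/idP/idP; rewrite inE/A/= in_itv.
  by case: (v <= p); rewrite /= ?mule1 ?mule0 ?adde0 ?add0e.
have mAC : measurable (~` A) by exact: measurableC.
rewrite ge0_integralD//; last 4 first.
- by move=> v _; rewrite -EFinM lee_fin mulr_ge0.
- by apply: measurable_funeM; apply/measurable_EFinP.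
- by move=> v _; rewrite -EFinM lee_fin mulr_ge0.
- by apply: measurable_funeM; apply/measurable_EFinP.
rewrite ge0_integralZl//; last by apply/measurable_EFinP.
rewrite ge0_integralZl//; last by apply/measurable_EFinP.
have PAC : uniform_prob (@ltr01 R) (~` A) = (1 - p%:E)%E.
  by have := probability_setC (uniform_prob (@ltr01 R)) mA; rewrite /= PA.
rewrite !integral_indic// !setIT /= PA PAC.
by rewrite -EFinB -!EFinM -EFinD; congr _%:E; ring.
Qed.

(** * Dispersion of the mass increment *)

Section lmass_modulus.
Context {R : realType} {d : nat}.
Variable r : R.
Hypothesis r0 : 0 < r.
Implicit Types (g : 'rV[R]_d -> R) (c x : 'rV[R]_d).
Local Notation mu := (@lebesgue_rV R d).
Local Notation w := (@ball_vol R d r).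
Local Notation vol := (@ball_vol R d).

(** The ball around c' lies in the ball of radius r + delta around c. As g <= 1, it can add to H(c)
    at most the volume of the shell S between the two concentric balls. *)
Lemma lmass_shift g c c' (delta : R) : Sc g -> 0 <= delta -> enorm (c - c') <= delta ->
  lmass r g c' <= lmass r g c + (vol (r + delta) - w).
Proof.
move=> hg delta0 cc'.
pose S : set 'rV[R]_d := eball c (r + delta) `\` eball c r.
have mS : measurable S by apply: measurableD; exact: measurable_eball.
have muS : mu S = (vol (r + delta) - w)%:E.
  rewrite measureD; [|exact: measurable_eball|exact: measurable_eball|].
    rewrite setIidr; first by rewrite /= !lebesgue_rV_eball -EFinB.
    by move=> x; rewrite /eball/= => /le_trans; apply; rewrite lerDl.
  by rewrite /= lebesgue_rV_eball ltry.
have iS : (\int[mu]_x (\1_S x)%:E = (vol (r + delta) - w)%:E)%E.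
  by rewrite integral_indic// setIT.
rewrite -lee_fin EFinD !lmassE// -iS.
have m1 : measurable_fun setT (fun x => (g x * kern r c x)%:E).
  by apply/measurable_EFinP; exact: measurable_gkern.
have m2 : measurable_fun setT (fun x => (\1_S x : R)%:E).
  by apply/measurable_EFinP.
rewrite -ge0_integralD//; last by move=> x _; rewrite lee_fin gkern_ge0.
apply: ge0_le_integral => //.
- by move=> x _; rewrite lee_fin gkern_ge0.
- by apply/measurable_EFinP; exact: measurable_gkern.
- exact: emeasurable_funD.
move=> x _; rewrite -EFinD lee_fin.
have g1 := Sc_le1 x hg; have g0 := Sc_ge0 x hg.
have [xS|xS] := boolP (x \in S).
  rewrite indicE xS (le_trans (gkern_le_kern _ _ _ hg))//.
  have /andP[_ k1] := kern_itv r c' x.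
  by rewrite (le_trans k1)// lerDr gkern_ge0.
rewrite indicE (negbTE xS) addr0 /kern ler_wpM2l// ler_nat.
case: (boolP (enorm (x - c') <= r)) => // xc'.
case: (boolP (enorm (x - c) <= r)) => // xc.
exfalso; move: xS; rewrite notin_setE; apply; split => /=.
  rewrite /eball/= (le_trans (enorm_triangle c' _ _))// lerD//.
  by rewrite enormBC.
by rewrite /eball/=; exact/negP.
Qed.

(** Continuity from above along the balls of radius r + 1 / (n + 1), whose intersection is the
    closed ball of radius r. *)
Lemma ball_vol_right_continuous (eps : R) : 0 < eps ->
  exists2 delta : R, 0 < delta & vol (r + delta) - w < eps.
Proof.
move=> eps0.
pose F n : set 'rV[R]_d := eball 0 (r + n.+1%:R^-1).
have FE : \bigcap_n F n = eball 0 r.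
  apply/seteqP; split => x /=; last first.
    by move=> xr n _; rewrite /F /eball/= (le_trans xr)// lerDl.
  move=> xF; rewrite /eball/=; apply/ler_addgt0Pr => e e0.
  have [k _ /(_ k)] := near_infty_natSinv_lt (PosNum e0).
  move=> /(_ (leqnn _))/= ke; apply: (le_trans (xF k I)).
  by rewrite lerD2l ltW.
have cvF : mu \o F @ \oo --> mu (eball 0 r).
  rewrite -FE; apply: nonincreasing_cvg_mu.
  - by rewrite /= lebesgue_rV_eball ltry.
  - by move=> n; exact: measurable_eball.
  - by rewrite FE; exact: measurable_eball.
  move=> n m nm; apply/subsetPset => x; rewrite /F /eball/= => /le_trans; apply.
  by rewrite lerD2l lef_pV2 ?posrE// ler_nat.
have cvv : (fun n : nat => vol (r + n.+1%:R^-1)) @ \oo --> w.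
  rewrite (_ : (fun n => _) = fine \o (mu \o F)); last first.
    by apply/funext => n /=; rewrite lebesgue_rV_eball.
  by apply: fine_cvg; rewrite -(lebesgue_rV_eball 0); exact: cvF.
have /cvgrPdist_lt/(_ _ eps0)[k _ /(_ k (leqnn _)) /=] := cvv.
rewrite ltr_norml => /andP[h _]; exists k.+1%:R^-1 => //.
lra.
Qed.

(** It matters that delta is chosen before g: the same modulus then serves every state of the
    chain. *)
Lemma lmass_uniform_continuous (eps : R) : 0 < eps ->
  exists2 delta : R, 0 < delta & forall g c c', Sc g -> enorm (c - c') <= delta ->
    `|lmass r g c - lmass r g c'| <= eps.
Proof.
move=> /ball_vol_right_continuous[delta delta0 hd]; exists delta => // g c c' hg cc'.
have h1 := lmass_shift hg (ltW delta0) cc'; rewrite enormBC in cc'.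
have h2 := lmass_shift hg (ltW delta0) cc'.
rewrite ler_norml; move: h1 h2 hd.
move: (lmass _ _ _) (lmass _ _ _) (vol _) w; clear => a b s t h1 h2 h3.
by apply/andP; split; lra.
Qed.

End lmass_modulus.

Section dispersion.
Context {R : realType} {d : nat}.
Variable r : R.
Hypotheses (d0 : (0 < d)%N) (r0 : 0 < r).
Implicit Types (g : 'rV[R]_d -> R) (c x : 'rV[R]_d).
Local Notation mu := (@lebesgue_rV R d).
Local Notation w := (@ball_vol R d r).

Definition dispersion g c : R :=
  g c * (w - lmass r g c) ^+ 2 + (1 - g c) * lmass r g c ^+ 2.

Lemma dispersion_ge0 g c : Sc g -> 0 <= dispersion g c.
Proof.
move=> hg; apply: addr_ge0; apply: mulr_ge0; rewrite ?sqr_ge0//; first exact: Sc_ge0.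
by rewrite subr_ge0 Sc_le1.
Qed.

Lemma measurable_dispersion g : Sc g -> measurable_fun setT (dispersion g).
Proof.
move=> hg; have mg := Sc_measurable hg; have mH := measurable_lmass r hg.
apply: measurable_funD; apply: measurable_funM => //.
- by apply: measurable_funX; apply: measurable_funB.
- exact: measurable_funB.
- exact: measurable_funX.
Qed.

(** A discrete intermediate value argument: walk from c0 in steps of length delta along a coordinate
    axis until H, which vanishes far out, first drops to w / 2 or below. The previous value exceeded
    w / 2 and one step changes H by at most w / 8, whence the bound 3 w / 8. *)
Lemma lmass_intermediate (delta : R) g c0 : Sc g -> 0 < delta ->
  (forall c c', enorm (c - c') <= delta -> `|lmass r g c - lmass r g c'| <= w / 8) ->
  w / 2 < lmass r g c0 -> exists c, w * 3 / 8 <= lmass r g c <= w / 2.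
Proof.
move=> hg delta0 hdelta Hc0.
pose e : 'rV[R]_d := delta_mx 0 (Ordinal d0).
have e1 : enorm e = 1.
  rewrite /enorm (bigD1 (Ordinal d0))//= big1 => [|i /negbTE ie].
    by rewrite mxE !eqxx expr1n addr0 sqrtr1.
  by rewrite mxE ie andbF expr0n.
pose p k := c0 + (delta * k%:R) *: e.
have pS k : enorm (p k.+1 - p k) = delta.
  rewrite /p opprD addrACA subrr add0r -scalerBl -mulrBr -natrB//.
  by rewrite subSn// subnn mulr1 enormZ e1 mulr1 gtr0_norm.
have [k0 Hk0] : exists k, lmass r g (p k) <= w / 2.
  have : bounded_set (enlarge r (supp g)).
    by apply: compact_bounded; apply: compact_enlarge; case: hg.
  move=> [M [_ /(_ (`|M| + 1))]].
  rewrite (le_lt_trans (ler_norm _)) ?ltrDl// => /(_ isT) hM.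
  (* After k steps the walk has left the enlarged support, whose points have sup norm at most |M| +
     1. *)
  have [k hk] : exists k : nat, (Num.sqrt d%:R * (`|M| + 1) + enorm c0) / delta < k%:R.
    exists (Num.truncn ((Num.sqrt d%:R * (`|M| + 1) + enorm c0) / delta)).+1.
    exact: truncnS_gt.
  exists k; rewrite lmass_notin//; first by have := @ball_vol_ge0 R d r; lra.
  move=> /hM /= pM; have := enormD (p k) (- c0).
  rewrite {1}/p addrC addKr enormZ e1 mulr1 enormN ger0_norm ?mulr_ge0 ?(ltW delta0)//.
  have h1 := le_trans (enorm_le_norm (p k)) (ler_wpM2l (sqrtr_ge0 _) pM).
  move: hk; rewrite ltr_pdivrMr// => h2; rewrite mulrC => h3.
  by have := lt_le_trans h2 (le_trans h3 (lerD h1 (lexx (enorm c0)))); rewrite ltxx.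
have exk : exists k, lmass r g (p k) <= w / 2 by exists k0.
case: (ex_minnP exk) => -[|k] Hk kmin.
  by move: Hk; rewrite /p mulr0 scale0r addr0 leNgt Hc0.
exists (p k.+1); rewrite Hk andbT.
have Hk1 : w / 2 < lmass r g (p k).
  by rewrite ltNge; apply/negP => /kmin; rewrite ltnn.
have := hdelta (p k.+1) (p k); rewrite pS lexx => /(_ isT).
rewrite ler_norml => /andP[+ _]; move: Hk1.
by move: (lmass _ _ _) (lmass _ _ _) w; clear => a b t h1 h2; lra.
Qed.

Lemma dispersion_lower_bound :
  exists2 delta : R, 0 < delta & forall g, Sc g ->
   ((Num.min delta (mass g * (w / 2) ^+ 2))%:E <=
     \int[mu]_(c in enlarge r (supp g)) (dispersion g c)%:E)%E.
Proof.
have w0 : 0 < w by exact: ball_vol_gt0.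
have [delta delta0 hdelta] := @lmass_uniform_continuous R d r (w / 8) ltac:(by rewrite divr_gt0).
(* Within delta of a point where 3 w / 8 <= H <= w / 2, both H and w - H are at least w / 4, so the
   dispersion, a convex combination of their squares, is at least (w / 4)^2. *)
exists ((w / 4) ^+ 2 * @ball_vol R d delta).
  by rewrite mulr_gt0 ?exprn_gt0 ?ball_vol_gt0 ?divr_gt0.
move=> g hg; set E := enlarge r (supp g).
have mE : measurable E by exact: Sc_enlarge_measurable.
have mD : measurable_fun E (fun c => (dispersion g c)%:E).
  by apply/measurable_EFinP; apply: measurable_funTS; exact: measurable_dispersion.
have [[c0 Hc0]|HH] := pselect (exists c, w / 2 < lmass r g c).
  apply: (@le_trans _ _ ((w / 4) ^+ 2 * @ball_vol R d delta)%:E).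
    by rewrite lee_fin ge_min lexx.
  have [c /andP[c1 c2]] := lmass_intermediate hg delta0 (fun _ _ => hdelta g _ _ hg) Hc0.
  have Hc x : eball c delta x -> w / 4 <= lmass r g x <= w * 5 / 8.
    move=> xc; have := hdelta g x c hg xc; rewrite ler_norml; move: c1 c2.
    move: (lmass _ _ _) (lmass _ _ _) w; clear => a b t h1 h2 /andP[h3 h4].
    by apply/andP; split; lra.
  have cE : eball c delta `<=` E.
    move=> x /Hc /andP[h _]; apply: contrapT => /(lmass_notin hg) Hx0.
    by move: h; rewrite Hx0; move: w0; move: w; clear => t *; lra.
  apply: le_trans (ge0_subset_integral mu (measurable_eball c delta) mE mD _ cE); last first.
    by move=> x _; rewrite lee_fin dispersion_ge0.
  rewrite EFinM -(lebesgue_rV_eball c) -integral_cst; last exact: measurable_eball.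
  apply: ge0_le_integral => //.
  - exact: measurable_eball.
  - by move=> x _; rewrite lee_fin sqr_ge0.
  - by apply: measurable_funS mD.
  move=> x /Hc /andP[h1 h2]; rewrite lee_fin /dispersion.
  have g0 := Sc_ge0 x hg; have g1 := Sc_le1 x hg.
  set H := lmass r g x in h1 h2 *.
  move: h1 h2 w0 g0 g1; move: H w (g x); clear => H w y h1 h2 w0 g0 g1.
  have a1 : (w / 4) ^+ 2 <= (w - H) ^+ 2 by rewrite lerXn2r ?nnegrE; lra.
  have a2 : (w / 4) ^+ 2 <= H ^+ 2 by rewrite lerXn2r ?nnegrE; lra.
  set A := (w / 4) ^+ 2 in a1 a2 *; set B := (w - H) ^+ 2 in a1 *; set C := H ^+ 2 in a2 *.
  have b1 : 0 <= y * (B - A) by rewrite mulr_ge0// subr_ge0.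
  have b2 : 0 <= (1 - y) * (C - A) by rewrite mulr_ge0// subr_ge0.
  lra.
(* Here H <= w / 2 everywhere, so the first term of the dispersion alone is at least g (w / 2)^2. *)
apply: (@le_trans _ _ (mass g * (w / 2) ^+ 2)%:E).
  by rewrite lee_fin ge_min lexx orbT.
rewrite EFinM massE// muleC -ge0_integralZl//; last 3 first.
- by apply/measurable_EFinP; exact: Sc_measurable.
- by move=> x _; rewrite lee_fin Sc_ge0.
- by rewrite lee_fin sqr_ge0.
rewrite [leRHS]integral_mkcond; apply: ge0_le_integral => //.
- by move=> x _; rewrite -EFinM lee_fin mulr_ge0 ?sqr_ge0 ?Sc_ge0.
- by apply: measurable_funeM; apply/measurable_EFinP; exact: Sc_measurable.
- by apply/(measurable_restrictT _ _).1.
move=> x _; rewrite patchE; case: ifPn => xE; last first.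
  rewrite (@notin_enlarge_supp _ _ r r0 g x) ?mule0// => h.
  by move: xE; rewrite notin_setE.
rewrite -EFinM lee_fin /dispersion.
have g0 := Sc_ge0 x hg; have g1 := Sc_le1 x hg.
have H2 : lmass r g x <= w / 2 by rewrite leNgt; apply/negP => h; apply: HH; exists x.
have H0 := lmass_ge0 r x hg.
have a1 : (w / 2) ^+ 2 <= (w - lmass r g x) ^+ 2.
  move: H0 H2 w0; move: (lmass _ _ _) w; clear => H w *.
  by rewrite lerXn2r ?nnegrE; lra.
rewrite mulrC; apply: (@le_trans _ _ (g x * (w - lmass r g x) ^+ 2)).
  by rewrite ler_wpM2l.
by rewrite lerDl mulr_ge0 ?sqr_ge0// subr_ge0.
Qed.

End dispersion.

(** * One-step drift *)

Section saturation.
Context {R : realType}.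
Implicit Types m x a : R.

Definition sat m : R := m / (1 + m).

Lemma sat_ge0 m : 0 <= m -> 0 <= sat m.
Proof. by move=> m0; rewrite divr_ge0// addr_ge0. Qed.

Lemma sat_le1 m : 0 <= m -> sat m <= 1.
Proof. by move=> m0; rewrite ler_pdivrMr ?mul1r ?lerDr// ltr_pwDl. Qed.

Lemma sat_le_id m : 0 <= m -> sat m <= m.
Proof. by move=> m0; rewrite ler_pdivrMr ?ltr_pwDl// ler_peMr// lerDl. Qed.

Lemma sat_le m x : 0 <= m -> m <= x -> sat m <= sat x.
Proof.
move=> m0 mx; have x0 := le_trans m0 mx.
rewrite ler_pdivrMr ?ltr_pwDl// mulrAC ler_pdivlMr ?ltr_pwDl//; lra.
Qed.

(* The absolute value removes the pole at -1. *)
Lemma measurable_sat : measurable_fun setT (fun m => sat `|m|).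
Proof.
apply: continuous_measurable_fun => m; apply: continuousM.
  exact: norm_continuous.
apply: continuousV; first by rewrite gt_eqF// ltr_pwDl.
by apply: continuousD; [exact: cst_continuous|exact: norm_continuous].
Qed.

(** Exact expansion: sat (m + x) = sat m + x / (1 + m)^2 - x^2 / ((1 + m)^2 (1 + m + x)). Replacing
    x by its bound a in the last denominator gives x^2 a coefficient independent of x. *)
Lemma sat_concave m x a : 0 <= m -> 0 <= m + x -> x <= a -> 0 <= a ->
  sat (m + x) + x ^+ 2 / ((1 + m) ^+ 2 * (1 + m + a)) <= sat m + x / (1 + m) ^+ 2.
Proof.
move=> m0 mx0 xa a0.
have m1 : 0 < 1 + m by lra.
have mx1 : 0 < 1 + m + x by lra.
have ma1 : 0 < 1 + m + a by lra.
have -> : sat (m + x) = sat m + x / (1 + m) ^+ 2 - x ^+ 2 / ((1 + m) ^+ 2 * (1 + m + x)).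
  rewrite /sat addrA; field; rewrite ?gt_eqF//.
rewrite -addrA gerDl addrC subr_le0 ler_wpM2l ?sqr_ge0//.
by rewrite lef_pV2 ?posrE ?mulr_gt0 ?exprn_gt0// ler_wpM2l ?sqr_ge0// lerD2l.
Qed.

End saturation.

Section one_step.
Context {R : realType} {d : nat}.
Variables r U : R.
Hypotheses (d0 : (0 < d)%N) (r0 : 0 < r) (U01 : 0 < U < 1).
Implicit Types (g : 'rV[R]_d -> R) (c x : 'rV[R]_d).
Local Notation mu := (@lebesgue_rV R d).
Local Notation w := (@ball_vol R d r).

Let U0 : 0 < U. Proof. by case/andP: U01. Qed.
Let U1 : U < 1. Proof. by case/andP: U01. Qed.

(** Applied to g and H, which vanish off the region where centres are drawn, so that whole-space
    identities hold on that region. *)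
Lemma integral_enlarge (u : 'rV[R]_d -> R) g :
  (forall x, ~ enlarge r (supp g) x -> u x = 0) ->
  (\int[mu]_(x in enlarge r (supp g)) (u x)%:E = \int[mu]_x (u x)%:E)%E.
Proof.
move=> uE; rewrite [LHS]integral_mkcond; apply: eq_integral => x _.
by rewrite patchE; case: ifPn => //; rewrite notin_setE => /uE ->.
Qed.

Definition mean_sat g c : R :=
  g c * sat (mass g + U * (w - lmass r g c)) + (1 - g c) * sat (mass g - U * lmass r g c).

Lemma mass_down_ge0 g c : Sc g -> 0 <= mass g - U * lmass r g c.
Proof.
move=> hg; have h0 := lmass_ge0 r c hg; have h1 := lmass_le_mass r c hg.
have U1' := ltW U1; rewrite subr_ge0 (le_trans _ h1)// ler_piMl//.
Qed.

Lemma mass_up_ge0 g c : Sc g -> 0 <= mass g + U * (w - lmass r g c).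
Proof.
move=> hg; rewrite addr_ge0 ?mass_ge0// mulr_ge0 ?subr_ge0 ?lmass_le_vol//.
exact: ltW.
Qed.

Lemma mean_sat_ge0 g c : Sc g -> 0 <= mean_sat g c.
Proof.
move=> hg; apply: addr_ge0; apply: mulr_ge0.
- exact: Sc_ge0.
- exact/sat_ge0/mass_up_ge0.
- by rewrite subr_ge0 Sc_le1.
- exact/sat_ge0/mass_down_ge0.
Qed.

Lemma integral_mean_sat g c : Sc g ->
  (\int[uniform_prob (@ltr01 R)]_v (sat (mass (jump r U g c v)))%:E = (mean_sat g c)%:E)%E.
Proof.
move=> hg; rewrite /mean_sat -uniform_threshold.
- apply: eq_integral => v _; rewrite mass_jump//; congr _%:E.
  by case: (v <= g c); rewrite ?mul1r// mul0r sub0r mulrN.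
- by rewrite Sc_ge0 ?Sc_le1.
- exact/sat_ge0/mass_up_ge0.
- exact/sat_ge0/mass_down_ge0.
Qed.

Lemma measurable_mean_sat g : Sc g -> measurable_fun setT (mean_sat g).
Proof.
move=> hg; have mg := Sc_measurable hg; have mH := measurable_lmass r hg.
have -> : mean_sat g = (fun c =>
  g c * sat `|mass g + U * (w - lmass r g c)| + (1 - g c) * sat `|mass g - U * lmass r g c|).
  apply/funext => c; rewrite [in RHS]ger0_norm; last exact: mass_up_ge0.
  by rewrite ger0_norm//; exact: mass_down_ge0.
apply: measurable_funD; apply: measurable_funM => //.
- apply: (measurableT_comp measurable_sat); apply: measurable_funD => //.
  by apply: measurable_funM => //; exact: measurable_funB.
- exact: measurable_funB.
- apply: (measurableT_comp measurable_sat); apply: measurable_funB => //.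
  exact: measurable_funM.
Qed.

(** U^2 times the remainder coefficient of [sat_concave] with a := w, times the bound of
    [dispersion_lower_bound]. Divided by the rate, it bounds from below the mean loss of [sat] in
    one step. *)
Definition sat_decay (delta m : R) : R :=
  U ^+ 2 / ((1 + m) ^+ 2 * (1 + m + w)) * Num.min delta (m * (w / 2) ^+ 2).

(** Average [sat_concave] over the two possible increments U (w - H) and - U H, both at most w. The
    first-order term U (w g - H) is split between the two sides to keep all terms nonnegative. *)
Let mean_sat_le g c : Sc g ->
  mean_sat g c + U ^+ 2 / ((1 + mass g) ^+ 2 * (1 + mass g + w)) * dispersion r g c
    + U / (1 + mass g) ^+ 2 * lmass r g c
  <= sat (mass g) + U * w / (1 + mass g) ^+ 2 * g c.
Proof.
move=> hg; have m0 := mass_ge0 hg; have H0 := lmass_ge0 r c hg.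
have Hw := lmass_le_vol r c hg; have w0 := @ball_vol_ge0 R d r.
have up0 := mass_up_ge0 c hg; have dn0 := mass_down_ge0 c hg.
have g0 := Sc_ge0 c hg; have g1 := Sc_le1 c hg.
rewrite /mean_sat /dispersion.
move: m0 H0 Hw w0 up0 dn0 g0 g1 U0 U1.
move: (mass g) (lmass r g c) w (g c) U; clear => m H w p U m0 H0 Hw w0 up0 dn0 p0 p1 U0 U1.
have b1 : U * (w - H) <= w.
  apply: (@le_trans _ _ (w - H)); last lra.
  by apply: ler_piMl; [rewrite subr_ge0|exact: ltW].
have b2 : - (U * H) <= w by have := mulr_ge0 (ltW U0) H0; lra.
have h1 := @sat_concave _ m (U * (w - H)) w m0 up0 b1 w0.
have h2 := @sat_concave _ m (- (U * H)) w m0 dn0 b2 w0.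
have {}h1 := ler_wpM2l p0 h1.
have p1' : 0 <= 1 - p by lra.
have {}h2 := ler_wpM2l p1' h2.
have {h1 h2} := lerD h1 h2.
move: ((1 + m) ^+ 2 * (1 + m + w))%R^-1 ((1 + m) ^+ 2)^-1 (sat _) (sat _) (sat _) => a b s1 s2 s3 h.
rewrite -subr_ge0; rewrite -subr_ge0 in h; apply: le_trans h _.
by rewrite le_eqVlt; apply/orP; left; apply/eqP; ring.
Qed.

Lemma sat_supermartingale : exists2 delta : R, 0 < delta & forall g, Sc g ->
  (\int[mu]_(c in enlarge r (supp g)) \int[uniform_prob (@ltr01 R)]_v
      (sat (mass (jump r U g c v)))%:E + (sat_decay delta (mass g))%:E <=
   (fine (jump_rate r g) * sat (mass g))%:E)%E.
Proof.
have [delta delta0 hdelta] := @dispersion_lower_bound R d r d0 r0.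
exists delta => // g hg; set E := enlarge r (supp g).
have mE : measurable E by exact: Sc_enlarge_measurable.
have U0' := ltW U0.
have m0 := mass_ge0 hg; have w0 := @ball_vol_ge0 R d r.
set m := mass g.
pose k := U ^+ 2 / ((1 + m) ^+ 2 * (1 + m + w)).
have k0 : 0 <= k.
  apply: divr_ge0; first exact: sqr_ge0.
  by apply: mulr_ge0; [exact: sqr_ge0|rewrite !addr_ge0].
pose k1 := U / (1 + m) ^+ 2.
have k10 : 0 <= k1 by apply: divr_ge0 => //; exact: sqr_ge0.
have k1w : 0 <= k1 * w by exact: mulr_ge0.
have ms0 x : 0 <= mean_sat g x by exact: mean_sat_ge0.
have kd0 x : 0 <= k * dispersion r g x.
  by apply: mulr_ge0 => //; exact: dispersion_ge0.
have kl0 x : 0 <= k1 * lmass r g x.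
  by apply: mulr_ge0 => //; exact: lmass_ge0.
have mms : measurable_fun E (fun c => (mean_sat g c)%:E).
  by apply/measurable_EFinP/measurable_funTS; exact: measurable_mean_sat.
have md : measurable_fun E (fun c => (dispersion r g c)%:E).
  by apply/measurable_EFinP/measurable_funTS; exact: measurable_dispersion.
have ml : measurable_fun E (fun c => (lmass r g c)%:E).
  by apply/measurable_EFinP/measurable_funTS; exact: measurable_lmass.
have mg : measurable_fun E (fun c => (g c)%:E).
  by apply/measurable_EFinP/measurable_funTS; exact: Sc_measurable.
have muE : mu E = (fine (jump_rate r g))%:E.
  by rewrite fineK// ge0_fin_numE//; exact: Sc_enlarge_lty.
have IH : (\int[mu]_(c in E) (lmass r g c)%:E = (w * m)%:E)%E.
  rewrite integral_enlarge; first by rewrite integral_lmass.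
  by move=> x; exact: lmass_notin.
have Ig : (\int[mu]_(c in E) (g c)%:E = m%:E)%E.
  rewrite integral_enlarge; first by rewrite massE.
  by move=> x; exact: notin_enlarge_supp.
under eq_integral do rewrite integral_mean_sat//.
set I1 := (\int[mu]_(c in E) (mean_sat g c)%:E)%E.
set I2 := (\int[mu]_(c in E) (dispersion r g c)%:E)%E.
(* By [IH] and [Ig] the first-order terms of the two sides integrate to the same finite quantity,
   which is cancelled at the end. *)
have key : (I1 + k%:E * I2 + k1%:E * (w * m)%:E <=
    (sat m)%:E * (fine (jump_rate r g))%:E + (k1 * w)%:E * m%:E)%E.
  rewrite -IH -Ig -muE -integral_cst// -ge0_integralZl//; last first.
    by move=> x _; rewrite lee_fin dispersion_ge0.
  rewrite -ge0_integralZl//; last by move=> x _; rewrite lee_fin lmass_ge0.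
  rewrite -ge0_integralZl ?lee_fin//; last first.
    by move=> x _; rewrite lee_fin Sc_ge0.
  rewrite -!ge0_integralD//; first last.
  - exact: measurable_funeM.
  - by move=> x _; rewrite -EFinM lee_fin.
  - by move=> x _; rewrite lee_fin.
  - exact: measurable_funeM.
  - by move=> x _; rewrite -EFinM lee_fin.
  - by apply: emeasurable_funD => //; exact: measurable_funeM.
  - by move=> x _; rewrite -EFinM -EFinD lee_fin addr_ge0.
  - exact: measurable_funeM.
  - by move=> x _; rewrite -EFinM lee_fin; apply: mulr_ge0 => //; exact: Sc_ge0.
  - by move=> x _; rewrite lee_fin sat_ge0.
  apply: ge0_le_integral => //.
  - by move=> x _; rewrite -!EFinM -!EFinD lee_fin; apply: addr_ge0 => //; apply: addr_ge0 => //. 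
  - apply: emeasurable_funD; last exact: measurable_funeM.
    by apply: emeasurable_funD => //; exact: measurable_funeM.
  - by apply: emeasurable_funD => //; exact: measurable_funeM.
  move=> x _; rewrite -!EFinM -!EFinD lee_fin.
  apply: (le_trans (mean_sat_le x hg)); rewrite le_eqVlt; apply/orP; left.
  by apply/eqP; rewrite /k1 -/m; congr (_ + _); ring.
have dec : ((sat_decay delta m)%:E <= k%:E * I2)%E.
  by rewrite /sat_decay -/k EFinM lee_wpmul2l ?lee_fin// hdelta.
apply: (@le_trans _ _ (I1 + k%:E * I2)%E); first exact: leeD.
have e1 : ((k1 * w)%:E * m%:E = k1%:E * (w * m)%:E)%E by rewrite -!EFinM mulrA.
have e2 : ((sat m)%:E * (fine (jump_rate r g))%:E =
    (fine (jump_rate r g) * sat m)%:E)%E by rewrite -EFinM mulrC.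
by move: key; rewrite e1 e2 leeD2rE// -EFinM.
Qed.

End one_step.

(** * Freezing lemma *)

Section density.
Local Open Scope ereal_scope.
Context {dT : measure_display} {T : measurableType dT} {R : realType}.
Variables (mu nu : {measure set T -> \bar R}) (rho : T -> R).
Hypotheses (rho_ge0 : forall x, (0 <= rho x)%R) (mrho : measurable_fun setT rho).
Hypothesis nuE : forall A, measurable A -> nu A = \int[mu]_(x in A) (rho x)%:E.

Import HBNNSimple.

(** It holds for simple functions by [nuE] and linearity, and passes to f by monotone convergence on
    both sides. *)
Lemma ge0_integral_density (f : T -> \bar R) :
  measurable_fun setT f -> (forall x, 0 <= f x) ->
  \int[nu]_x f x = \int[mu]_x (f x * (rho x)%:E).
Proof.
move=> mf f0; pose h := nnsfun_approx measurableT mf.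
have mr : measurable_fun setT (fun x => (rho x)%:E) by exact/measurable_EFinP.
have r0 x : 0 <= (rho x)%:E by rewrite lee_fin.
have hf x : (h n x)%:E @[n --> \oo] --> f x by exact: cvg_nnsfun_approx.
transitivity (limn (fun n => \int[nu]_x (h n x)%:E)).
  rewrite -monotone_convergence//.
  - by apply: eq_integral => x _; apply/esym/cvg_lim.
  - by move=> n; exact/measurable_EFinP/measurable_funP.
  - by move=> n x _; rewrite lee_fin.
  - by move=> x _ m n mn; rewrite lee_fin; exact/lefP/nd_nnsfun_approx.
transitivity (limn (fun n => \int[mu]_x ((h n x)%:E * (rho x)%:E))); last first.
  rewrite -monotone_convergence//.
  - by apply: eq_integral => x _; apply/cvg_lim => //; apply: cvgeZr.
  - by move=> n; apply: emeasurable_funM => //; exact/measurable_EFinP/measurable_funP.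
  - by move=> n x _; rewrite mule_ge0// lee_fin.
  - move=> x _ m n mn; rewrite lee_wpmul2r// lee_fin.
    exact/lefP/nd_nnsfun_approx.
congr (limn _); apply/funext => n.
rewrite integralT_nnsfun sintegralE.
under [RHS]eq_integral => x _.
  rewrite fimfunE -fsumEFin// ge0_mule_fsuml; last first.
    by move=> y; exact: nnfun_muleindic_ge0.
  over.
rewrite ge0_integral_fsum//; last 2 first.
- move=> y; apply: emeasurable_funM => //; apply/measurable_EFinP.
  exact: measurable_funM.
- by move=> y x _; rewrite mule_ge0// nnfun_muleindic_ge0.
apply: eq_fsbigr => y; rewrite inE => -[t _ ht].
have y0 : 0 <= y%:E by rewrite -ht lee_fin.
under eq_integral do rewrite EFinM -muleA.
rewrite ge0_integralZl//; last 2 first.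
- by apply: emeasurable_funM => //; exact/measurable_EFinP.
- by move=> x _; rewrite mule_ge0// lee_fin.
rewrite nuE//; congr (_ * _); rewrite [LHS]integral_mkcond.
apply: eq_integral => x _; rewrite patchE indicE.
by case: ifPn => _; rewrite ?mul1e ?mul0e.
Qed.

End density.

Section freezing.
Local Open Scope ereal_scope.
Context {R : realType} {d : nat}.
Context {dO dS : measure_display} {Omega : measurableType dO} {S : measurableType dS}.
Variables (P : probability Omega R) (X : {mfun Omega >-> S}).
Variables (C : Omega -> 'rV[R]_d) (V : Omega -> measurableTypeR R).
Hypotheses (mC : measurable_fun setT C) (mV : measurable_fun setT V).
Variables (D : set (S * 'rV[R]_d)) (lam : S -> R).
Hypotheses (mD : measurable D) (mlam : measurable_fun setT lam)
  (lam_gt0 : forall s, (0 < lam s)%R).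
Local Notation RR := (measurableTypeR R).
Local Notation mu := (@lebesgue_rV R d).
Local Notation unif := (uniform_prob (@ltr01 R)).

(** Stands for the conditional mean of F (X, V, C) given X = s: V is uniform on [0, 1] and C has
    density 1 / [lam s] on the section of D at s. *)
Definition draw_mean (F : S * RR * 'rV[R]_d -> \bar R) (s : S) : \bar R :=
  (lam s)^-1%:E * \int[mu]_(c in xsection D s) \int[unif]_v F (s, v, c).

Hypothesis draw : forall (A : set S) (CC : set 'rV[R]_d) (VV : set RR),
  measurable A -> measurable CC -> measurable VV ->
  P (X @^-1` A `&` (C @^-1` CC `&` V @^-1` VV)) =
  \int[P]_(w in X @^-1` A)
    (mu (CC `&` xsection D (X w)) * (lam (X w))^-1%:E * unif VV).

Local Notation PX := (distribution P X).
(* The library infers that a product measure is sigma-finite only when its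
   factors are subprobabilities: hence the factor [mu] comes last. *)
Local Notation PU := (product_subprobability (PX : subprobability S R, unif : subprobability RR R)).

(** Candidate density of the law of (X, V, C) with respect to the law of X times the uniform law
    times Lebesgue measure; [law] confirms it. *)
Let rho (z : S * RR * 'rV[R]_d) : R := ((lam z.1.1)^-1 * \1_D (z.1.1, z.2))%R.

Let rho_ge0 z : (0 <= rho z)%R.
Proof. by rewrite mulr_ge0 ?invr_ge0 ?(ltW (lam_gt0 _))// indicE. Qed.

Let mlamV : measurable_fun setT (fun s => (lam s)^-1%R).
Proof.
(* On positive reals the inverse is the power -1, and power functions are measurable; the same
   device serves below for the rate. *)
rewrite (_ : (fun s => _) = (fun s => powR (lam s) (-1))).
  exact: measurableT_comp (measurable_powR _) mlam.
by apply/funext => s; rewrite powR_inv1// ltW.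
Qed.

Let mrho : measurable_fun setT rho.
Proof.
apply: measurable_funM.
  apply: (measurableT_comp mlamV).
  exact: (measurableT_comp measurable_fst measurable_fst).
apply: (measurableT_comp (measurable_indic mD)).
apply: measurable_fun_pair; last exact: measurable_snd.
exact: (measurableT_comp measurable_fst measurable_fst).
Qed.

Lemma measurable_draw_inner (F : S * RR * 'rV[R]_d -> \bar R) s :
  measurable_fun setT F -> (forall z, 0 <= F z) ->
  measurable_fun setT (fun c => \int[unif]_v F (s, v, c)).
Proof.
move=> mF F0.
apply: (measurable_fun_fubini_tonelli_F (m2 := unif) (fun q => F (s, q.2, q.1))) => //.
apply: (measurableT_comp mF); apply: measurable_fun_pair; last exact: measurable_fst.
by apply: measurable_fun_pair; [exact: measurable_cst|exact: measurable_snd].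
Qed.

Let mFr (F : S * RR * 'rV[R]_d -> \bar R) : measurable_fun setT F ->
  measurable_fun setT (fun z => F z * (rho z)%:E).
Proof. by move=> mF; apply: emeasurable_funM => //; exact/measurable_EFinP. Qed.

Let Fr0 (F : S * RR * 'rV[R]_d -> \bar R) z : 0 <= F z -> 0 <= F z * (rho z)%:E.
Proof. by move=> Fz; rewrite mule_ge0// lee_fin. Qed.

Let draw_mean_fubini (F : S * RR * 'rV[R]_d -> \bar R) s :
  measurable_fun setT F -> (forall z, 0 <= F z) ->
  fubini_F unif (fubini_F mu (fun z => F z * (rho z)%:E)) s = draw_mean F s.
Proof.
move=> mF F0; rewrite /fubini_F/=.
have ms : measurable_fun setT (fun q : RR * 'rV[R]_d => F (s, q.1, q.2) * (rho (s, q.1, q.2))%:E).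
  apply: (measurableT_comp (mFr mF)); apply: measurable_fun_pair; last exact: measurable_snd.
  by apply: measurable_fun_pair; [exact: measurable_cst|exact: measurable_fst].
rewrite (fubini_tonelli (m1 := unif) (m2 := mu)
  (fun q => F (s, q.1, q.2) * (rho (s, q.1, q.2))%:E))//=; last first.
  by move=> q; exact: Fr0.
pose G := (fun c => \int[unif]_v F (s, v, c)) \_ (xsection D s).
have mG : measurable_fun setT G.
  apply: (measurable_restrictT (fun c => \int[unif]_v F (s, v, c)) (measurable_xsection s mD)).1.
  by apply: measurable_funTS; exact: (measurable_draw_inner s mF F0).
have G0 c : 0 <= G c by rewrite /G patchE; case: ifPn => // _; exact: integral_ge0.
have l0 : 0 <= (lam s)^-1%:E by rewrite lee_fin invr_ge0 ltW.
transitivity (\int[mu]_c ((lam s)^-1%:E * G c)); last first.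
  by rewrite ge0_integralZl// /draw_mean [in RHS]integral_mkcond.
apply: eq_integral => c _; rewrite /G patchE /rho/= mem_xsection indicE.
case: (boolP (_ \in D)) => _.
  have mvc : measurable_fun setT (fun v : RR => (s, v, c)).
    by apply: measurable_fun_pair => //; apply: measurable_fun_pair.
  rewrite mulr1; transitivity (\int[unif]_v ((lam s)^-1%:E * F (s, v, c))).
    by apply: eq_integral => v _; rewrite muleC.
  by rewrite ge0_integralZl//; exact: (measurableT_comp mF mvc).
rewrite mule0; apply: integral0_eq => v _; by rewrite mulr0 mule0.
Qed.

Lemma measurable_draw_mean (F : S * RR * 'rV[R]_d -> \bar R) :
  measurable_fun setT F -> (forall z, 0 <= F z) ->
  measurable_fun setT (draw_mean F).
Proof.
move=> mF F0; rewrite (_ : draw_mean F =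
    fubini_F unif (fubini_F mu (fun z => F z * (rho z)%:E))); last first.
  by apply/funext => s; rewrite draw_mean_fubini.
apply: measurable_fun_fubini_tonelli_F.
  apply: measurable_fun_fubini_tonelli_F; first exact: mFr.
  by move=> z; exact: Fr0.
by move=> z; apply: integral_ge0 => c _; exact: Fr0.
Qed.

Lemma draw_mean_ge0 (F : S * RR * 'rV[R]_d -> \bar R) s :
  (forall z, 0 <= F z) -> 0 <= draw_mean F s.
Proof.
move=> F0; apply: mule_ge0; first by rewrite lee_fin invr_ge0 ltW.
by apply: integral_ge0 => c _; exact: integral_ge0.
Qed.

Let draw_meanE (F : S * RR * 'rV[R]_d -> \bar R) :
  measurable_fun setT F -> (forall z, 0 <= F z) ->
  \int[PU \x mu]_z (F z * (rho z)%:E) = \int[P]_w draw_mean F (X w).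
Proof.
move=> mF F0.
have Fr0' z : 0 <= F z * (rho z)%:E by exact: Fr0.
have h1 := fubini_tonelli1 (m1 := PU) (m2 := mu) (fun z => F z * (rho z)%:E) (mFr mF) Fr0'.
apply: (etrans h1); clear h1.
have mF1 := measurable_fun_fubini_tonelli_F (m2 := mu) (fun z => F z * (rho z)%:E) (mFr mF) Fr0'.
have F10 z : 0 <= fubini_F mu (fun z => F z * (rho z)%:E) z by apply: integral_ge0.
have h2 := fubini_tonelli1 (m1 := PX) (m2 := unif) _ mF1 F10.
apply: (etrans h2); clear h2.
transitivity (\int[PX]_s draw_mean F s).
  by apply: eq_integral => s _; exact: draw_mean_fubini.
rewrite ge0_integral_distribution//; first exact: measurable_draw_mean.
by move=> s; exact: draw_mean_ge0.
Qed.

(** Both sides are measures in B. They agree on boxes by [draw], and boxes form a class stable under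
    intersection that generates the product sigma-algebra. *)
Let law (B : set (S * RR * 'rV[R]_d)) : measurable B ->
  P ((fun w => (X w, V w, C w)) @^-1` B) = \int[PU \x mu]_(z in B) (rho z)%:E.
Proof.
have mX : measurable_fun setT X by exact: measurable_funPT.
have mZ : measurable_fun setT (fun w => (X w, V w, C w)).
  by apply: measurable_fun_pair => //; exact: measurable_fun_pair.
pose Zm := isMeasurableFun.Build _ _ _ _ (fun w => (X w, V w, C w)) mZ.
pose Z : {mfun Omega >-> (S * RR * 'rV[R]_d)%type} := HB.pack (fun w => (X w, V w, C w)) Zm.
pose m2 (B : set (S * RR * 'rV[R]_d)) := \int[PU \x mu]_(z in B) (rho z)%:E.
have m20 : m2 set0 = 0 by rewrite /m2 integral_set0.
have m2ge0 A : 0 <= m2 A by apply: integral_ge0 => z _; rewrite lee_fin.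
have m2sa : semi_sigma_additive m2.
  move=> F mF tF mUF; rewrite /m2.
  rewrite ge0_integral_bigcup//; last 2 first.
  - by apply/measurable_EFinP; exact: measurable_funTS.
  - by move=> z _; rewrite lee_fin.
  by apply: is_cvg_nneseries => n _ _; exact: m2ge0.
pose M1 := isMeasure.Build _ _ _ m2 m20 m2ge0 m2sa.
pose M : {measure set (S * RR * 'rV[R]_d) -> \bar R} := HB.pack m2 M1.
pose G := [set B | exists A VV CC, [/\ measurable (A : set S), measurable (VV : set RR),
   measurable (CC : set 'rV[R]_d) & B = (A `*` VV) `*` CC]].
(* The substantial inclusion says that the identity is measurable from the sigma-algebra generated
   by boxes, which is checked on the three coordinates. *)
have mGE : measurable = <<s G>>.
  pose T' := g_sigma_algebraType G.
  have GmB : G `<=` measurable.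
    move=> _ [A [VV [CC [mA mVV mCC ->]]]].
    by apply: measurableX => //; exact: measurableX.
  have m1 : measurable_fun [set: T'] (fun z : T' => z.1.1).
    move=> _ A mA; rewrite setTI; apply: sub_sigma_algebra.
    exists A, setT, setT; split => //.
    by apply/seteqP; split => [z Az|z [[]]].
  have m2' : measurable_fun [set: T'] (fun z : T' => z.1.2 : RR).
    move=> _ A mA; rewrite setTI; apply: sub_sigma_algebra.
    exists setT, A, setT; split => //.
    by apply/seteqP; split => [z Az|z [[]]].
  have m3 : measurable_fun [set: T'] (fun z : T' => z.2).
    move=> _ A mA; rewrite setTI; apply: sub_sigma_algebra.
    exists setT, setT, A; split => //.
    by apply/seteqP; split => [z Az|z [[]]].
  have mid : measurable_fun [set: T'] (fun z : T' => (z.1.1, z.1.2 : RR, z.2)).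
    by apply: measurable_fun_pair => //; exact: measurable_fun_pair.
  rewrite eqEsubset; split; last first.
    by apply: smallest_sub => //; exact: sigma_algebra_measurable.
  move=> B' mB'; have := mid measurableT _ mB'; rewrite setTI.
  by congr (<<s G>> _); apply/seteqP; split => -[[? ?] ?].
have GI : setI_closed G.
  move=> _ _ [A1 [V1 [C1 [mA1 mV1 mC1 ->]]]] [A2 [V2 [C2 [mA2 mV2 mC2 ->]]]].
  exists (A1 `&` A2), (V1 `&` V2), (C1 `&` C2); split; try exact: measurableI.
  by rewrite !setXI.
move=> mB; have : distribution P Z B = M B.
  apply: (measure_unique G (fun=> setT)) => //.
  - by move=> _; exists setT, setT, setT; split; rewrite ?setXTT.
  - by rewrite bigcup_const.
  - move=> _ [A [VV [CC [mA mVV mCC ->]]]].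
    pose F : S * RR * 'rV[R]_d -> \bar R := fun z => (\1_((A `*` VV) `*` CC) z)%:E.
    have mF : measurable_fun setT F.
      apply/measurable_EFinP; apply: measurable_indic.
      by apply: measurableX => //; exact: measurableX.
    have F0 z : 0 <= F z by rewrite lee_fin.
    transitivity (\int[PU \x mu]_z (F z * (rho z)%:E)); last first.
      rewrite /= /m2 [RHS]integral_mkcond; apply: eq_integral => z _.
      by rewrite patchE /F indicE; case: ifPn => _; rewrite ?mul1e ?mul0e.
    rewrite draw_meanE//.
    transitivity (P (X @^-1` A `&` (C @^-1` CC `&` V @^-1` VV))).
      rewrite /= /distribution /pushforward; congr (P _).
      by apply/seteqP; split => w /=; [move=> [[]]|move=> [? []]].
    rewrite draw// integral_mkcond; apply: eq_integral => w _.
    rewrite patchE /draw_mean; case: ifPn => wA.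
      have {}wA : A (X w) by rewrite inE in wA.
      rewrite (muleC (mu _)) -muleA; congr (_ * _).
      transitivity (\int[mu]_(c in xsection D (X w)) ((\1_CC c)%:E * unif VV)).
        rewrite ge0_integralZr//; last 2 first.
        - exact: measurable_xsection.
        - by apply/measurable_EFinP; apply: measurable_funTS.
        by rewrite integral_indic//; exact: measurable_xsection.
      apply: eq_integral => c _.
      transitivity (\int[unif]_v ((\1_CC c)%:E * (\1_VV v)%:E)).
        rewrite ge0_integralZl//; last by apply/measurable_EFinP.
        by rewrite integral_indic// setIT.
      apply: eq_integral => v _; rewrite /F -EFinM; congr _%:E.
      rewrite !indicE -natrM mulnb; congr ((nat_of_bool _)%:R).
      apply/idP/idP; first by move=> /andP[]; rewrite !inE => cC vV.
      by rewrite !inE => -[[_ vV] cC]; apply/andP; rewrite !inE.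
    rewrite [X in _ * X]integral0_eq ?mule0// => c _.
    apply: integral0_eq => v _; rewrite /F indicE memNset// => -[[xA _] _].
    by move: wA; rewrite notin_setE; apply.
  - move=> _; rewrite (le_lt_trans (probability_le1 _ measurableT))//.
    exact: ltry.
by [].
Qed.

(** Passes from product events to arbitrary nonnegative functions of the past and the new draw:
    average over the draw with the past held fixed, then over the past. *)
Theorem freezing (F : S * RR * 'rV[R]_d -> \bar R) :
  measurable_fun setT F -> (forall z, 0 <= F z) ->
  \int[P]_w F (X w, V w, C w) = \int[P]_w draw_mean F (X w).
Proof.
move=> mF F0; rewrite -draw_meanE//.
have mX : measurable_fun setT X by exact: measurable_funPT.
have mZ : measurable_fun setT (fun w => (X w, V w, C w)).
  by apply: measurable_fun_pair => //; exact: measurable_fun_pair.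
pose Zm := isMeasurableFun.Build _ _ _ _ (fun w => (X w, V w, C w)) mZ.
pose Z : {mfun Omega >-> (S * RR * 'rV[R]_d)%type} := HB.pack (fun w => (X w, V w, C w)) Zm.
rewrite -(ge0_integral_density (nu := distribution P Z) rho_ge0 mrho)//.
by rewrite ge0_integral_distribution.
Qed.

End freezing.

(** * The jump chain *)

Section chain_facts.
Context {R : realType} {d : nat} {dO : measure_display} {Omega : measurableType dO}.
Variables r U : R.
Hypotheses (r0 : 0 < r) (U01 : 0 < U < 1).
Variables (f : 'rV[R]_d -> R).
Hypotheses (hf : Sc f) (f_neq0 : supp f !=set0).
Variables (c : nat -> Omega -> 'rV[R]_d) (v : nat -> Omega -> R).
Local Notation mu := (@lebesgue_rV R d).
Local Notation state := (state r U f c v).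

Lemma jump_rate_gt0 (g : 'rV[R]_d -> R) : Sc g -> supp g !=set0 -> (0 < jump_rate r g)%E.
Proof.
move=> hg [y gy]; apply: (@lt_le_trans _ _ (ball_vol r : R)%:E).
  by rewrite lte_fin; exact: (@ball_vol_gt0 R d).
rewrite -(lebesgue_rV_eball y); apply: le_measure; rewrite ?inE.
- exact: measurable_eball.
- exact: Sc_enlarge_measurable.
by move=> x xy; exists y.
Qed.

(** The two properties are proved together because both are needed for the positive rate that rules
    out the absorbing branch of [state]. *)
Lemma state_Sc_supp n w : Sc (state n w) /\ supp (state n w) !=set0.
Proof.
elim: n => [//|n [IHS IHne]] /=; rewrite gt_eqF ?jump_rate_gt0//.
split; first exact: jump_Sc.
rewrite supp_jump//; case: ifPn => // _; case: IHne => y ys.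
by exists y; left.
Qed.

Lemma state_Sc n w : Sc (state n w). Proof. by have [] := state_Sc_supp n w. Qed.

Lemma state_rate_gt0 n w : (0 < jump_rate r (state n w))%E.
Proof. by have [hS hs] := state_Sc_supp n w; exact: jump_rate_gt0. Qed.

Lemma stateS n w : state n.+1 w = jump r U (state n w) (c n w) (v n w).
Proof. by rewrite /= gt_eqF// state_rate_gt0. Qed.

Definition red_event n w : bool := v n w <= state n w (c n w).

Lemma supp_stateS n w : supp (state n.+1 w) =
  if red_event n w then supp (state n w) `|` eball (c n w) r else supp (state n w).
Proof. by rewrite stateS supp_jump//; exact: state_Sc. Qed.

(** The draws enter the support only through the red centres; without the bound on k, the same union
    gives the limit support. *)
Lemma supp_state n w : supp (state n w) =
  supp f `|` \bigcup_(k in [set k | (k < n)%N && red_event k w]) eball (c k w) r.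
Proof.
elim: n => [|n IH]; first by rewrite bigcup0 ?setU0// => k /=; rewrite ltn0.
rewrite supp_stateS IH; apply/seteqP; split => x.
  case: ifPn => hr.
    move=> [[fx|[k /= /andP[kn kr] kx]]|cx]; first by left.
      by right; exists k => //=; rewrite (leqW kn) kr.
    by right; exists n => //=; rewrite ltnSn.
  move=> [fx|[k /= /andP[kn kr] kx]]; first by left.
  by right; exists k => //=; rewrite (leqW kn) kr.
move=> [fx|[k /= /andP[kn kr] kx]].
  by case: ifPn => _; [left|]; left.
move: kn; rewrite ltnS leq_eqVlt => /orP[/eqP kn|kn].
  by move: kx; rewrite -kn kr => kx; right.
have h : (supp f `|` \bigcup_(k0 in [set k0 | (k0 < n)%N && red_event k0 w]) eball (c k0 w) r) x.
  by right; exists k => //=; rewrite kn.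
by case: ifPn => _ //; left.
Qed.

Lemma supp_state_nondecreasing m n w : (m <= n)%N -> supp (state m w) `<=` supp (state n w).
Proof.
move=> mn; rewrite !supp_state; apply: setUS => x [k /= /andP[km kr] kx].
by exists k => //=; rewrite kr (leq_trans km mn).
Qed.

Definition rate n w : R := fine (jump_rate r (state n w)).

Lemma rateE n w : (rate n w)%:E = jump_rate r (state n w).
Proof.
rewrite fineK// ge0_fin_numE; first exact: Sc_enlarge_lty (state_Sc _ _).
exact/ltW/state_rate_gt0.
Qed.

Lemma rate_gt0 n w : 0 < rate n w.
Proof. by rewrite -lte_fin rateE state_rate_gt0. Qed.

(** A jump adds to the enlarged support at most one ball of radius 2 r. This linear growth is what
    brings in the harmonic series. *)
Lemma rate_linear : exists2 a : R, 0 < a & forall n w, rate n w <= a * n.+1%:R.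
Proof.
pose b : R := @ball_vol R d (r + r).
have b0 : 0 <= b by exact: ball_vol_ge0.
pose a0 : R := fine (jump_rate r f).
have a00 : 0 <= a0 by exact: fine_ge0.
exists (a0 + b + 1); first by rewrite ltr_wpDl// addr_ge0.
suff h n w : rate n w <= a0 + b * n%:R.
  move=> n w; apply: (le_trans (h n w)).
  rewrite mulrDl mul1r mulrDl -addrA lerD//; first by rewrite ler_peMr// ler1n.
  by rewrite -[leLHS]addr0 lerD// ler_wpM2l// ler_nat.
elim: n => [|n IH]; first by rewrite mulr0 addr0.
have mE k := Sc_enlarge_measurable r (state_Sc k w).
have : (jump_rate r (state n.+1 w) <= jump_rate r (state n w) + b%:E)%E.
  rewrite /jump_rate supp_stateS; case: ifPn => _; last by rewrite leeDl// lee_fin.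
  rewrite enlargeU enlarge_eball//.
  rewrite -(lebesgue_rV_eball (c n w)).
  exact: (measureU2 mu (mE n) (measurable_eball _ _)).
rewrite -!rateE -EFinD lee_fin => h; apply: (le_trans h).
by rewrite mulrSr mulrDr mulr1 addrA lerD2r.
Qed.

End chain_facts.

(** * Measurability of the chain in the sample *)

Section chain_measurability.
Context {R : realType} {d : nat}.
Variables r U : R.
Hypotheses (r0 : 0 < r) (U01 : 0 < U < 1).
Variables (f : 'rV[R]_d -> R).
Hypotheses (hf : Sc f) (f_neq0 : supp f !=set0).
Context {dT : measure_display} {T : measurableType dT}.
Variables (c : nat -> T -> 'rV[R]_d) (v : nat -> T -> R).
Local Notation mu := (@lebesgue_rV R d).
Local Notation state := (state r U f c v).
Variable N : nat.
Hypotheses (mc : forall k, (k < N)%N -> measurable_fun setT (c k))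
  (mv : forall k, (k < N)%N -> measurable_fun setT (v k)).

(** Joint measurability in the sample and the location, for Tonelli. Only draws of index below N are
    assumed measurable, so that T can be [history N], whose events involve just these draws. *)
Lemma measurable_state n : (n <= N)%N ->
  measurable_fun setT (fun p : T * 'rV[R]_d => state n p.1 p.2).
Proof.
elim: n => [_|n IH nN].
  exact: (measurableT_comp (Sc_measurable hf) measurable_snd).
have ms := IH (ltnW nN).
have mc' : measurable_fun setT (fun p : T * 'rV[R]_d => c n p.1).
  exact: (measurableT_comp (mc nN) measurable_fst).
have mv' : measurable_fun setT (fun p : T * 'rV[R]_d => v n p.1).
  exact: (measurableT_comp (mv nN) measurable_fst).
have msc : measurable_fun setT (fun p : T * 'rV[R]_d => state n p.1 (c n p.1)).
  have mp : measurable_fun setT (fun p : T * 'rV[R]_d => (p.1, c n p.1)).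
    by apply: measurable_fun_pair => //; exact: measurable_fst.
  exact: (measurableT_comp ms mp).
rewrite (_ : (fun p => _) = (fun p : T * 'rV[R]_d => state n p.1 p.2 +
   U * kern r (c n p.1) p.2 * ((v n p.1 <= state n p.1 (c n p.1))%R%:R - state n p.1 p.2))).
  apply: measurable_funD => //; apply: measurable_funM.
    by apply: measurable_funM => //; apply: measurable_kern => //; exact: measurable_snd.
  apply: measurable_funB => //; apply: measurable_natb.
  exact: measurable_fun_ler.
by apply/funext => p; rewrite stateS.
Qed.

Lemma measurable_red k : (k < N)%N -> measurable_fun setT (red_event r U f c v k).
Proof.
move=> kN; apply: measurable_fun_ler; first exact: mv.
have mp : measurable_fun setT (fun w : T => (w, c k w)).
  by apply: measurable_fun_pair => //; exact: mc.
exact: (measurableT_comp (measurable_state (ltnW kN)) mp).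
Qed.

Definition draw_region (rho : R) n : set (T * 'rV[R]_d) :=
  [set p | enlarge rho (supp (state n p.1)) p.2].

(** The support is a closure; its measurable dependence on the sample is obtained by following how
    it grows, each red jump adding one enlarged ball. The radius rho is r for drawing centres and r
    / 2 for the recurrence argument. *)
Lemma measurable_draw_region rho n : 0 < rho -> (n <= N)%N ->
  measurable (draw_region rho n).
Proof.
move=> rho0; elim: n => [_|n IH nN].
  rewrite (_ : draw_region rho 0 = setT `*` enlarge rho (supp f)).
    by apply: measurableX => //; exact: Sc_enlarge_measurable.
  by apply/seteqP; split => p; [move=> h; split|move=> []].
rewrite (_ : draw_region rho n.+1 = draw_region rho n `|`
  ([set p | red_event r U f c v n p.1] `&` [set p | enorm (p.2 - c n p.1) <= rho + r])); last first.
  apply/seteqP; split => p; rewrite /draw_region/= supp_stateS//.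
    by case: ifPn => hr; [rewrite enlargeU enlarge_eball// => -[]; [left|right]|left].
  case: ifPn => hr; first by rewrite enlargeU enlarge_eball// => -[]; [left|move=> []; right].
  by move=> [//|[]].
apply: measurableU; first exact: IH (ltnW nN).
apply: measurableI.
  have h : measurable_fun setT (fun p : T * 'rV[R]_d => red_event r U f c v n p.1).
    exact: (measurableT_comp (measurable_red nN) measurable_fst).
  by have := h measurableT [set true] I; rewrite setTI.
have h : measurable_fun setT (fun p : T * 'rV[R]_d => enorm (p.2 - c n p.1) <= rho + r).
  apply: measurable_fun_ler => //; apply: measurable_enormB; first exact: measurable_snd.
  exact: (measurableT_comp (mc nN) measurable_fst).
by have := h measurableT [set true] I; rewrite setTI.
Qed.

Lemma xsection_draw_region rho n w :
  xsection (draw_region rho n) w = enlarge rho (supp (state n w)).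
Proof. by apply/seteqP; split => x; rewrite /xsection/= inE. Qed.

Lemma measurable_rate n : (n <= N)%N -> measurable_fun setT (rate r U f c v n).
Proof.
move=> nN; apply/measurable_EFinP.
rewrite (_ : EFin \o _ = mu \o xsection (draw_region r n)).
  by apply: measurable_fun_xsection; exact: measurable_draw_region.
by apply/funext => w /=; rewrite rateE// xsection_draw_region.
Qed.

Lemma measurable_mass_state n : (n <= N)%N ->
  measurable_fun setT (fun w => mass (state n w)).
Proof.
move=> nN; apply/measurable_EFinP.
rewrite (_ : EFin \o _ = (fun w => \int[mu]_x (state n w x)%:E)%E); last first.
  by apply/funext => w /=; rewrite massE//; exact: state_Sc.
apply: (measurable_fun_fubini_tonelli_F (m2 := mu) (fun p : T * 'rV[R]_d => (state n p.1 p.2)%:E)).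
  by apply/measurable_EFinP; exact: measurable_state.
by move=> p; rewrite lee_fin; exact: Sc_ge0 (state_Sc _ _ _ _ _ _ _ _).
Qed.

End chain_measurability.

(** * Pasts as sigma-algebras and one-step averages *)

Section chain_history.
Context {R : realType} {d : nat} {dO : measure_display} {Omega : measurableType dO}.
Variables r U : R.
Hypotheses (r0 : 0 < r) (U01 : 0 < U < 1).
Variables (f : 'rV[R]_d -> R).
Hypotheses (hf : Sc f) (f_neq0 : supp f !=set0).
Variables (P : probability Omega R).
Variables (tau : nat -> Omega -> R) (c : nat -> Omega -> 'rV[R]_d) (v : nat -> Omega -> R).
Hypotheses (mtau : forall n, measurable_fun setT (tau n))
  (mc : forall n, measurable_fun setT (c n)) (mv : forall n, measurable_fun setT (v n)).
Hypothesis law : draws_law r U f tau c v P.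
Local Notation mu := (@lebesgue_rV R d).
Local Notation state := (state r U f c v).
Local Notation red := (red_event r U f c v).
Local Notation rate := (rate r U f c v).
Local Notation RR := (measurableTypeR R).
Local Notation unif := (uniform_prob (@ltr01 R)).

Definition draws_before (n : nat) : set_system Omega :=
  \bigcup_(k in `I_n)
        (preimage_set_system setT (tau k) measurable `|`
         preimage_set_system setT (c k) measurable `|`
         preimage_set_system setT (v k) measurable).

(* The measurable sets of [history n] are, by conversion, those of [past n]. *)
Definition history (n : nat) := g_sigma_algebraType (draws_before n).

Lemma history_subset n : @measurable _ (history n) `<=` @measurable _ Omega.
Proof.
apply: smallest_sub; first exact: sigma_algebra_measurable.
move=> A [k _ [[|]|]] [B mB <-]; rewrite setTI -[X in measurable X]setTI.
- exact: mtau.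
- exact: mc.
- exact: mv.
Qed.

Lemma history_c n k : (k < n)%N -> measurable_fun [set: history n] (c k).
Proof.
by move=> kn _ A mA; apply: sub_sigma_algebra; exists k => //; left; right; exists A.
Qed.

Lemma history_v n k : (k < n)%N -> measurable_fun [set: history n] (v k).
Proof.
by move=> kn _ A mA; apply: sub_sigma_algebra; exists k => //; right; exists A.
Qed.

Lemma measurable_id_history n : measurable_fun [set: Omega] (id : Omega -> history n).
Proof. by move=> _ A mA; rewrite setTI; exact: (history_subset mA). Qed.

Definition draw_average n (F : history n * RR * 'rV[R]_d -> \bar R) (w : Omega) : \bar R :=
  ((rate n w)^-1%:E * \int[mu]_(x in enlarge r (supp (state n w)))
     \int[unif]_t F (w : history n, t, x))%E.

(** [freezing] with the whole past as X, that is, the identity into the smaller sigma-algebra. The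
    waiting time is integrated out by letting its event be everything. *)
Lemma chain_freezing n (F : history n * RR * 'rV[R]_d -> \bar R) :
  measurable_fun setT F -> (forall z, 0 <= F z)%E ->
  (\int[P]_w F (w : history n, v n w, c n w) = \int[P]_w draw_average F w)%E.
Proof.
move=> mF F0.
pose Xm := isMeasurableFun.Build _ _ _ _ (id : Omega -> history n) (@measurable_id_history n).
pose X : {mfun Omega >-> history n} := HB.pack (id : Omega -> history n) Xm.
have mD := @measurable_draw_region R d r U r0 U01 f hf f_neq0 _ (history n) c v n
  (@history_c n) (@history_v n) r n r0 (leqnn n).
have ml := @measurable_rate R d r U r0 U01 f hf f_neq0 _ (history n) c v n
  (@history_c n) (@history_v n) n (leqnn n).
have lgt0 (w : history n) : 0 < rate n w by exact: rate_gt0.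
have hdraw A CC VV : measurable (A : set (history n)) -> measurable CC ->
    measurable (VV : set RR) -> P (X @^-1` A `&` (c n @^-1` CC `&` v n @^-1` VV)) =
    (\int[P]_(w in X @^-1` A) (mu (CC `&` xsection (draw_region r U f c v r n) (X w)) *
      (rate n (X w))^-1%:E * unif VV))%E.
  move=> mA mCC mVV; rewrite (_ : X @^-1` A = A)//.
  have := law (G := A) (D := setT) mA measurableT mCC mVV.
  have -> : A `&` [set w | (0 < jump_rate r (state n w))%E] = A.
    by apply/seteqP; split => w /=; [case|move=> Aw; split => //; exact: state_rate_gt0].
  rewrite preimage_setT setTI => ->; apply: eq_integral => w _.
  have h0 : (0 < fine (jump_rate r (state n w)))%R by exact: rate_gt0.
  rewrite {1}/exponential_prob integral_exponential_pdf// mul1e.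
  by rewrite /uniform_on xsection_draw_region.
apply: (etrans (freezing (P := P) (X := X) (mc n) (mv n) mD ml lgt0 hdraw mF F0)).
by apply: eq_integral => w _; rewrite /draw_mean/= xsection_draw_region.
Qed.

Lemma measurable_draw_average n (F : history n * RR * 'rV[R]_d -> \bar R) :
  measurable_fun setT F -> (forall z, 0 <= F z)%E ->
  measurable_fun [set: Omega] (draw_average F).
Proof.
move=> mF F0.
have mD := @measurable_draw_region R d r U r0 U01 f hf f_neq0 _ (history n) c v n
  (@history_c n) (@history_v n) r n r0 (leqnn n).
have ml := @measurable_rate R d r U r0 U01 f hf f_neq0 _ (history n) c v n
  (@history_c n) (@history_v n) n (leqnn n).
have lgt0 (w : history n) : 0 < rate n w by exact: rate_gt0.
have h := measurable_draw_mean mD ml lgt0 mF F0.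
rewrite (_ : draw_average F = (draw_mean (draw_region r U f c v r n) (rate n) F) \o
    (id : Omega -> history n)).
  exact: (measurableT_comp h (@measurable_id_history n)).
by apply/funext => w; rewrite /draw_mean/= xsection_draw_region.
Qed.

End chain_history.

(** * Mass along the embedded chain *)

Section mass_mean.
Context {R : realType} {d : nat}.
Variables r U : R.
Hypotheses (r0 : 0 < r) (U01 : 0 < U < 1).
Local Notation mu := (@lebesgue_rV R d).
Local Notation w := (@ball_vol R d r).

Let U0 : 0 < U. Proof. by case/andP: U01. Qed.

(** Averaged over v, a jump at c changes the mass by U (w g(c) - H(c)), and the two parts have equal
    integrals by [integral_lmass]. *)
Lemma mass_martingale (g : 'rV[R]_d -> R) : Sc g ->
  (\int[mu]_(c in enlarge r (supp g)) \int[uniform_prob (@ltr01 R)]_v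
      (mass (jump r U g c v))%:E = (fine (jump_rate r g) * mass g)%:E)%E.
Proof.
move=> hg; set E := enlarge r (supp g); set m := mass g.
have mE : measurable E by exact: Sc_enlarge_measurable.
have U0' := ltW U0; have m0 := mass_ge0 hg; have w0 := @ball_vol_ge0 R d r.
have muE : mu E = (fine (jump_rate r g))%:E.
  by rewrite fineK// ge0_fin_numE//; exact: Sc_enlarge_lty.
pose u c := m + U * w * g c - U * lmass r g c.
have uE c : (\int[uniform_prob (@ltr01 R)]_v (mass (jump r U g c v))%:E = (u c)%:E)%E.
  transitivity (\int[uniform_prob (@ltr01 R)]_v (if v <= g c
      then m + U * (w - lmass r g c) else m - U * lmass r g c)%:E)%E.
    apply: eq_integral => v _; rewrite mass_jump//; congr _%:E.
    by case: (v <= g c); rewrite ?mul1r// mul0r sub0r mulrN.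
  rewrite uniform_threshold.
  - by congr _%:E; rewrite /u; ring.
  - by rewrite Sc_ge0 ?Sc_le1.
  - exact: (mass_up_ge0 _ U01).
  - exact: (mass_down_ge0 r U01).
under eq_integral do rewrite uE.
have u0 c : 0 <= u c.
  have := mass_down_ge0 r U01 c hg; rewrite /u -/m => h.
  by rewrite addrAC addr_ge0// !mulr_ge0// Sc_ge0.
have ml : measurable_fun E (fun c => (lmass r g c)%:E).
  by apply/measurable_EFinP/measurable_funTS; exact: measurable_lmass.
have mg : measurable_fun E (fun c => (g c)%:E).
  by apply/measurable_EFinP/measurable_funTS; exact: Sc_measurable.
have mu' : measurable_fun E (fun c => (u c)%:E).
  apply/measurable_EFinP/measurable_funTS; apply: measurable_funB.
    apply: measurable_funD => //; apply: measurable_funM => //.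
    exact: Sc_measurable.
  by apply: measurable_funM => //; exact: measurable_lmass.
have IH : (\int[mu]_(c in E) (lmass r g c)%:E = (w * m)%:E)%E.
  rewrite integral_enlarge; first by rewrite integral_lmass.
  by move=> x; exact: lmass_notin.
have Ig : (\int[mu]_(c in E) (g c)%:E = m%:E)%E.
  rewrite integral_enlarge; first by rewrite massE.
  by move=> x; exact: notin_enlarge_supp.
have key : (\int[mu]_(c in E) (u c)%:E + U%:E * (w * m)%:E =
    m%:E * (fine (jump_rate r g))%:E + (U * w)%:E * m%:E)%E.
  have Uw : 0 <= U * w by exact: mulr_ge0.
  have l0 c : 0 <= U * lmass r g c by apply: mulr_ge0 => //; exact: lmass_ge0.
  have gw0 c : 0 <= U * w * g c by apply: mulr_ge0 => //; exact: Sc_ge0.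
  have -> : ((U * w)%:E * m%:E = \int[mu]_(x in E) ((U * w)%:E * (g x)%:E))%E.
    by rewrite ge0_integralZl ?Ig// => x _; rewrite lee_fin Sc_ge0.
  rewrite -IH -muE -integral_cst// -ge0_integralZl//; last first.
    by move=> x _; rewrite lee_fin lmass_ge0.
  rewrite -!ge0_integralD//; first last.
  - exact: measurable_funeM.
  - by move=> x _; rewrite -EFinM lee_fin.
  - by move=> x _; rewrite lee_fin.
  - exact: measurable_funeM.
  - by move=> x _; rewrite -EFinM lee_fin.
  apply: eq_integral => x _; rewrite -!EFinM -!EFinD; congr _%:E.
  by rewrite /u subrK.
have e1 : ((U * w)%:E * m%:E = U%:E * (w * m)%:E)%E by rewrite -!EFinM mulrA.
have e2 : (m%:E * (fine (jump_rate r g))%:E = (fine (jump_rate r g) * m)%:E)%E.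
  by rewrite -EFinM mulrC.
move: key; rewrite e1 e2 -EFinM => /(congr1 (fun z => z - (U * (w * m))%:E)%E).
by rewrite !addeK.
Qed.

End mass_mean.

Section mass_chain.
Context {R : realType} {d : nat} {dO : measure_display} {Omega : measurableType dO}.
Variables r U : R.
Hypotheses (r0 : 0 < r) (U01 : 0 < U < 1).
Variables (f : 'rV[R]_d -> R).
Hypotheses (hf : Sc f) (f_neq0 : supp f !=set0).
Variables (P : probability Omega R).
Variables (tau : nat -> Omega -> R) (c : nat -> Omega -> 'rV[R]_d) (v : nat -> Omega -> R).
Hypotheses (mtau : forall n, measurable_fun setT (tau n))
  (mc : forall n, measurable_fun setT (c n)) (mv : forall n, measurable_fun setT (v n)).
Hypothesis law : draws_law r U f tau c v P.
Local Notation mu := (@lebesgue_rV R d).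
Local Notation state := (state r U f c v).
Local Notation red := (red_event r U f c v).
Local Notation rate := (rate r U f c v).
Local Notation RR := (measurableTypeR R).
Local Notation unif := (uniform_prob (@ltr01 R)).
Local Notation history n := (history tau c v n).

Definition state_mass n w : R := mass (state n w).

(** By [mass_jump] the new mass is expressed through the old mass, the old density and H at the new
    centre, and H is jointly measurable by Tonelli. *)
Lemma measurable_jump_mass n : measurable_fun setT
  (fun z : history n * RR * 'rV[R]_d => mass (jump r U (state n z.1.1) z.2 z.1.2)).
Proof.
have hS (w : history n) : Sc (state n w) by exact: state_Sc.
have ms := @measurable_state R d r U r0 U01 f hf f_neq0 _ (history n) c v n
  (@history_c _ _ _ _ tau c v n) (@history_v _ _ _ _ tau c v n) n (leqnn n).
have mM := @measurable_mass_state R d r U r0 U01 f hf f_neq0 _ (history n) c v n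
  (@history_c _ _ _ _ tau c v n) (@history_v _ _ _ _ tau c v n) n (leqnn n).
have m11 : measurable_fun setT (fun z : history n * RR * 'rV[R]_d => z.1.1).
  exact: (measurableT_comp measurable_fst measurable_fst).
have m12 : measurable_fun setT (fun z : history n * RR * 'rV[R]_d => z.1.2 : R).
  exact: (measurableT_comp measurable_snd measurable_fst).
have mp : measurable_fun setT (fun z : history n * RR * 'rV[R]_d => (z.1.1, z.2)).
  by apply: measurable_fun_pair => //; exact: measurable_snd.
have ml : measurable_fun setT
    (fun p : history n * 'rV[R]_d => lmass r (state n p.1) p.2).
  apply/measurable_EFinP.
  rewrite (_ : EFin \o _ = (fun p : history n * 'rV[R]_d =>
      \int[mu]_x (state n p.1 x * kern r p.2 x)%:E)%E); last first.
    by apply/funext => p /=; rewrite lmassE.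
  apply: (measurable_fun_fubini_tonelli_F (m2 := mu)
    (fun q : history n * 'rV[R]_d * 'rV[R]_d => (state n q.1.1 q.2 * kern r q.1.2 q.2)%:E)).
    apply/measurable_EFinP; apply: measurable_funM.
      have mq : measurable_fun setT (fun q : history n * 'rV[R]_d * 'rV[R]_d => (q.1.1, q.2)).
        apply: measurable_fun_pair; last exact: measurable_snd.
        exact: (measurableT_comp measurable_fst measurable_fst).
      exact: (measurableT_comp ms mq).
    apply: measurable_kern; last exact: measurable_snd.
    exact: (measurableT_comp measurable_snd measurable_fst).
  by move=> q; rewrite lee_fin; exact: gkern_ge0.
rewrite (_ : (fun z => _) = (fun z : history n * RR * 'rV[R]_d => mass (state n z.1.1) +
    U * ((z.1.2 <= state n z.1.1 z.2)%R%:R * @ball_vol R d r - lmass r (state n z.1.1) z.2))).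
  apply: measurable_funD; first exact: (measurableT_comp mM m11).
  apply: measurable_funM => //; apply: measurable_funB; last exact: (measurableT_comp ml mp).
  apply: measurable_funM => //; apply: measurable_natb.
  by apply: measurable_fun_ler => //; exact: (measurableT_comp ms mp).
by apply/funext => z; rewrite mass_jump.
Qed.

(** A version of the conditional mean of [h (state_mass n.+1 w)] given [past n], as
    [chain_step_mean] shows. *)
Definition mean_after (h : R -> R) n (w : Omega) : \bar R :=
  ((rate n w)^-1%:E * \int[mu]_(x in enlarge r (supp (state n w))) \int[unif]_t
     (h (mass (jump r U (state n w) x t)))%:E)%E.

Lemma measurable_mean_after (h : R -> R) n :
  measurable_fun setT h -> (forall x, 0 <= h x) -> measurable_fun setT (mean_after h n).
Proof.
move=> mh h0.
have mF := (measurableT_comp mh (@measurable_jump_mass n)).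
have mF' : measurable_fun setT (fun z : history n * RR * 'rV[R]_d =>
    (h (mass (jump r U (state n z.1.1) z.2 z.1.2)))%:E) by exact/measurable_EFinP.
have F0 (z : history n * RR * 'rV[R]_d) :
    (0 <= (h (mass (jump r U (state n z.1.1) z.2 z.1.2)))%:E)%E by rewrite lee_fin.
exact: (measurable_draw_average r0 U01 hf f_neq0 mtau mc mv mF' F0).
Qed.

Lemma chain_step_mean n (h : R -> R) (G : set Omega) :
  measurable_fun setT h -> (forall x, 0 <= h x) -> past tau c v n G ->
  (\int[P]_(w in G) (h (state_mass n.+1 w))%:E =
   \int[P]_(w in G) mean_after h n w)%E.
Proof.
move=> mh h0 pG.
have mG : measurable (G : set (history n)) by [].
pose F (z : history n * RR * 'rV[R]_d) : \bar R :=
  ((\1_G z.1.1 : R) * h (mass (jump r U (state n z.1.1) z.2 z.1.2)))%:E.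
have mF : measurable_fun setT F.
  apply/measurable_EFinP; apply: measurable_funM.
    apply: (measurableT_comp (measurable_indic mG)).
    exact: (measurableT_comp measurable_fst measurable_fst).
  exact: (measurableT_comp mh (@measurable_jump_mass n)).
have F0 z : (0 <= F z)%E by rewrite lee_fin mulr_ge0// indicE.
have := chain_freezing r0 U01 hf f_neq0 mtau mc mv law mF F0.
have -> : (\int[P]_w F (w, v n w, c n w) = \int[P]_(w in G) (h (state_mass n.+1 w))%:E)%E.
  rewrite [RHS]integral_mkcond; apply: eq_integral => w _.
  rewrite patchE /state_mass stateS// /F/= indicE.
  by case: ifPn => _; rewrite ?mul1r ?mul0r.
move=> ->; rewrite [RHS]integral_mkcond; apply: eq_integral => w _.
rewrite patchE /draw_average /mean_after; case: ifPn => wG; rewrite /F/= indicE.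
  rewrite wG; congr (_ * _)%E; apply: eq_integral => x _.
  by apply: eq_integral => t _; rewrite mul1r.
rewrite (negbTE wG) [X in (_ * X)%E]integral0_eq ?mule0// => x _.
by apply: integral0_eq => t _; rewrite mul0r.
Qed.

End mass_chain.

(** * Expected mass and finiteness of the red events *)

(** If b stayed above eps, summing the decrements would bound the harmonic series by a(0) C / eps.
    Used both for the mean of [sat] and for the probability of missing a ball. *)
Lemma vanishing_decrement {R : realType} (a b : nat -> R) (C : R) :
  0 < C -> (forall n, 0 <= a n) -> (forall n, 0 <= b n) ->
  (forall n, a n.+1 + b n / (C * n.+1%:R) <= a n) ->
  forall eps, 0 < eps -> exists n, b n < eps.
Proof.
move=> C0 a0 b0 ab eps eps0; apply: contrapT => /forallNP hb.
have {}hb n : eps <= b n by rewrite leNgt; apply/negP.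
have hs n : eps / C * series harmonic n <= a 0%N - a n.
  elim: n => [|n IH]; first by rewrite /series/= big_geq// mulr0 subrr.
  rewrite seriesEnat/= big_nat_recr//= mulrDr.
  have h1 := ab n; have h2 : eps / C * n.+1%:R^-1 <= b n / (C * n.+1%:R).
    by rewrite invfM mulrA !ler_wpM2r// invr_ge0 ltW.
  move: IH; rewrite seriesEnat/= => IH.
  have := lerD IH (le_trans h2 _) => /(_ (a n - a n.+1)); rewrite lerBrDl => /(_ h1).
  by rewrite addrA subrK.
apply: (@dvg_harmonic R); apply: nondecreasing_is_cvgn.
  by apply: nondecreasing_series => n _ _; exact: harmonic_ge0.
exists (a 0%N / (eps / C)) => _ [n _ <-].
rewrite ler_pdivlMr ?divr_gt0// mulrC (le_trans (hs n))// gerBl//.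
Qed.

Section mass_expectation.
Context {R : realType} {d : nat} {dO : measure_display} {Omega : measurableType dO}.
Variables r U : R.
Hypotheses (d0 : (0 < d)%N) (r0 : 0 < r) (U01 : 0 < U < 1).
Variables (f : 'rV[R]_d -> R).
Hypotheses (hf : Sc f) (f_neq0 : supp f !=set0).
Variables (P : probability Omega R).
Variables (tau : nat -> Omega -> R) (c : nat -> Omega -> 'rV[R]_d) (v : nat -> Omega -> R).
Hypotheses (mtau : forall n, measurable_fun setT (tau n))
  (mc : forall n, measurable_fun setT (c n)) (mv : forall n, measurable_fun setT (v n)).
Hypothesis law : draws_law r U f tau c v P.
Local Notation mu := (@lebesgue_rV R d).
Local Notation w0 := (@ball_vol R d r).
Local Notation state := (state r U f c v).
Local Notation red := (red_event r U f c v).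
Local Notation rate := (rate r U f c v).
Local Notation M := (state_mass r U f c v).
Local Notation decay := (@sat_decay R d r U).

Let U0 : 0 < U. Proof. by case/andP: U01. Qed.

Lemma state_mass_ge0 n w : 0 <= M n w.
Proof. by apply: mass_ge0; exact: state_Sc. Qed.

Lemma measurable_state_mass n : measurable_fun setT (M n).
Proof. exact: (@measurable_mass_state R d r U r0 U01 f hf f_neq0 _ Omega c v n). Qed.

Lemma measurable_rateT n : measurable_fun setT (rate n).
Proof. exact: (@measurable_rate R d r U r0 U01 f hf f_neq0 _ Omega c v n). Qed.

Lemma measurable_sat_mass n : measurable_fun setT (fun w => sat (M n w)).
Proof.
rewrite (_ : (fun w => _) = (fun w => sat `|M n w|)).
  exact: (measurableT_comp measurable_sat (measurable_state_mass n)).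
by apply/funext => w; rewrite ger0_norm// state_mass_ge0.
Qed.

Lemma past_measurable n G : past tau c v n G -> measurable G.
Proof. by move=> pG; exact: (history_subset mtau mc mv pG). Qed.

Lemma decay_ge0 delta m : 0 < delta -> 0 <= m -> 0 <= decay delta m.
Proof.
move=> delta0 m0; have w00 := @ball_vol_ge0 R d r.
apply: mulr_ge0.
  apply: divr_ge0; first exact: sqr_ge0.
  by apply: mulr_ge0; [exact: sqr_ge0|rewrite !addr_ge0].
rewrite le_min ltW//=; apply: mulr_ge0 => //; exact: sqr_ge0.
Qed.

Lemma measurable_decay_mass delta n :
  measurable_fun setT (fun w => decay delta (M n w)).
Proof.
have mM := measurable_state_mass n; have w00 := @ball_vol_ge0 R d r.
rewrite (_ : (fun w => _) = (fun w =>
  U ^+ 2 * powR ((1 + M n w) ^+ 2 * (1 + M n w + w0)) (-1) *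
    Num.min delta (M n w * (w0 / 2) ^+ 2))); last first.
  apply/funext => w; rewrite /sat_decay powR_inv1//.
  have m0 := state_mass_ge0 n w.
  by apply: mulr_ge0; [exact: sqr_ge0|rewrite !addr_ge0].
apply: measurable_funM.
  apply: measurable_funM => //; apply: (measurableT_comp (measurable_powR _)).
  apply: measurable_funM; first by apply: measurable_funX; exact: measurable_funD.
  by apply: measurable_funD => //; exact: measurable_funD.
by apply: measurable_minr => //; exact: measurable_funM.
Qed.

(** Integrating over an arbitrary event of the past replaces conditioning and permits the stopping
    argument of [red_between_maximal]. *)
Lemma sat_mass_step : exists2 delta : R, 0 < delta & forall n G, past tau c v n G ->
  (\int[P]_(w in G) (sat (M n.+1 w))%:E +
     \int[P]_(w in G) (decay delta (M n w) / rate n w)%:E <=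
   \int[P]_(w in G) (sat (M n w))%:E)%E.
Proof.
have [delta delta0 hdelta] := @sat_supermartingale R d r U d0 r0 U01.
exists delta => // n G pG; have mG := past_measurable pG.
(* [chain_step_mean] wants a function that is nonnegative on the whole line; on masses the absolute
   value changes nothing. *)
have ms0 : forall x : R, 0 <= sat `|x| by move=> x; exact: sat_ge0.
have -> : (\int[P]_(w in G) (sat (M n.+1 w))%:E =
    \int[P]_(w in G) (sat `|M n.+1 w|)%:E)%E.
  by apply: eq_integral => w _; rewrite ger0_norm// state_mass_ge0.
rewrite (chain_step_mean r0 U01 hf f_neq0 mtau mc mv law measurable_sat ms0 pG).
have mma := measurable_mean_after r0 U01 hf f_neq0 mtau mc mv n measurable_sat ms0.
have ma0 w : (0 <= mean_after r U f c v (fun x => sat `|x|) n w)%E.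
  apply: mule_ge0; first by rewrite lee_fin invr_ge0 ltW// rate_gt0.
  by apply: integral_ge0 => x _; apply: integral_ge0 => t _; rewrite lee_fin.
have mdr : measurable_fun setT (fun w => (decay delta (M n w) / rate n w)%:E).
  apply/measurable_EFinP; apply: measurable_funM; first exact: measurable_decay_mass.
  rewrite (_ : (fun w => _) = (fun w => powR (rate n w) (-1))).
    exact: (measurableT_comp (measurable_powR _) (measurable_rateT n)).
  by apply/funext => w; rewrite powR_inv1// ltW// rate_gt0.
have dr0 w : 0 <= decay delta (M n w) / rate n w.
  by rewrite divr_ge0 ?decay_ge0 ?state_mass_ge0// ltW// rate_gt0.
rewrite -ge0_integralD//; last 3 first.
- exact: measurable_funTS.
- by move=> w _; rewrite lee_fin.
- exact: measurable_funTS.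
apply: ge0_le_integral => //.
- by move=> w _; rewrite adde_ge0 ?lee_fin.
- by apply: measurable_funTS; exact: emeasurable_funD.
- by apply/measurable_EFinP/measurable_funTS; exact: measurable_sat_mass.
move=> w Gw; have hS := state_Sc r0 U01 hf f_neq0 c v n w.
have rt0 := rate_gt0 r0 U01 hf f_neq0 c v n w.
have := hdelta _ hS; rewrite -/(rate n w) -/(M n w) /mean_after => h.
rewrite (_ : decay _ _ / _ = (rate n w)^-1 * decay delta (M n w)); last by rewrite mulrC.
rewrite EFinM -ge0_muleDr; last 2 first.
- by apply: integral_ge0 => x _; apply: integral_ge0 => t _; rewrite lee_fin.
- by rewrite lee_fin decay_ge0// state_mass_ge0.
have -> : (sat (M n w))%:E = ((rate n w)^-1%:E * (rate n w * sat (M n w))%:E)%E.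
  by rewrite -EFinM mulKf// gt_eqF.
apply: lee_wpmul2l; first by rewrite lee_fin invr_ge0 ltW.
apply: le_trans h; apply: leeD2r; rewrite le_eqVlt; apply/orP; left; apply/eqP.
apply: eq_integral => x _; apply: eq_integral => t _.
by rewrite ger0_norm// mass_ge0//; exact: jump_Sc.
Qed.

Lemma expected_mass n : (\int[P]_w (M n w)%:E = (mass f)%:E)%E.
Proof.
elim: n => [|n IH].
  by under eq_integral do rewrite /state_mass/=; rewrite integral_cst//= probability_setT mule1.
have mabs : measurable_fun setT (fun x : R => `|x|) by [].
have abs0 : forall x : R, 0 <= `|x| by [].
have pT : past tau c v n setT.
  by apply: (@measurableT _ (history tau c v n)).
rewrite -IH; transitivity (\int[P]_w (`|M n.+1 w|)%:E)%E.
  by apply: eq_integral => w _; rewrite ger0_norm// state_mass_ge0.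
rewrite (chain_step_mean r0 U01 hf f_neq0 mtau mc mv law mabs abs0 pT).
apply: eq_integral => w _; rewrite /mean_after.
have hS := state_Sc r0 U01 hf f_neq0 c v n w.
have rt0 := rate_gt0 r0 U01 hf f_neq0 c v n w.
have := mass_martingale r0 U01 hS; rewrite -/(rate n w) -/(M n w) => h.
transitivity ((rate n w)^-1%:E * (rate n w * M n w)%:E)%E.
  congr (_ * _)%E; rewrite -h; apply: eq_integral => x _; apply: eq_integral => t _.
  by rewrite ger0_norm// mass_ge0//; exact: jump_Sc.
by rewrite -EFinM mulKf// gt_eqF.
Qed.

End mass_expectation.

(** * Finiteness of the red jumps *)

Section finitely_many_red_events.
Context {R : realType} {d : nat} {dO : measure_display} {Omega : measurableType dO}.
Variables r U : R.
Hypotheses (d0 : (0 < d)%N) (r0 : 0 < r) (U01 : 0 < U < 1).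
Variables (f : 'rV[R]_d -> R).
Hypotheses (hf : Sc f) (f_neq0 : supp f !=set0).
Variables (P : probability Omega R).
Variables (tau : nat -> Omega -> R) (c : nat -> Omega -> 'rV[R]_d) (v : nat -> Omega -> R).
Hypotheses (mtau : forall n, measurable_fun setT (tau n))
  (mc : forall n, measurable_fun setT (c n)) (mv : forall n, measurable_fun setT (v n)).
Hypothesis law : draws_law r U f tau c v P.
Local Notation mu := (@lebesgue_rV R d).
Local Notation w0 := (@ball_vol R d r).
Local Notation state := (state r U f c v).
Local Notation red := (red_event r U f c v).
Local Notation rate := (rate r U f c v).
Local Notation M := (state_mass r U f c v).
Local Notation decay := (@sat_decay R d r U).

Let U0 : 0 < U. Proof. by case/andP: U01. Qed.
Let U1 : U < 1. Proof. by case/andP: U01. Qed.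
Let w00 : 0 < w0. Proof. exact: ball_vol_gt0. Qed.

Let M0 n w : 0 <= M n w. Proof. exact: state_mass_ge0. Qed.

(** Three ranges of m: sat m <= m <= eta below eta, sat m <= 1 <= m / K above K, and in between the
    decay is at least kappa. In mean, the term m / K is controlled by the constant expected mass. *)
Lemma sat_le_decay (delta eta K : R) : 0 < delta -> 0 < eta -> 0 < K ->
  exists2 kappa : R, 0 < kappa &
    forall m, 0 <= m -> sat m <= eta + m / K + decay delta m / kappa.
Proof.
move=> delta0 eta0 K0.
pose A m : R := (1 + m) ^+ 2 * (1 + m + w0).
have A0 m : 0 <= m -> 0 < A m.
  move=> m0; rewrite mulr_gt0 ?exprn_gt0//; first by rewrite ltr_pwDl.
  by rewrite addr_gt0// ltr_pwDl.
(* The first factor of the decay decreases in m and the second increases, so on [eta, K] they are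
   bounded below by their values at K and at eta. *)
pose kappa : R := U ^+ 2 / A K * Num.min delta (eta * (w0 / 2) ^+ 2).
have w2 : 0 < (w0 / 2) ^+ 2 by rewrite exprn_gt0// divr_gt0.
have min0 : 0 < Num.min delta (eta * (w0 / 2) ^+ 2) by rewrite lt_min delta0 mulr_gt0.
have kappa0 : 0 < kappa.
  apply: mulr_gt0 => //; apply: divr_gt0; first by rewrite exprn_gt0.
  exact/A0/ltW.
exists kappa => // m m0.
have dk0 : 0 <= decay delta m / kappa.
  by apply: divr_ge0; [exact: decay_ge0|exact: ltW].
have mK0 : 0 <= m / K by rewrite divr_ge0// ltW.
have [mle|mgt] := leP m eta.
  by rewrite (le_trans (sat_le_id m0))// (le_trans mle)// -addrA lerDl addr_ge0.
have s1 := sat_le1 m0.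
have [Km|mK] := leP K m.
  rewrite (le_trans s1)//; have : 1 <= m / K by rewrite ler_pdivlMr// mul1r.
  lra.
rewrite (le_trans s1)//.
suff : 1 <= decay delta m / kappa by lra.
rewrite ler_pdivlMr// mul1r /kappa /sat_decay.
have AA : A m <= A K.
  have mK' := ltW mK.
  rewrite /A ler_pM ?sqr_ge0//.
  - by rewrite !addr_ge0// ltW.
  - by rewrite lerXn2r ?nnegrE ?addr_ge0 ?lerD2l// ltW.
  - by rewrite lerD2r lerD2l.
apply: ler_pM.
- by apply: divr_ge0; [exact: sqr_ge0|apply/ltW/A0/ltW].
- exact: ltW.
- by rewrite ler_wpM2l ?sqr_ge0// lef_pV2// posrE A0// ltW.
rewrite le_min ge_min lexx/= ge_min; apply/orP; right.
by rewrite ler_wpM2r// ltW.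
Qed.

Lemma expected_sat_mass_fin n : (\int[P]_w (sat (M n w))%:E)%E \is a fin_num.
Proof.
have s0 w : 0 <= sat (M n w) by exact: sat_ge0.
rewrite ge0_fin_numE; last by apply: integral_ge0 => w _; rewrite lee_fin.
apply: (@le_lt_trans _ _ (\int[P]_w (cst 1%:E w))%E); last first.
  by rewrite integral_cst//= probability_setT mule1 ltry.
apply: ge0_le_integral => //.
- by move=> w _; rewrite lee_fin.
- by apply/measurable_EFinP; exact: measurable_sat_mass.
by move=> w _; rewrite lee_fin sat_le1.
Qed.

Lemma inf_expected_sat_mass (eps : R) : 0 < eps ->
  exists n, (\int[P]_w (sat (M n w))%:E < eps%:E)%E.
Proof.
move=> eps0.
have [delta delta0 hstep] := sat_mass_step d0 r0 U01 hf f_neq0 mtau mc mv law.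
have [a a0 ha] := rate_linear r0 U01 hf f_neq0 c v.
have mf0 : 0 <= mass f by exact: mass_ge0.
(* Each of the three terms of [sat_le_decay] is to contribute at most eps / 4 in mean; the 1 added
   to the mass keeps K positive when f is null almost everywhere. *)
pose eta := eps / 4; pose K := (mass f + 1) * 4 / eps.
have eta0 : 0 < eta by rewrite divr_gt0.
have K0 : 0 < K by rewrite divr_gt0// mulr_gt0// ltr_wpDl.
have [kappa kappa0 hkappa] := sat_le_decay delta0 eta0 K0.
have dec0 n w : 0 <= decay delta (M n w) by exact: decay_ge0.
have mdec n := @measurable_decay_mass R d dO Omega r U r0 U01 f hf f_neq0 c v mc mv delta n.
have dec1 n w : decay delta (M n w) <= delta.
  rewrite /sat_decay -[leRHS]mul1r; apply: ler_pM.
  - apply: divr_ge0; first exact: sqr_ge0.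
    by apply: mulr_ge0; [exact: sqr_ge0|rewrite !addr_ge0// ltW].
  - rewrite le_min ltW//=; apply: mulr_ge0 => //; exact: sqr_ge0.
  - have := M0 n w; move: (M n w) => m m0.
    have m1 : 1 <= (1 + m) ^+ 2 by rewrite exprn_ege1// lerDl.
    have m2 : 1 <= 1 + m + w0 by rewrite -addrA lerDl addr_ge0// ltW.
    have m3 : 1 <= (1 + m) ^+ 2 * (1 + m + w0) by rewrite -[leLHS]mulr1 ler_pM.
    rewrite ler_pdivrMr ?(lt_le_trans ltr01 m3)// mul1r (le_trans _ m3)//.
    by rewrite exprn_ile1// ltW.
  - by rewrite ge_min lexx.
pose b n := fine (\int[P]_w (decay delta (M n w))%:E)%E.
have bE n : (\int[P]_w (decay delta (M n w))%:E)%E = (b n)%:E.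
  rewrite fineK// ge0_fin_numE; last by apply: integral_ge0 => w _; rewrite lee_fin.
  apply: (@le_lt_trans _ _ (\int[P]_w (cst delta%:E w))%E); last first.
    by rewrite integral_cst//= probability_setT mule1 ltry.
  apply: ge0_le_integral => //.
  - by move=> w _; rewrite lee_fin.
  - by apply/measurable_EFinP; exact: mdec.
  by move=> w _; rewrite lee_fin.
have b0 n : 0 <= b n.
  by rewrite -lee_fin -bE; apply: integral_ge0 => w _; rewrite lee_fin.
pose e n := fine (\int[P]_w (sat (M n w))%:E)%E.
have eE n : (\int[P]_w (sat (M n w))%:E)%E = (e n)%:E.
  by rewrite fineK// expected_sat_mass_fin.
have e0 n : 0 <= e n.
  rewrite -lee_fin -eE; apply: integral_ge0 => w _; rewrite lee_fin.
  exact: sat_ge0.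
have hdec n : e n.+1 + b n / (a * n.+1%:R) <= e n.
  have pT : past tau c v n setT by apply: (@measurableT _ (history tau c v n)).
  rewrite -lee_fin EFinD -!eE; apply: le_trans (hstep n _ pT).
  rewrite leeD2lE; last exact: expected_sat_mass_fin.
  rewrite EFinM -bE muleC -ge0_integralZl//; last 3 first.
  - by apply/measurable_EFinP; exact: mdec.
  - by move=> w _; rewrite lee_fin.
  - by rewrite lee_fin invr_ge0 mulr_ge0// ltW.
  apply: ge0_le_integral => //.
  - by move=> w _; rewrite -EFinM lee_fin mulr_ge0// invr_ge0 mulr_ge0// ltW.
  - by apply: measurable_funeM; apply/measurable_EFinP; exact: mdec.
  - apply/measurable_EFinP; apply: measurable_funM; first exact: mdec.
    have mr := @measurable_rateT R d dO Omega r U r0 U01 f hf f_neq0 c v mc mv n.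
    rewrite (_ : (fun w => _) = (fun w => powR (rate n w) (-1))).
      exact: (measurableT_comp (measurable_powR _) mr).
    by apply/funext => w; rewrite powR_inv1// ltW// rate_gt0.
  move=> w _; rewrite -EFinM lee_fin mulrC ler_wpM2l//.
  have rt0 := rate_gt0 r0 U01 hf f_neq0 c v n w.
  by rewrite lef_pV2 ?posrE ?mulr_gt0// ha.
have [n hn] := vanishing_decrement a0 e0 b0 hdec (divr_gt0 (mulr_gt0 kappa0 eps0) (ltr0n R 4)).
exists n; apply: (@le_lt_trans _ _ (eta + mass f / K + b n / kappa)%:E); last first.
  rewrite lte_fin.
  have h1 : b n / kappa < eps / 4 by rewrite ltr_pdivrMr// mulrC mulrA.
  have h2 : mass f / K <= eps / 4.
    rewrite ler_pdivrMr// /K.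
    rewrite (_ : eps / 4 * ((mass f + 1) * 4 / eps) = mass f + 1); first by rewrite lerDl.
    by field; rewrite gt_eqF.
  by rewrite /eta; lra.
rewrite EFinD EFinD (EFinM (mass f)) (EFinM (b n)) -bE.
rewrite -(expected_mass r0 U01 hf f_neq0 mtau mc mv law n).
have -> : eta%:E = (\int[P]_w (cst eta%:E w))%E.
  by rewrite integral_cst//= probability_setT mule1.
have mM := @measurable_state_mass R d dO Omega r U r0 U01 f hf f_neq0 c v mc mv n.
have iK0 : 0 <= K^-1 by rewrite invr_ge0 ltW.
have ik0 : 0 <= kappa^-1 by rewrite invr_ge0 ltW.
rewrite (muleC _ K^-1%:E) (muleC _ kappa^-1%:E).
rewrite -ge0_integralZl//; last 2 first.
- by apply/measurable_EFinP.
- by move=> w _; rewrite lee_fin.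
rewrite -ge0_integralZl//; last 2 first.
- by apply/measurable_EFinP; exact: mdec.
- by move=> w _; rewrite lee_fin.
have mm1 : measurable_fun setT (fun w => (K^-1)%:E * (M n w)%:E)%E.
  by apply: measurable_funeM; apply/measurable_EFinP.
have mm2 : measurable_fun setT (fun w => (kappa^-1)%:E * (decay delta (M n w))%:E)%E.
  by apply: measurable_funeM; apply/measurable_EFinP; exact: mdec.
have p1 w : (0 <= (K^-1)%:E * (M n w)%:E)%E by rewrite -EFinM lee_fin mulr_ge0.
have p2 w : (0 <= (kappa^-1)%:E * (decay delta (M n w))%:E)%E.
  by rewrite -EFinM lee_fin mulr_ge0.
have p3 w : (0 <= cst eta%:E (w : Omega))%E by rewrite /= lee_fin ltW.
rewrite -ge0_integralD// -ge0_integralD//; last 2 first.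
- by move=> w _; apply: adde_ge0.
- exact: emeasurable_funD.
apply: ge0_le_integral => //.
- by move=> w _; rewrite lee_fin sat_ge0.
- by apply/measurable_EFinP; exact: measurable_sat_mass.
- by apply: emeasurable_funD => //; exact: emeasurable_funD.
move=> w _; rewrite /= -!EFinM -!EFinD lee_fin (mulrC K^-1) (mulrC kappa^-1).
exact: hkappa.
Qed.

(** M - U H is nonnegative, and a red jump adds U w to it. *)
Lemma red_mass n w : red n w -> U * w0 <= M n.+1 w.
Proof.
move=> hr; have hS := state_Sc r0 U01 hf f_neq0 c v n w.
rewrite /state_mass stateS// mass_jump//; move: hr; rewrite /red_event => ->.
have := mass_down_ge0 r U01 (c n w) hS; rewrite mul1r mulrBr; lra.
Qed.

Definition red_between m n : set Omega :=
  \bigcup_(k in [set k | (m <= k < n)%N]) [set w | red k w].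

Lemma past_red k n : (k < n)%N -> past tau c v n [set w | red k w].
Proof.
move=> kn; have h := @measurable_red R d r U r0 U01 f hf f_neq0 _ (history tau c v n) c v n
  (@history_c _ _ _ _ tau c v n) (@history_v _ _ _ _ tau c v n) k kn.
by have := h measurableT [set true] I; rewrite setTI.
Qed.

Lemma past_red_between m n : past tau c v n (red_between m n).
Proof.
apply: (@bigcup_measurable _ (history tau c v n)) => k /= /andP[_ kn].
exact: past_red.
Qed.

Lemma red_betweenS m n : (m <= n)%N ->
  red_between m n.+1 = red_between m n `|` [set w | red n w].
Proof.
move=> mn; apply/seteqP; split => w.
  move=> [k /= /andP[mk]]; rewrite ltnS leq_eqVlt => /orP[/eqP ->|kn] kr; first by right.
  by left; exists k => //=; rewrite mk.
move=> [[k /= /andP[mk kn] kr]|nr]; last by exists n => //=; rewrite mn ltnSn.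
by exists k => //=; rewrite mk (leqW kn).
Qed.

(* Stopping the supermartingale [sat M] at the first red jump after time [m],
   where it is at least [theta]. *)
Let theta := sat (U * w0).

Lemma red_between_maximal m k :
  (theta%:E * P (red_between m (m + k)) +
     \int[P]_(w in ~` red_between m (m + k)) (sat (M (m + k) w))%:E <=
   \int[P]_w (sat (M m w))%:E)%E.
Proof.
have theta0 : 0 <= theta.
  by apply: sat_ge0; rewrite mulr_ge0// ltW.
have [delta delta0 hstep] := sat_mass_step d0 r0 U01 hf f_neq0 mtau mc mv law.
have mred n : measurable [set w | red n w].
  by apply: (past_measurable mtau mc mv); exact: (past_red (ltnSn n)).
have mrb n : measurable (red_between m n).
  by apply: (past_measurable mtau mc mv); exact: past_red_between.
have ms n : measurable_fun setT (fun w => (sat (M n w))%:E).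
  by apply/measurable_EFinP; exact: measurable_sat_mass.
have s0 n w : (0 <= (sat (M n w))%:E)%E by rewrite lee_fin sat_ge0.
elim: k => [|k IH].
  rewrite addn0 (_ : red_between m m = set0); last first.
    by rewrite -subset0 => w [j /= /andP[mj jm]]; move: (leq_trans jm mj); rewrite ltnn.
  by rewrite measure0 mule0 add0e setC0.
apply: le_trans IH; rewrite addnS.
(* A means a red jump in [m, n) and B, below, one at n: the part of B outside A is the event that
   the first red jump from m on happens at n, and there [red_mass] bounds [sat M] below by theta. *)
set n := (m + k)%N; set A := red_between m n.
have mA : measurable A by exact: mrb.
have mnA : measurable (~` A) by exact: measurableC.
have mnr : measurable (~` [set w | red n w]) by exact: measurableC.
rewrite (red_betweenS (leq_addr k m)) -/A setCU.
set B := [set w | red n w] in mnr *.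
have mB : measurable B by exact: mred.
have mAB : measurable (~` A `&` B) by exact: measurableI.
have mAnB : measurable (~` A `&` ~` B) by exact: measurableI.
have -> : P (A `|` B) = (P A + P (~` A `&` B))%E.
  rewrite (_ : A `|` B = A `|` (~` A `&` B)); last first.
    by rewrite setUIr setUv setTI.
  by rewrite measureU// setIA setICr set0I.
have pA : (0 <= P A)%E by exact: measure_ge0.
have pAB : (0 <= P (~` A `&` B))%E by exact: measure_ge0.
rewrite (ge0_muleDr _ pA pAB).
rewrite -addeA; apply: leeD2l.
have pnA : past tau c v n (~` A).
  by apply: (@measurableC _ (history tau c v n)); exact: past_red_between.
apply: (@le_trans _ _ (\int[P]_(w in ~` A) (sat (M n.+1 w))%:E)%E); last first.
  apply: le_trans (hstep n _ pnA); rewrite leeDl//; apply: integral_ge0 => w _.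
  by rewrite lee_fin divr_ge0 ?decay_ge0// ltW// rate_gt0.
have -> : (\int[P]_(w in ~` A) (sat (M n.+1 w))%:E =
    \int[P]_(w in ~` A `&` B) (sat (M n.+1 w))%:E +
    \int[P]_(w in ~` A `&` ~` B) (sat (M n.+1 w))%:E)%E.
  rewrite -ge0_integral_setU//; first by rewrite -setIUr setUv setIT.
    exact: measurable_funTS.
  by apply/disj_setPS => w [[_ Bw] [_ nBw]].
apply: leeD2r; rewrite -integral_cst//; apply: ge0_le_integral => //.
- exact: measurable_funTS.
move=> w [_ Bw]; rewrite lee_fin; apply: sat_le; first by rewrite mulr_ge0// ltW.
exact: red_mass.
Qed.

Lemma red_after_prob m :
  (theta%:E * P (\bigcup_k red_between m (m + k)) <= \int[P]_w (sat (M m w))%:E)%E.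
Proof.
have theta0 : 0 <= theta by apply: sat_ge0; rewrite mulr_ge0// ltW.
have mrb n : measurable (red_between m n).
  by apply: (past_measurable mtau mc mv); exact: past_red_between.
have cv : (P \o (fun k => red_between m (m + k))) @ \oo -->
    P (\bigcup_k red_between m (m + k)).
  apply: nondecreasing_cvg_mu => //; first exact: bigcup_measurable.
  move=> k l kl; apply/subsetPset => w [j /= /andP[mj jk] jr]; exists j => //=.
  by rewrite mj (leq_trans jk)// leq_add2l.
have cv' := cvgeZl (isT : theta%:E \is a fin_num) cv.
rewrite -(cvg_lim _ cv')//; apply: lime_le; first by apply/cvg_ex; eexists; exact: cv'.
apply: nearW => k /=; apply: le_trans (red_between_maximal m k).
by rewrite leeDl//; apply: integral_ge0 => w _; rewrite lee_fin sat_ge0.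
Qed.

Lemma finitely_many_red : {ae P, forall w, exists N, forall n, (N <= n)%N -> ~~ red n w}.
Proof.
have theta0 : 0 < theta by apply: divr_gt0; rewrite ?ltr_pwDl ?mulr_gt0// ltW// mulr_gt0.
pose Z := \bigcap_m \bigcup_k red_between m (m + k).
have mrb m : measurable (\bigcup_k red_between m (m + k)).
  apply: bigcup_measurable => k _.
  by apply: (past_measurable mtau mc mv); exact: past_red_between.
have mZ : measurable Z by exact: bigcapT_measurable.
exists Z; split => //; last first.
  move=> w /= hw m _; apply: contrapT => hm; apply: hw; exists m => n mn.
  apply/negP => nr; apply: hm; exists (n - m).+1 => //; exists n => //=.
  by rewrite mn addnS subnKC// ltnSn.
apply/eqP; rewrite eq_le measure_ge0 andbT.
apply/lee_addgt0Pr => eps eps0; rewrite add0e.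
(* One index m with mean below theta eps is enough, because Z is contained in the event of a red
   jump from m on. *)
have [m hm] := inf_expected_sat_mass (mulr_gt0 theta0 eps0).
apply: (@le_trans _ _ (P (\bigcup_k red_between m (m + k)))).
  by apply: le_measure; rewrite ?inE// => w; apply.
rewrite -(@lee_pmul2l _ theta%:E)// ?lte_fin// -EFinM.
by rewrite (le_trans (red_after_prob m))// ltW.
Qed.

End finitely_many_red_events.

(** * Recurrence of the centres *)

Section recurrent_hits.
Context {R : realType} {d : nat} {dO : measure_display} {Omega : measurableType dO}.
Variables r U : R.
Hypotheses (r0 : 0 < r) (U01 : 0 < U < 1).
Variables (f : 'rV[R]_d -> R).
Hypotheses (hf : Sc f) (f_neq0 : supp f !=set0).
Variables (P : probability Omega R).
Variables (tau : nat -> Omega -> R) (c : nat -> Omega -> 'rV[R]_d) (v : nat -> Omega -> R).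
Hypotheses (mtau : forall n, measurable_fun setT (tau n))
  (mc : forall n, measurable_fun setT (c n)) (mv : forall n, measurable_fun setT (v n)).
Hypothesis law : draws_law r U f tau c v P.
Local Notation mu := (@lebesgue_rV R d).
Local Notation state := (state r U f c v).
Local Notation rate := (rate r U f c v).
Local Notation h := (r / 2).
Local Notation vol := (@ball_vol R d h).

Let h0 : 0 < h. Proof. by rewrite divr_gt0. Qed.

(** The radius h = r / 2 serves twice: a ball of radius h meeting the support stays within r of it,
    so that centres can fall anywhere in this ball, and a centre falling in the ball covers all of
    it. *)
Definition reachable q N : set Omega := [set w | enlarge h (supp (state N w)) q].

Definition missed q N n : set Omega := reachable q N `\`
  \bigcup_(k in [set k | (N <= k < n)%N]) (c k @^-1` eball q h).

Lemma past_missed q N n : (N <= n)%N -> past tau c v n (missed q N n).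
Proof.
move=> Nn; have mD := @measurable_draw_region R d r U r0 U01 f hf f_neq0 _
  (history tau c v n) c v n (@history_c _ _ _ _ tau c v n) (@history_v _ _ _ _ tau c v n)
  h N h0 Nn.
apply: (@measurableD _ (history tau c v n)).
  have := measurable_ysection q mD; congr measurable.
  by apply/seteqP; split => w; rewrite /ysection/= inE.
apply: (@bigcup_measurable _ (history tau c v n)) => k /= /andP[_ kn].
have := @history_c _ _ _ _ tau c v n k kn measurableT _ (measurable_eball q h).
by rewrite setTI.
Qed.

Lemma missedS q N n : (N <= n)%N ->
  missed q N n.+1 = missed q N n `\` (missed q N n `&` c n @^-1` eball q h).
Proof.
move=> Nn; apply/seteqP; split => w.
  move=> [wN wm]; split; last first.
    by move=> [_ wn]; apply: wm; exists n => //=; rewrite Nn ltnSn.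
  split => // -[k /= /andP[Nk kn] kw]; apply: wm; exists k => //=.
  by rewrite Nk (leqW kn).
move=> [[wN wm] wn]; split => // -[k /= /andP[Nk]].
rewrite ltnS leq_eqVlt => /orP[/eqP ->|kn] kw.
  by apply: wn; split.
by apply: wm; exists k => //=; rewrite Nk.
Qed.

(** Supports only grow, so a ball reachable at N stays inside the region of centres, and the
    conditional probability of hitting it is its volume divided by the rate. *)
Lemma hit_prob (a : R) q N n : (N <= n)%N ->
  (forall m w, rate m w <= a * m.+1%:R) -> 0 < a ->
  ((vol / (a * n.+1%:R))%:E * P (missed q N n) <=
    P (missed q N n `&` c n @^-1` eball q h))%E.
Proof.
move=> Nn ha a0; set G := missed q N n.
have pG : past tau c v n G by exact: past_missed.
have mG : measurable G by exact: (history_subset mtau mc mv pG).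
have := law (D := setT) (V := setT) pG measurableT (measurable_eball q h) measurableT.
have -> : G `&` [set w | (0 < jump_rate r (state n w))%E] = G.
  by apply/seteqP; split => w /=; [case|move=> Aw; split => //; exact: state_rate_gt0].
rewrite !preimage_setT setTI setIT => ->.
rewrite -integral_cst//.
have fE : {in G, forall w, (exponential_prob (fine (jump_rate r (state n w))) setT *
     uniform_on (enlarge r (supp (state n w))) (eball q h) *
     uniform_prob (@ltr01 R) setT = (vol * (rate n w)^-1)%:E)%E}.
  move=> w; rewrite inE => -[wN _].
  have rt0 : (0 < fine (jump_rate r (state n w)))%R by exact: rate_gt0.
  rewrite {1}/exponential_prob integral_exponential_pdf// mul1e.
  rewrite [X in (_ * X)%E](_ : _ = 1%E); last exact: probability_setT.
  rewrite mule1 /uniform_on setIidl ?lebesgue_rV_eball -?EFinM//.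
  move=> x xq; case: wN => y yN qy.
  exists y.
    exact: (@supp_state_nondecreasing R d dO Omega r U r0 U01 f hf f_neq0 c v
      N n w Nn y yN).
  rewrite (le_trans (enorm_triangle q _ _))//.
  by rewrite [leRHS](splitr r) lerD.
rewrite [leRHS](eq_integral _ _ fE).
have mr := @measurable_rateT R d dO Omega r U r0 U01 f hf f_neq0 c v mc mv n.
have mr1 : measurable_fun setT (fun w => (vol * (rate n w)^-1)%:E).
  apply/measurable_EFinP; apply: measurable_funM => //.
  rewrite (_ : (fun w => _) = (fun w => powR (rate n w) (-1))).
    exact: (measurableT_comp (measurable_powR _) mr).
  by apply/funext => w; rewrite powR_inv1// ltW// rate_gt0.
apply: ge0_le_integral => //.
- by move=> w _; rewrite lee_fin divr_ge0 ?ball_vol_ge0// mulr_ge0// ltW.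
- exact: measurable_funTS.
move=> w _; rewrite lee_fin ler_wpM2l ?ball_vol_ge0//.
have rt0 := rate_gt0 r0 U01 hf f_neq0 c v n w.
by rewrite lef_pV2 ?posrE ?mulr_gt0// ha.
Qed.

Lemma missed_forever_prob0 q N : P (\bigcap_k missed q N (N + k)) = 0%E.
Proof.
have [a a0 ha] := rate_linear r0 U01 hf f_neq0 c v.
have mm k : measurable (missed q N (N + k)).
  exact: (history_subset mtau mc mv (past_missed q (leq_addr k N))).
pose p k := fine (P (missed q N (N + k))).
have pE k : P (missed q N (N + k)) = (p k)%:E by rewrite fineK// fin_num_measure.
have p0 k : 0 <= p k by rewrite -lee_fin -pE.
have vol0 : 0 < vol by exact: ball_vol_gt0.
have vp0 k : 0 <= vol * p k by rewrite mulr_ge0// ltW.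
(* N + k + 1 <= (N + 1) (k + 1) brings the rate bound to the form C (k + 1) of
   [vanishing_decrement]. *)
have C0 : 0 < a * N.+1%:R by rewrite mulr_gt0.
have step k : p k.+1 + vol * p k / (a * N.+1%:R * k.+1%:R) <= p k.
  have := hit_prob q (leq_addr k N) ha a0; rewrite pE => hp.
  have mh : measurable (c (N + k)%N @^-1` eball q h).
    by rewrite -[X in measurable X]setTI; apply: mc => //; exact: measurable_eball.
  have mI : measurable (missed q N (N + k) `&` c (N + k)%N @^-1` eball q h).
    exact: measurableI.
  have IE : P (missed q N (N + k) `&` c (N + k)%N @^-1` eball q h) =
      (fine (P (missed q N (N + k) `&` c (N + k)%N @^-1` eball q h)))%:E.
    by rewrite fineK// fin_num_measure.
  have : P (missed q N (N + k.+1)) =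
      (P (missed q N (N + k)) - P (missed q N (N + k) `&` c (N + k)%N @^-1` eball q h))%E.
    rewrite addnS missedS ?leq_addr// measureD//.
      by rewrite setIA setIid.
    by rewrite (le_lt_trans (probability_le1 _ _))// ltry.
  rewrite !pE IE -EFinB => -[->].
  move: hp; rewrite IE -EFinM lee_fin => hp.
  rewrite -[leRHS](subrK (fine (P (missed q N (N + k) `&` c (N + k)%N @^-1` eball q h)))).
  rewrite lerD2l (le_trans _ hp)//.
  rewrite mulrAC ler_wpM2r// ler_wpM2l ?(ltW vol0)//.
  rewrite lef_pV2 ?posrE ?mulr_gt0// -mulrA ler_wpM2l ?(ltW a0)// -natrM ler_nat.
  by rewrite mulSn mulnS addnA [(k.+1 + N)%N]addnC addnS leq_addr.
apply/eqP; rewrite eq_le measure_ge0 andbT; apply/lee_addgt0Pr => eps eps0.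
rewrite add0e.
have [k hk] := vanishing_decrement C0 p0 vp0 step (mulr_gt0 vol0 eps0).
rewrite (@ltr_pM2l _ vol)// in hk.
apply: (@le_trans _ _ (P (missed q N (N + k)))); last by rewrite pE lee_fin ltW.
apply: le_measure; rewrite ?inE//; first exact: bigcapT_measurable.
by move=> w; apply.
Qed.

(** Rational centres leave only countably many null events to discard, and by density their balls
    still cover every compact support. *)
Lemma hit_infinitely_often : {ae P, forall w, forall (q : 'rV[rat]_d) N,
  let y := map_mx (@ratr R) q in enlarge h (supp (state N w)) y ->
  exists2 n, (N <= n)%N & eball y h (c n w)}.
Proof.
pose Z (k : nat) : set Omega := if unpickle k is Some (q, N)
  then \bigcap_j missed (map_mx (@ratr R) (q : 'rV[rat]_d)) N (N + j) else set0.
have mZ k : measurable (Z k).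
  rewrite /Z; case: (unpickle k) => [[q N]|//]; apply: bigcapT_measurable => j.
  exact: (history_subset mtau mc mv (past_missed _ (leq_addr j N))).
have : P.-negligible (\bigcup_k Z k).
  apply: negligible_bigcup => k; apply/(negligibleP _ (mZ k)).
  rewrite /Z; case: (unpickle k) => [[q N]|]; last exact: measure0.
  exact: missed_forever_prob0.
apply: negligibleS => w /= /existsNP[q /existsNP[N]].
move=> /not_implyP[hq hn]; exists (pickle (q, N)) => //.
rewrite /Z pickleK => j _; split => // -[k /= /andP[Nk _] kw].
by apply: hn; exists k.
Qed.

End recurrent_hits.

(** * Decay along a path *)

Lemma ratr_dense_rV {R : realType} {d : nat} (x : 'rV[R]_d) (eps : R) : 0 < eps ->
  exists q : 'rV[rat]_d, enorm (x - map_mx (@ratr R) q) < eps.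
Proof.
move=> eps0; pose K : R := Num.sqrt d%:R + 1.
have K0 : 0 < K by rewrite ltr_wpDl ?sqrtr_ge0.
pose e := eps / K / 2; have e0 : 0 < e by rewrite !divr_gt0.
have /choice[q hq] : forall i : 'I_d, exists q : rat, `|x 0 i - ratr q| < e.
  move=> i; have [|q] := @rat_in_itvoo R (x 0 i - e) (x 0 i + e).
    by rewrite ltrD2l gtrN.
  rewrite in_itv/= => /andP[q1 q2]; exists q; rewrite ltr_norml.
  by apply/andP; split; lra.
exists (\row_i q i); apply: (le_lt_trans (enorm_le_norm _)).
have h : `|x - map_mx (@ratr R) (\row_i q i)| <= e.
  have -> (z : 'rV[R]_d) : `|z| = mx_norm z by [].
  rewrite mx_normrE; apply/bigmax_leP; split => [|[i j] _ /=]; first exact: ltW.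
  by rewrite ord1 !mxE ltW.
apply: (@le_lt_trans _ _ (Num.sqrt d%:R * e)); first by rewrite ler_wpM2l ?sqrtr_ge0.
apply: (@lt_trans _ _ (K * e)); first by rewrite ltr_pM2r// ltrDl.
rewrite /e mulrA mulrCA divff ?gt_eqF// mulr1 ltr_pdivrMr//; lra.
Qed.

Section pathwise.
Context {R : realType} {d : nat} {dO : measure_display} {Omega : measurableType dO}.
Variables r U : R.
Hypotheses (r0 : 0 < r) (U01 : 0 < U < 1).
Variables (f : 'rV[R]_d -> R).
Hypotheses (hf : Sc f) (f_neq0 : supp f !=set0).
Variables (c : nat -> Omega -> 'rV[R]_d) (v : nat -> Omega -> R).
Local Notation state := (state r U f c v).
Local Notation red := (red_event r U f c v).
Local Notation h := (r / 2).

Let h0 : 0 < h. Proof. by rewrite divr_gt0. Qed.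
Let U0 : 0 < U. Proof. by case/andP: U01. Qed.
Let U1 : U < 1. Proof. by case/andP: U01. Qed.

Variables (w : Omega) (N : nat).
Hypothesis no_red : forall n, (N <= n)%N -> ~~ red n w.
Hypothesis hits : forall (q : 'rV[rat]_d) n,
  let y := map_mx (@ratr R) q in enlarge h (supp (state n w)) y ->
  exists2 m, (n <= m)%N & eball y h (c m w).

Lemma state_no_red n x : (N <= n)%N ->
  state n.+1 w x = state n w x * (1 - U * kern r (c n w) x).
Proof.
move=> Nn; rewrite stateS// jumpE (negbTE (no_red Nn : ~~ (v n w <= _))) sub0r; ring.
Qed.

Lemma supp_state_no_red n : (N <= n)%N -> supp (state n w) = supp (state N w).
Proof.
move=> Nn; rewrite -(subnKC Nn); elim: (n - N)%N => [|k IH]; first by rewrite addn0.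
by rewrite addnS supp_stateS// (negbTE (no_red (leq_addr k N))).
Qed.

Lemma state_nonincreasing m n x : (N <= m)%N -> (m <= n)%N -> state n w x <= state m w x.
Proof.
move=> Nm mn; rewrite -(subnKC mn); elim: (n - m)%N => [|k IH]; first by rewrite addn0.
rewrite addnS state_no_red ?(leq_trans Nm (leq_addr _ _))//; apply: le_trans IH.
have s0 := Sc_ge0 x (state_Sc r0 U01 hf f_neq0 c v (m + k) w).
have /andP[k0 _] := kern_itv r (c (m + k)%N w) x.
by rewrite ler_piMr// gerBl mulr_ge0// ltW.
Qed.

(** Induction on the number k of hits: from N on the state never increases, and a hit multiplies it
    by 1 - U on the whole small ball. *)
Lemma state_local_decay (q : 'rV[rat]_d) k : let y := map_mx (@ratr R) q in
  enlarge h (supp (state N w)) y ->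
  exists2 m, (N <= m)%N & forall n x, (m <= n)%N -> eball y h x ->
    state n w x <= (1 - U) ^+ k.
Proof.
move=> y hy; elim: k => [|k [m Nm IH]].
  exists N => // n x _ _; rewrite expr0.
  exact: Sc_le1 (state_Sc r0 U01 hf f_neq0 c v n w).
have [|m' mm' hit] := @hits q m; first by rewrite supp_state_no_red.
have Nm' := leq_trans Nm mm'.
exists m'.+1 => [|n x mn yx]; first exact: leqW.
apply: (le_trans (state_nonincreasing x (leqW Nm') mn)).
rewrite state_no_red// exprSr.
have -> : kern r (c m' w) x = 1.
  rewrite /kern (_ : enorm _ <= r)// (le_trans (enorm_triangle y _ _))//.
  by rewrite [leRHS](splitr r) lerD// enormBC.
rewrite mulr1; apply: ler_wpM2r; first by rewrite subr_ge0 ltW.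
exact: IH.
Qed.

Lemma state_decay (eps : R) : 0 < eps -> exists2 m, (N <= m)%N &
  forall n x, (m <= n)%N -> supp (state N w) x -> state n w x <= eps.
Proof.
move=> eps0.
have [k hk] : exists k : nat, (1 - U) ^+ k <= eps.
  have U1' : `|1 - U| < 1 by rewrite ger0_norm ?subr_ge0 ?ltW// gtrBl.
  have /cvgrPdist_le/(_ _ eps0)[k _ /(_ k (leqnn _))] := cvg_expr U1'.
  rewrite sub0r normrN => hk; exists k; exact: le_trans (ler_norm _) hk.
have cS : compact (supp (state N w)).
  by have [] := state_Sc r0 U01 hf f_neq0 c v N w.
rewrite compact_cover in cS.
pose y (q : 'rV[rat]_d) := map_mx (@ratr R) q.
pose D := [set q : 'rV[rat]_d | enlarge h (supp (state N w)) (y q)].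
have [||D' D'D cover] := cS _ D (fun q => [set x | enorm (x - y q) < h]).
- by move=> q _; exact: open_eball.
- move=> x Sx; have [q hq] := ratr_dense_rV x h0; exists q => //=.
  by exists x => //; rewrite enormBC ltW.
have /choice[m hm] : forall q, exists m, D q -> (N <= m)%N /\ forall n x, (m <= n)%N ->
    eball (y q) h x -> state n w x <= (1 - U) ^+ k.
  move=> q; have [Dq|] := pselect (D q); last by exists 0%N.
  by have [m Nm hm] := state_local_decay k Dq; exists m.
exists (maxn N (\max_(q <- finmap.enum_fset D') m q)); first exact: leq_maxl.
move=> n x; rewrite geq_max => /andP[Nn mn] Sx.
have [q /= qD' xq] := cover _ Sx.
have [|Nm hq] := hm q; first by have := D'D _ qD'; rewrite inE.
apply: le_trans hk; apply: hq; last exact: ltW.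
by apply: leq_trans mn; exact: leq_bigmax_seq.
Qed.

End pathwise.

(** * Limit support and last red time *)

Section limit_support.
Context {R : realType} {d : nat} {dO : measure_display} {Omega : measurableType dO}.
Variables r U : R.
Hypotheses (r0 : 0 < r) (U01 : 0 < U < 1).
Variables (f : 'rV[R]_d -> R).
Hypotheses (hf : Sc f) (f_neq0 : supp f !=set0).
Variables (tau : nat -> Omega -> R) (c : nat -> Omega -> 'rV[R]_d) (v : nat -> Omega -> R).
Hypotheses (mtau : forall n, measurable_fun setT (tau n))
  (mc : forall n, measurable_fun setT (c n)) (mv : forall n, measurable_fun setT (v n)).
Local Notation state := (state r U f c v).
Local Notation red := (red_event r U f c v).

Definition eventually_no_red : set Omega :=
  [set w | exists N, forall n, (N <= n)%N -> ~~ red n w].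

Definition red_from n : set Omega := [set w | exists2 k, (n <= k)%N & red k w].

(** Made empty on the null event of infinitely many red jumps, so that boundedness holds for every
    sample. *)
Definition limit_support (w : Omega) : set 'rV[R]_d := [set x | eventually_no_red w /\
  (supp f `|` \bigcup_(k in [set k | red k w]) eball (c k w) r) x].

(* The maximum with 0 spares a proof that [tau k] is almost surely nonnegative. *)
Definition last_red_time (w : Omega) : \bar R :=
  (\sum_(k <oo) ((\1_(red_from k) w : R) * Num.max (tau k w) 0)%:E)%E.

Lemma measurable_set_red k : measurable [set w | red k w].
Proof.
have h := @measurable_red R d r U r0 U01 f hf f_neq0 _ Omega c v k.+1
  (fun k _ => mc k) (fun k _ => mv k) k (ltnSn k).
by have := h measurableT [set true] I; rewrite setTI.
Qed.

Lemma measurable_red_from n : measurable (red_from n).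
Proof.
rewrite (_ : red_from n = \bigcup_(k in [set k | (n <= k)%N]) [set w | red k w]).
  by apply: bigcup_measurable => k _; exact: measurable_set_red.
by apply/seteqP; split => w [k]; exists k.
Qed.

Lemma measurable_eventually_no_red : measurable eventually_no_red.
Proof.
rewrite (_ : eventually_no_red = \bigcup_n ~` red_from n).
  by apply: bigcup_measurable => n _; apply: measurableC; exact: measurable_red_from.
apply/seteqP; split => w.
  by move=> [N hN]; exists N => // -[k Nk]; apply/negP; exact: hN.
move=> [N _ hN]; exists N => n Nn; apply/negP => nr; apply: hN.
by exists n.
Qed.

Lemma last_red_time_term_ge0 k w :
  (0 <= ((\1_(red_from k) w : R) * Num.max (tau k w) 0)%:E)%E.
Proof. by rewrite lee_fin mulr_ge0// ?indicE// le_max lexx orbT. Qed.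

Lemma last_red_time_ge0 w : (0 <= last_red_time w)%E.
Proof. by apply: nneseries_ge0 => k _ _; exact: last_red_time_term_ge0. Qed.

Lemma measurable_last_red_time : measurable_fun setT last_red_time.
Proof.
apply: ge0_emeasurable_sum => [k w _ _|k _]; first exact: last_red_time_term_ge0.
apply/measurable_EFinP; apply: measurable_funM.
  exact: (measurable_indic (measurable_red_from k)).
exact: measurable_maxr.
Qed.

Lemma last_red_time_lty w : eventually_no_red w -> (last_red_time w < +oo)%E.
Proof.
move=> [N hN]; rewrite /last_red_time (nneseries_split 0 N); last first.
  by move=> k _; exact: last_red_time_term_ge0.
rewrite eseries0 ?adde0; last first.
  move=> k Nk _; rewrite indicE memNset ?mul0r// => -[j kj].
  by apply/negP; apply: hN; apply: leq_trans kj; rewrite add0n in Nk.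
by rewrite sumEFin ltry.
Qed.

Lemma limit_supportE w N : (forall n, (N <= n)%N -> ~~ red n w) ->
  limit_support w = supp (state N w).
Proof.
move=> hN; rewrite supp_state//; apply/seteqP; split => x.
  move=> [_ [fx|[k /= kr kx]]]; first by left.
  right; exists k => //=; rewrite kr andbT ltnNge.
  by apply/negP => /hN; rewrite kr.
move=> hx; split; first by exists N.
case: hx => [fx|[k /= /andP[_ kr] kx]]; first by left.
by right; exists k.
Qed.

Lemma bounded_limit_support w : bounded_set (limit_support w).
Proof.
have [[N hN]|hw] := pselect (eventually_no_red w).
  by rewrite (limit_supportE hN); exact: Sc_bounded_supp (state_Sc r0 U01 hf f_neq0 c v N w).
rewrite (_ : limit_support w = set0); first by exists 0; split=> // M _ x.
by rewrite -subset0 => x [].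
Qed.

(** A ball of radius r meets G exactly when its centre lies in [enlarge r G], which is open. *)
Lemma random_limit_support : random_set limit_support.
Proof.
move=> G oG.
rewrite (_ : [set w | _] = eventually_no_red `&` ([set w | supp f `&` G !=set0] `|`
   \bigcup_k ([set w | red k w] `&` (c k @^-1` enlarge r G)))).
  apply: measurableI; first exact: measurable_eventually_no_red.
  apply: measurableU.
    have [h|h] := pselect (supp f `&` G !=set0).
      by rewrite (_ : [set w | _] = setT)//; apply/seteqP; split.
    by rewrite (_ : [set w | _] = set0)//; apply/seteqP; split.
  apply: bigcup_measurable => k _; apply: measurableI; first exact: measurable_set_red.
  rewrite -[X in measurable X]setTI; apply: mc => //.
  by apply: open_measurable_rV; exact: open_enlarge.
apply/seteqP; split => w.
  move=> [x [[wA [fx|[k /= kr kx]]] Gx]]; split => //; first by left; exists x.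
  by right; exists k => //; split => //=; exists x => //; rewrite enormBC.
move=> [wA [[x [fx Gx]]|[k _ [/= kr [x Gx xk]]]]]; exists x.
  by split => //; split => //; left.
by split => //; split => //; right; exists k => //=; rewrite /eball/= enormBC.
Qed.

Lemma jump_timeE n w : jump_time r U f tau c v n w = (\sum_(k < n) (tau k w)%:E)%E.
Proof.
apply: eq_bigr => k _; rewrite /sojourn gt_eqF//; exact: state_rate_gt0.
Qed.

(** With a red jump at some j >= n, every index k <= n has indicator 1, so the series dominates the
    first n + 1 waiting times. By contraposition, no red jump remains ahead at a time beyond
    [last_red_time]. *)
Lemma jump_time_le_last_red_time n w : red_from n w ->
  (jump_time r U f tau c v n.+1 w <= last_red_time w)%E.
Proof.
move=> [j nj jr]; rewrite jump_timeE /last_red_time.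
apply: (@le_trans _ _ (\sum_(0 <= k < n.+1) ((\1_(red_from k) w : R) * Num.max (tau k w) 0)%:E)%E).
  rewrite big_mkord; apply: lee_sum => k _; rewrite lee_fin indicE mem_set ?mul1r.
    by rewrite le_max lexx.
  by exists j => //; rewrite (leq_trans _ nj)// -ltnS.
by apply: nneseries_lim_ge => k _ _; exact: last_red_time_term_ge0.
Qed.

(** Taking the least index whose jump time exceeds t avoids any appeal to monotonicity of the jump
    times; t >= 0 excludes the index 0. *)
Lemma time_in_jump_interval w (t : R) : 0 <= t ->
  (exists n, (t%:E < jump_time r U f tau c v n w)%E) ->
  exists n, (jump_time r U f tau c v n w <= t%:E < jump_time r U f tau c v n.+1 w)%E.
Proof.
move=> t0 hex; case: (ex_minnP hex) => -[|n] hn nmin.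
  by move: hn; rewrite /jump_time big_ord0 lte_fin ltNge t0.
exists n; rewrite hn andbT leNgt; apply/negP => /nmin.
by rewrite ltnn.
Qed.

End limit_support.

Theorem theorem1p3 (R : realType) (d : nat) (hd : (1 <= d)%N)
    (r U : R) (hr : 0 < r) (hU : 0 < U < 1)
    (dO : measure_display) (Omega : measurableType dO)
    (P : probability Omega R)
    (f : 'rV[R]_d -> R) (hf : Sc f)
    (X : R -> Omega -> 'rV[R]_d -> R)
    (hX : jump_process P r U f X) :
  exists (B : Omega -> set 'rV[R]_d) (T : Omega -> \bar R),
    [/\ random_set B /\ (forall w, bounded_set (B w)),
        measurable_fun setT T /\ (forall w, (0 <= T w)%E),
        {ae P, forall w, (T w < +oo)%E},
        {ae P, forall w, forall t : R, (T w < t%:E)%E -> supp (X t w) = B w}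
      & {ae P, forall w,
          sup [set X t w z | z in B w] @[t --> +oo] --> (0 : R)}].
Proof.
case: hX => X_Sc [tau [c [v [mtau mc mv law nonexp path]]]].
have [f_neq0|f0] := pselect (supp f !=set0); last first.
  (* The zero state is absorbing: take the empty set and T = 0, the supremum over the empty set
     being 0. *)
  have sf0 : supp f = set0 by apply/seteqP; split => x // fx; apply: f0; exists x.
  have rate0 : jump_rate r f = 0%E.
    rewrite /jump_rate sf0 (_ : enlarge r set0 = set0) ?measure0//.
    by rewrite -subset0 => x [].
  exists (fun=> set0), (fun=> 0%E); split.
  - split => [G _|w]; last by exists 0; split=> // M _ x.
    rewrite (_ : [set w | _] = set0)//.
    by rewrite -subset0 => w [x []].
  - by split.
  - by apply: aeW => w; rewrite ltry.
  - apply: filterS path => w hw t; rewrite lte_fin => t0.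
    have := hw 0%N t; rewrite /jump_time big_ord0 big_ord1 /sojourn/= rate0 eqxx.
    by rewrite lee_fin (ltW t0) ltry => /(_ isT) ->.
  - apply: aeW => w; rewrite (_ : (fun t => _) = cst 0); first exact: cvg_cst.
    by apply/funext => t; rewrite image_set0 sup0.
have noredae := finitely_many_red hd hr hU hf f_neq0 mtau mc mv law.
have hitsae := hit_infinitely_often hr hU hf f_neq0 mtau mc mv law.
exists (limit_support r U f c v), (last_red_time r U f tau c v); split.
- by split; [exact: random_limit_support|exact: bounded_limit_support].
- by split; [exact: measurable_last_red_time|exact: last_red_time_ge0].
- by apply: filterS noredae => w; exact: last_red_time_lty.
- apply: filterS3 noredae nonexp path => w hw wexp wpath t Tt.
  have t0 : 0 <= t.
    by rewrite -lee_fin (le_trans (last_red_time_ge0 r U f tau c v w))// ltW.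
  have [n hn] := time_in_jump_interval t0 (wexp t).
  rewrite (wpath n t hn) (@limit_supportE R d dO Omega r U hr hU f hf f_neq0 c v w n)//.
  (* A red jump of index k >= n would force the end of the jump interval containing t to be at most
     T, hence before t. *)
  move=> k nk; apply/negP => kr; have /andP[_] := hn.
  rewrite ltNge; apply/negP; rewrite negbK.
  apply/ltW/(le_lt_trans _ Tt); apply: jump_time_le_last_red_time => //.
  by exists k.
apply: filterS (filterI path (filterI nonexp (filterI noredae hitsae))).
move=> w [wpath [wexp [[N hN] whits]]].
apply/cvgrPdist_le => eps eps0.
have [m Nm hm] := state_decay hr hU hf f_neq0 hN whits eps0.
(* t1 dominates the first m jump times, the maxima making partial sums monotone, so beyond t1 at
   least m jumps have occurred. *)
pose t1 := \sum_(k < m) Num.max (tau k w) 0.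
near=> t.
have t10 : 0 <= t1 by apply: sumr_ge0 => k _; rewrite le_max lexx orbT.
have t1t : t1 < t by near: t; apply: nbhs_pinfty_gt; exact: num_real.
have [n hn] := time_in_jump_interval (le_trans t10 (ltW t1t)) (wexp t).
have mn : (m <= n)%N.
  rewrite leqNgt; apply/negP => nm; have /andP[_] := hn.
  rewrite jump_timeE// sumEFin lte_fin ltNge; apply/negP; rewrite negbK.
  apply: le_trans (ltW t1t); rewrite /t1.
  rewrite -(big_mkord xpredT (fun k => tau k w)) -(big_mkord xpredT (fun k => Num.max (tau k w) 0)).
  rewrite [leRHS](big_cat_nat (leq0n _) nm)//= -[leLHS]addr0 lerD//.
    by apply: ler_sum => k _; rewrite le_max lexx.
  by apply: sumr_ge0 => k _; rewrite le_max lexx orbT.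
rewrite (wpath n t hn) (limit_supportE hr hU hf f_neq0 hN).
set S := [set _ | _ in _].
have hS z : S z -> 0 <= z <= eps.
  move=> [x xN <-]; rewrite hm// andbT.
  exact: Sc_ge0 (state_Sc hr hU hf f_neq0 c v n w).
(* [sup] is a genuine supremum only on a nonempty bounded set, so a point of the support is
   exhibited. *)
have [x xN] : supp (state r U f c v N w) !=set0.
  by have [] := state_Sc_supp hr hU hf f_neq0 c v N w.
have Sx : S (state r U f c v n w x) by exists x.
have ubS : ubound S eps by move=> z /hS/andP[].
rewrite sub0r normrN ger0_norm.
  by apply: ge_sup => //; exists (state r U f c v n w x).
have /andP[s0 _] := hS _ Sx.
by apply: (le_trans s0); apply: ub_le_sup Sx; exists eps.
Unshelve. all: by end_near. Qed.
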